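(* Let $\mathbf f$ be a projection in $\mathcal C(I)$ with a projection-valued local lifting $(f_0,\dots,f_n)$ over a partition $x_1<\dots<x_n$ of $X$ into closed subintervals $X_0,\dots,X_n$. Put $k_i=[f_i(x_i):f_{i-1}(x_i)]$ for $i=1,\dots,n$ and, if $X=\mathbb T$, $k_0=[f_0(x_0):f_n(x_0)]$. Then there is a projection $g\in M(I)$ with $\pi(g)=\mathbf f$ if and only if there exist integers $l_0,\dots,l_n$ such that all of the following hold: (1) $l_i-l_{i-1}=-k_i$ for $i=1,\dots,n$, and, if $X=\mathbb T$, also $l_0-l_n=-k_0$; (2) for every $i$ and every $x\in X_i$ such that $f_i(x)$ has finite rank, $l_i\ge -\operatorname{rank}(f_i(x))$; (3) for every $i$ and every $x\in X_i$ such that $1-f_i(x)$ has finite rank, $l_i\le \operatorname{rank}(1-f_i(x))$; (4) $l_i=0$ for every $i$ such that an end point of $X_i$ is infinite.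
   Context: $H$ is a separable infinite-dimensional complex Hilbert space, $B(H)$ the bounded operators and $K$ the compact operators on $H$. $X$ is one of $[0,1]$, $[0,\infty)$, $(-\infty,\infty)$, $\mathbb T=[0,1]/\{0,1\}$. $I=C(X)\otimes K$ is the $C^*$-algebra of norm continuous functions $X\to K$ (vanishing in norm at the infinite ends of $X$, if any). Its multiplier algebra is $M(I)=C_b(X,B(H))$, the bounded functions $X\to B(H)$ continuous for the double-strong (i.e. strong-$*$) topology. $\mathcal C(I)=M(I)/I$ is the corona algebra and $\pi:M(I)\to\mathcal C(I)$ the quotient map. Essential codimension: for projections $p,q\in B(H)$ with $p-q\in K$, $[p:q]=\operatorname{rank}(p)-\operatorname{rank}(q)$ if $p,q$ have finite rank; if they have infinite rank, $[p:q]=\operatorname{Ind}(V^*W)$ (Fredholm index), where $V,W$ are isometries on $H$ with $VV^*=q$, $WW^*=p$ (independent of the choice). Local liftings: take points $x_1<\dots<x_n$ in the interior of $X$ (in $(0,1)$ if $X=\mathbb T$), dividing $X$ (or $[0,1]$ if $X=\mathbb T$) into closed subintervals $X_0,X_1,\dots,X_n$ in order, with $x_i$ the common end point of $X_{i-1}$ and $X_i$. If $X=\mathbb T$, $x_0$ is the point $0=1$, and $f_0(x_0)$ means the value of $f_0$ at $0$, $f_n(x_0)$ the value of $f_n$ at $1$. A tuple $(f_0,\dots,f_n)$ with $f_i\in C_b(X_i,B(H))$ (strong-$*$ continuous, bounded), $f_i(x_i)-f_{i-1}(x_i)\in K$ for $i=1,\dots,n$, and $f_0(x_0)-f_n(x_0)\in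 K$ if $X=\mathbb T$, represents the element of $\mathcal C(I)$ equal to the coset of all $f\in M(I)$ such that, for every $i$, $f|_{X_i}-f_i$ is norm continuous with values in $K$ and vanishes in norm at any infinite end point of $X_i$. The tuple is a projection-valued local lifting of $\mathbf f$ if it represents $\mathbf f$ and each $f_i(x)$ is a projection. *)

(* Defs.v *)
From HB Require Import structures.
From mathcomp Require Import all_boot all_order all_algebra sesquilinear.
From mathcomp Require Import complex.
From mathcomp Require Import all_classical all_reals.
From mathcomp Require Import topology normedtype.

Set Implicit Arguments.
Unset Strict Implicit.
Unset Printing Implicit Defensive.

Import Order.TTheory GRing.Theory Num.Theory.
Import numFieldNormedType.Exports.
Local Open Scope classical_set_scope.
Local Open Scope ring_scope.
Local Open Scope complex_scope.

HB.mixin Record isHilbert (R : realType) H of CompleteNormedModule R[i] H := {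
  dotp : {dot H for @Num.conj R[i]} ;
  dotp_norm : forall u : H, `|u| ^+ 2 = dotp u u }.

#[short(type="hilbertType")]
HB.structure Definition Hilbert (R : realType) :=
  {H of CompleteNormedModule R[i] H & isHilbert R H}.

Section Operators.
Context {R : realType} {H : hilbertType R}.
Implicit Types (u v : H) (S T p q V W : H -> H) (A B : set H).

(* The norm of a normed R[i]-module takes its values in R[i]. *)
Definition hnorm u : R := complex.Re `|u|.

Definition bounded_op T : Prop :=
  linear T /\ exists C : R, forall u, hnorm (T u) <= C * hnorm u.

Definition opnorm T : R := sup [set hnorm (T u) | u in [set u | hnorm u <= 1]].

Definition compact_op T : Prop :=
  bounded_op T /\ precompact [set T u | u in [set u | hnorm u <= 1]].

(* For bounded T such an S exists and is unique (Riesz). *)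
Definition adjoint T : H -> H :=
  xget (fun=> 0) [set S | bounded_op S /\ forall u v, dotp (T u) v = dotp u (S v)].

Definition projection p : Prop :=
  [/\ bounded_op p, p \o p = p & adjoint p = p].

Definition isometry_op V : Prop :=
  bounded_op V /\ forall u, hnorm (V u) = hnorm u.

(* [has_qdim A B n]: for subspaces A `<=` B, the quotient B / A has a basis of
   n elements, given by representatives e. *)
Definition has_qdim A B (n : nat) : Prop :=
  exists e : 'I_n -> H,
    [/\ forall i, B (e i),
        forall v, B v -> exists c : 'I_n -> R[i], A (v - \sum_i c i *: e i) &
        forall c : 'I_n -> R[i], A (\sum_i c i *: e i) -> forall i, c i = 0].

(* Equal to 0 when B / A is infinite-dimensional. *)
Definition qdim A B : nat := xget 0%N [set n | has_qdim A B n].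

Definition finite_rank T : Prop := exists n, has_qdim [set 0] (range T) n.

Definition rank T : nat := qdim [set 0] (range T).

Definition fredholm_index T : int :=
  (qdim [set 0] (T @^-1` [set 0]))%:Z - (qdim (range T) setT)%:Z.

(* Meant for projections p, q with p - q compact: then p and q are both of finite
   or both of infinite rank, and the index does not depend on V and W. *)
Definition esscodim p q : int :=
  if `[< finite_rank p /\ finite_rank q >] then (rank p)%:Z - (rank q)%:Z
  else xget 0 [set k | exists V W,
    [/\ isometry_op V /\ isometry_op W,
        V \o adjoint V = q,
        W \o adjoint W = p &
        k = fredholm_index (adjoint V \o W)]].

End Operators.

Definition separable_hilbert (R : realType) (H : hilbertType R) : Prop :=
  exists D : set H, countable D /\ dense D.

Definition infinite_dimensional (R : realType) (H : hilbertType R) : Prop :=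
  ~ exists n, @has_qdim R H [set 0] setT n.

Inductive ground := UnitInterval | HalfLine | RealLine | Circle.

Definition is_circle (X : ground) : bool := if X is Circle then true else false.

Section Corona.
Context {R : realType} {H : hilbertType R}.
Implicit Types (X : ground) (J : interval R).

(* The circle is [0, 1] with 0 and 1 identified: a function on it is a function
   on [0, 1] taking the same value at 0 and 1. *)
Definition base X : interval R :=
  match X with
  | UnitInterval | Circle => `[0, 1]
  | HalfLine => `[0, +oo[
  | RealLine => `]-oo, +oo[
  end.

Definition left_infinite J : bool := let: Interval a _ := J in a == -oo%O.
Definition right_infinite J : bool := let: Interval _ b := J in b == +oo%O.

(* A function on an interval J is a total function on R whose values outside J
   are irrelevant. *)

(* C_b(J, B(H)) for the strong-* topology. *)
Definition Cb J (f : R -> H -> H) : Prop :=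
  [/\ forall t, t \in J -> bounded_op (f t),
      exists C : R, forall t, t \in J -> opnorm (f t) <= C,
      forall u, {within [set` J], continuous (fun t => f t u)} &
      forall u, {within [set` J], continuous (fun t => adjoint (f t) u)}].

(* C_0(J, K) for the norm topology. *)
Definition C0K J (f : R -> H -> H) : Prop :=
  [/\ forall t, t \in J -> compact_op (f t),
      forall t, t \in J ->
        opnorm (f s \- f t) @[s --> within [set` J] (nbhs t)] --> (0 : R),
      left_infinite J -> opnorm (f t) @[t --> -oo] --> (0 : R) &
      right_infinite J -> opnorm (f t) @[t --> +oo] --> (0 : R)].

Definition multiplier X (f : R -> H -> H) : Prop :=
  Cb (base X) f /\ (is_circle X -> f 0 = f 1).

Definition ideal X (f : R -> H -> H) : Prop :=
  C0K (base X) f /\ (is_circle X -> f 0 = f 1).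

(* The image in the corona algebra of a multiplier f, as a coset of the ideal. *)
Definition corona_pi X (f : R -> H -> H) : set (R -> H -> H) :=
  [set g | multiplier X g /\ ideal X (fun t => g t \- f t)].

Definition corona X : set (set (R -> H -> H)) :=
  [set corona_pi X f | f in [set f | multiplier X f]].

Definition corona_mul X (F G : set (R -> H -> H)) : set (R -> H -> H) :=
  \bigcup_(f in F) \bigcup_(g in G) corona_pi X (fun t => f t \o g t).

Definition corona_star X (F : set (R -> H -> H)) : set (R -> H -> H) :=
  \bigcup_(f in F) corona_pi X (fun t => adjoint (f t)).

Definition corona_projection X (F : set (R -> H -> H)) : Prop :=
  [/\ corona X F, corona_mul X F F = F & corona_star X F = F].

Definition multiplier_projection X (g : R -> H -> H) : Prop :=
  multiplier X g /\ forall t, t \in base X -> projection (g t).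

Definition partition_points X (n : nat) (x : nat -> R) : Prop :=
  (forall i, (1 <= i <= n)%N -> [set` base X]° (x i)) /\
  (forall i, (1 <= i < n)%N -> x i < x i.+1).

(* The i-th piece X_i, for i <= n; only x 1, ..., x n are used. *)
Definition piece X (n : nat) (x : nat -> R) (i : nat) : interval R :=
  let: Interval a b := base X in
  Interval (if i == 0%N then a else BLeft (x i))
           (if i == n then b else BRight (x i.+1)).

Definition local_lifting X n (x : nat -> R) (f : nat -> R -> H -> H) : Prop :=
  [/\ forall i, (i <= n)%N -> Cb (piece X n x i) (f i),
      forall i, (1 <= i <= n)%N -> compact_op (f i (x i) \- f i.-1 (x i)) &
      is_circle X -> compact_op (f 0%N 0 \- f n 1)].

Definition represented X n (x : nat -> R) (f : nat -> R -> H -> H) :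
    set (R -> H -> H) :=
  [set g | multiplier X g /\ forall i, (i <= n)%N ->
             C0K (piece X n x i) (fun t => g t \- f i t)].

Definition projection_lifting X n (x : nat -> R) (f : nat -> R -> H -> H)
    (F : set (R -> H -> H)) : Prop :=
  [/\ local_lifting X n x f, F = represented X n x f &
      forall i t, (i <= n)%N -> t \in piece X n x i -> projection (f i t)].

End Corona.

(* Main.v *)
(* For projections [p], [q] with compact difference, the essential codimension is
   [dim E1 - dim E-1], where [E1] (the [v] with [p v = v] and [q v = 0]) and [E-1] (the
   same with [p] and [q] exchanged) are the eigenspaces of [p - q] for [1] and [-1].
   In this form it is locally constant along strongly continuous fields whose
   difference is norm continuous and compact.  If it
   vanishes, finitely many quarter turns exchanging unit vectors of [E1] and [E-1]
   reduce to the case [|p - q| < 1], where [q p + (1 - q) (1 - p)] is invertible and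
   intertwines [p] and [q]; every move is a segment [z_s = 1 + s k] of invertible
   operators with [k] compact, and replacing [g] by the range projection of [z_s g],
   with [s] depending on the parameter, moves the value of a field [g] at an end point
   from [p] to [q] within its class modulo compacts.  This also gives additivity.

   A lift [g] yields [l_i = [g : f_i]].  Conversely, over a compact piece the rank
   conditions provide [|l_i|] successive continuous unit sections of [1 - f_i] (or of
   [f_i]), which are added to (or subtracted from) [f_i]; the relations between the
   [l_i] say that neighbouring pieces differ by essential codimension [0] at the
   common point, so they can be made to match by a correction at the right ends. *)

Require Import Defs.
From mathcomp Require Import all_boot all_order all_algebra sesquilinear.
From mathcomp Require Import complex.
From mathcomp Require Import all_classical all_reals.
From mathcomp Require Import topology normedtype sequences.
From mathcomp Require Import finmap ring lra zify.

Set Implicit Arguments.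
Unset Strict Implicit.
Unset Printing Implicit Defensive.

Import Order.TTheory GRing.Theory Num.Theory.
Import numFieldNormedType.Exports.
Local Open Scope classical_set_scope.
Local Open Scope ring_scope.
Local Open Scope complex_scope.

(** * Inner products *)

Section InnerProduct.
Context {R : realType} {H : hilbertType R}.
Implicit Types (u v w : H) (a b : R[i]) (r s : R).

(** The lifting is only strongly continuous, whereas corrections must be norm continuous with
    compact values. A correction therefore perturbs the identity by a fixed compact operator: on a
    precompact image of the unit ball strong convergence is uniform. No functional calculus enters:
    inverses and closed ranges come from the contraction principle, spectral gaps from a compactness
    argument on almost fixed vectors. The dimensions of [E1 p q] and [E1 q p] can jump; a dimension
    count shows that their difference cannot jump up, and exchanging [p] and [q], which reverses its
    sign, that it cannot jump down. The bounds on [l_i] reflect that [E1 f_i g] lies in the range of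
    [f_i] and [E1 g f_i] in that of [1 - f_i]; near an infinite end [|g - f_i| < 1], so both vanish.
    In the converse, a correction leaves the left end of its piece alone, so pieces are corrected
    independently of each other, and on the circle the last piece is turned to the value of the
    first one at 0. *)

Definition rip u v : R := complex.Re (dotp u v).

Lemma dotpDl u v w : dotp (u + v) w = dotp u w + dotp v w.
Proof. exact: linearDl. Qed.
Lemma dotpDr u v w : dotp w (u + v) = dotp w u + dotp w v.
Proof. exact: linearDr. Qed.
Lemma dotpNl u w : dotp (- u) w = - dotp u w.
Proof. exact: linearNl. Qed.
Lemma dotpNr u w : dotp w (- u) = - dotp w u.
Proof. exact: linearNr. Qed.
Lemma dotpBl u v w : dotp (u - v) w = dotp u w - dotp v w.
Proof. by rewrite dotpDl dotpNl. Qed.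
Lemma dotpBr u v w : dotp w (u - v) = dotp w u - dotp w v.
Proof. by rewrite dotpDr dotpNr. Qed.
Lemma dotpZl a u w : dotp (a *: u) w = a * dotp u w.
Proof. exact: linearZl_LR. Qed.
Lemma dotpC u v : dotp u v = (dotp v u)^*%C.
Proof. by rewrite hermC /= expr0 mul1r. Qed.
Lemma dotpZr a u w : dotp w (a *: u) = a^*%C * dotp w u.
Proof. by rewrite dotpC dotpZl rmorphM; congr (_ * _); rewrite [RHS]dotpC. Qed.
Lemma dotp0l w : dotp 0 w = 0.
Proof. exact: linear0l. Qed.
Lemma dotp0r w : dotp w 0 = 0.
Proof. exact: linear0r. Qed.
Lemma dotp_suml I (s : seq I) (P : pred I) (F : I -> H) w :
  dotp (\sum_(i <- s | P i) F i) w = \sum_(i <- s | P i) dotp (F i) w.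
Proof. by elim/big_rec2: _ => [|i y1 y2 _ <-]; rewrite ?dotp0l ?dotpDl. Qed.
Lemma dotp_sumr I (s : seq I) (P : pred I) (F : I -> H) w :
  dotp w (\sum_(i <- s | P i) F i) = \sum_(i <- s | P i) dotp w (F i).
Proof. by elim/big_rec2: _ => [|i y1 y2 _ <-]; rewrite ?dotp0r ?dotpDr. Qed.

Lemma ripDl u v w : rip (u + v) w = rip u w + rip v w.
Proof. by rewrite /rip dotpDl; case: (dotp _ _) => ? ?; case: (dotp _ _). Qed.
Lemma ripC u v : rip u v = rip v u.
Proof. by rewrite /rip dotpC; case: (dotp _ _). Qed.
Lemma ripDr u v w : rip w (u + v) = rip w u + rip w v.
Proof. by rewrite ripC ripDl !(ripC w). Qed.
Lemma ripNl u w : rip (- u) w = - rip u w.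
Proof. by rewrite /rip dotpNl; case: (dotp _ _). Qed.
Lemma ripNr u w : rip w (- u) = - rip w u.
Proof. by rewrite ripC ripNl ripC. Qed.
Lemma ripBl u v w : rip (u - v) w = rip u w - rip v w.
Proof. by rewrite ripDl ripNl. Qed.
Lemma ripBr u v w : rip w (u - v) = rip w u - rip w v.
Proof. by rewrite ripDr ripNr. Qed.
Lemma ripZl r u w : rip (r%:C *: u) w = r * rip u w.
Proof. by rewrite /rip dotpZl; case: (dotp _ _) => x y /=; ring. Qed.
Lemma ripZr r u w : rip w (r%:C *: u) = r * rip w u.
Proof. by rewrite ripC ripZl ripC. Qed.
Lemma rip0l w : rip 0 w = 0.
Proof. by rewrite /rip dotp0l. Qed.
Lemma rip0r w : rip w 0 = 0.
Proof. by rewrite ripC rip0l. Qed.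

Definition ripE := (ripDl, ripDr, ripNl, ripNr, ripZl, ripZr, rip0l, rip0r).

Lemma normE u : `|u| = (hnorm u)%:C.
Proof.
rewrite /hnorm; have : 0 <= `|u| by [].
by case: `|u| => x y; rewrite lecE /= => /andP[/eqP -> _].
Qed.

Lemma hnorm_ge0 u : 0 <= hnorm u.
Proof. by rewrite -lecR -normE; exact: normr_ge0. Qed.

Lemma dotpE u : dotp u u = ((hnorm u) ^+ 2)%:C.
Proof. by rewrite -dotp_norm normE rmorphXn. Qed.

Lemma ripuu u : rip u u = hnorm u ^+ 2.
Proof. by rewrite /rip dotpE. Qed.

Lemma hnorm0 : hnorm (0 : H) = 0.
Proof. by rewrite /hnorm normr0. Qed.

Lemma hnorm_eq0 u : hnorm u = 0 -> u = 0.
Proof. by move=> u0; apply/normr0_eq0; rewrite normE u0. Qed.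

Lemma hnorm_gt0 u : u <> 0 -> 0 < hnorm u.
Proof.
by move=> u0; rewrite lt_neqAle hnorm_ge0 andbT eq_sym; apply/eqP => /hnorm_eq0.
Qed.

Lemma hnormN u : hnorm (- u) = hnorm u.
Proof. by rewrite /hnorm normrN. Qed.

Lemma hnormB u v : hnorm (u - v) = hnorm (v - u).
Proof. by rewrite -hnormN opprB. Qed.

Lemma ler_hnormD u v : hnorm (u + v) <= hnorm u + hnorm v.
Proof.
have := ler_normD u v; rewrite !normE => h; rewrite -lecR.
by apply: le_trans h _; rewrite rmorphD.
Qed.

Lemma ler_hnormB u v : hnorm (u - v) <= hnorm u + hnorm v.
Proof. by rewrite -(hnormN v) ler_hnormD. Qed.

Lemma ler_hdist u v w : hnorm (u - w) <= hnorm (u - v) + hnorm (v - w).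
Proof. by rewrite -[u - w](subrKA v) ler_hnormD. Qed.

Lemma hnormZ a u : hnorm (a *: u) = complex.Re `|a| * hnorm u.
Proof.
rewrite /hnorm normrZ normE; have : 0 <= `|a| by [].
by case: `|a| => x y; rewrite lecE /= => /andP[/eqP -> _]; ring.
Qed.

Lemma hnormZR r u : hnorm (r%:C *: u) = `|r| * hnorm u.
Proof. by rewrite hnormZ normc_def /= expr0n addr0 sqrtr_sqr. Qed.

Lemma hnormZ_ge0 r u : 0 <= r -> hnorm (r%:C *: u) = r * hnorm u.
Proof. by move=> r0; rewrite hnormZR ger0_norm. Qed.

Lemma rip_ext u v : (forall w, rip u w = rip v w) -> u = v.
Proof.
move=> e; apply/eqP; rewrite -subr_eq0; apply/eqP/hnorm_eq0/eqP.
by rewrite -sqrf_eq0 -ripuu ripBl e subrr.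
Qed.

Lemma dotp_ext u v : (forall w, dotp u w = dotp v w) -> u = v.
Proof. by move=> e; apply: rip_ext => w; rewrite /rip e. Qed.

Lemma hnormD2 u v : hnorm (u + v) ^+ 2 = hnorm u ^+ 2 + 2 * rip u v + hnorm v ^+ 2.
Proof. by rewrite -!ripuu !ripE (ripC v u); ring. Qed.

Lemma hnormB2 u v : hnorm (u - v) ^+ 2 = hnorm u ^+ 2 - 2 * rip u v + hnorm v ^+ 2.
Proof. by rewrite -!ripuu !ripE (ripC v u); ring. Qed.

(** Cauchy-Schwarz: the square of [|v| u - |u| v] is nonnegative, after a change of sign of [u] if
    the product is negative. *)
Lemma rip_le u v : `|rip u v| <= hnorm u * hnorm v.
Proof.
wlog rip0 : u / 0 <= rip u v.
  move=> W; case: (leP 0 (rip u v)) => [|lt]; first exact: W.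
  by rewrite -normrN -ripNl -(hnormN u); apply: W; rewrite ripNl; lra.
rewrite ger0_norm //.
have := hnorm_ge0 u; have := hnorm_ge0 v.
have [->|/hnorm_gt0 u0] := pselect (u = 0); first by rewrite rip0l hnorm0 mul0r.
have [->|/hnorm_gt0 v0] := pselect (v = 0); first by rewrite rip0r hnorm0 mulr0.
move=> _ _; have := sqr_ge0 (hnorm ((hnorm v)%:C *: u - (hnorm u)%:C *: v)).
rewrite -ripuu !ripE !ripuu (ripC v u).
have uv := mulr_gt0 u0 v0.
move=> hh; have : 0 <= (hnorm u * hnorm v) * (hnorm u * hnorm v - rip u v) by nra.
by rewrite pmulr_rge0 // subr_ge0.
Qed.

Lemma rip_ler u v : rip u v <= hnorm u * hnorm v.
Proof. exact: le_trans (ler_norm _) (rip_le _ _). Qed.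

Lemma hnorm_le_rip u r : 0 <= r -> (forall v, rip u v <= r * hnorm v) -> hnorm u <= r.
Proof.
move=> r0 /(_ u); rewrite ripuu expr2 => le.
by have [/hnorm_gt0 u0|] := pselect (u <> 0);
  [rewrite -(ler_pM2r u0)|move/contrapT ->; rewrite hnorm0].
Qed.

(** The real part at ['i *: u] is minus the imaginary part at [u], so two real equations make a
    complex one. *)
Lemma dotp_rip0 u v : rip u v = 0 -> rip ('i *: u) v = 0 -> dotp u v = 0.
Proof.
rewrite /rip dotpZl; case: (dotp u v) => x y /=.
by rewrite !mul0r mul1r sub0r => -> /eqP; rewrite oppr_eq0 => /eqP ->.
Qed.

Lemma rip_eq0 u v : dotp u v = 0 -> rip u v = 0.
Proof. by rewrite /rip => ->. Qed.

Lemma hnorm_sqr_le u v : (hnorm u ^+ 2 <= hnorm v ^+ 2) = (hnorm u <= hnorm v).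
Proof. by rewrite ler_sqr ?nnegrE ?hnorm_ge0. Qed.

End InnerProduct.

(* Linear identities between vectors, checked by pairing with a test vector. *)
Ltac vring := apply: rip_ext => ?;
  rewrite ?(ripDl, ripNl, ripZl, rip0l); ring.

(** * Completeness and bounded operators *)

Section Completeness.
Context {R : realType} {H : hilbertType R}.
Implicit Types (u v w : H).

(** The order of [R[i]] compares only numbers with equal imaginary parts, so the radii of
    neighbourhoods in [H] are real. *)
Lemma gt0_real (e : R[i]) : 0 < e -> exists2 r : R, 0 < r & e = r%:C.
Proof.
case: e => x y; rewrite ltcE /= => /andP[/eqP -> x0].
by exists x.
Qed.

Lemma hnorm_complete (f : nat -> H) :
  (forall e : R, 0 < e -> exists N, forall m n, (N <= m)%N -> (N <= n)%N ->
     hnorm (f m - f n) < e) ->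
  exists l, forall e : R, 0 < e -> exists N, forall n, (N <= n)%N ->
     hnorm (f n - l) < e.
Proof.
move=> hf.
have : cvg (f @ \oo).
  apply/cauchy_cvgP/cauchyP => e /gt0_real[r r0 ->].
  have [N hN] := hf _ r0.
  exists (f N); exists N => // n /= Nn.
  by rewrite -ball_normE /ball_ /= normE ltcR; apply: hN.
move=> /cvg_ex[l hl]; exists l => e e0.
move/cvgrPdist_lt : hl => /(_ e%:C); rewrite ltcR => /(_ e0)[N _ hN].
exists N => n Nn; have := hN n Nn; rewrite normE ltcR hnormB.
by [].
Qed.

Definition hclosed (S : set H) :=
  forall v, (forall e : R, 0 < e -> exists2 w, S w & hnorm (w - v) < e) -> S v.

(* Banach's theorem for the real norm: the library version requires a module
   over a realType, whereas [H] is a module over [R[i]]. *)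
Lemma hnorm_fixed_point (S : set H) (f : H -> H) (c : R) :
  0 <= c < 1 -> hclosed S -> S !=set0 -> (forall u, S u -> S (f u)) ->
  (forall u v, S u -> S v -> hnorm (f u - f v) <= c * hnorm (u - v)) ->
  exists2 v, S v & f v = v.
Proof.
move=> /andP[c0 c1] clS [x0 Sx0] fS lip.
pose x n := iter n f x0.
have Sx n : S (x n) by elim: n => //= n; exact: fS.
pose d := hnorm (x 1%N - x 0%N).
have d0 : 0 <= d by exact: hnorm_ge0.
have step n : hnorm (x n.+1 - x n) <= c ^+ n * d.
  elim: n => [|n IH]; first by rewrite expr0 mul1r.
  apply: (le_trans (lip (x n.+1) (x n) (Sx _) (Sx _))).
  by rewrite exprS -mulrA ler_wpM2l.
(* The geometric sum, multiplied by [1 - c] so that the induction is free of division. *)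
have far n k : hnorm (x (n + k)%N - x n) * (1 - c) <= c ^+ n * d * (1 - c ^+ k).
  elim: k => [|k IH]; first by rewrite addn0 subrr hnorm0 expr0 subrr mul0r mulr0.
  rewrite addnS; have := ler_hdist (x (n + k).+1) (x (n + k)%N) (x n).
  move: (step (n + k)%N) IH; rewrite exprD exprS => h1 h2 h3.
  have c1' : 0 <= 1 - c by lra.
  have := ler_wpM2r c1' h3; have := ler_wpM2r c1' h1.
  rewrite mulrDl => h4 h5; apply: le_trans h5 _; apply: le_trans (lerD h4 h2) _.
  by rewrite le_eqVlt; apply/orP; left; apply/eqP; ring.
have cN0 n : 0 <= c ^+ n by rewrite exprn_ge0.
have far' n k : hnorm (x (n + k)%N - x n) <= c ^+ n * (d / (1 - c)).
  rewrite mulrA ler_pdivlMr; last lra.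
  apply: le_trans (far n k) _; rewrite ler_piMr //; first by rewrite mulr_ge0.
  by have := cN0 k; lra.
have [e e0|l hl] := @hnorm_complete x.
  (* The summand 1 keeps [D] positive when the first step [d] is 0. *)
  pose D := d / (1 - c) + 1.
  have D0 : 0 < D by rewrite /D ltr_wpDl // divr_ge0 //; lra.
  have cc : `|c| < 1 by rewrite ger0_norm.
  have /cvgrPdist_lt /(_ (e / 2 / D)) := cvg_expr cc.
  case; first by rewrite !divr_gt0.
  move=> N _ hN; exists N => m n Nm Nn.
  have hx k : (N <= k)%N -> hnorm (x k - x N) < e / 2.
    move=> Nk; rewrite -(subnKC Nk); apply: le_lt_trans (far' _ _) _.
    have := hN N (leqnn N) => /=; rewrite sub0r normrN ger0_norm //.
    rewrite ltr_pdivlMr // => h; apply: le_lt_trans h.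
    by apply: ler_wpM2l => //; rewrite /D; lra.
  apply: le_lt_trans (ler_hdist _ (x N) _) _; rewrite (hnormB (x N)).
  by have := hx m Nm; have := hx n Nn; lra.
have Sl : S l.
  by apply: clS => e e0; have [N hN] := hl e e0; exists (x N); [|exact: hN].
exists l => //; apply/eqP; rewrite -subr_eq0; apply/eqP/hnorm_eq0/eqP.
rewrite eq_le hnorm_ge0 andbT; apply/ler_addgt0Pr => e e0; rewrite add0r.
have e20 : 0 < e / 2 by rewrite divr_gt0.
have [N hN] := hl _ e20.
apply: le_trans (ler_hdist _ (x N.+1) _) _.
have := lip _ _ Sl (Sx N); rewrite (hnormB l) => h1.
have := hN N (leqnn N); have := hN N.+1 (leqnSn N) => /= h2 h3.
have : c * hnorm (x N - l) <= hnorm (x N - l) by rewrite ler_piMl ?hnorm_ge0 // ltW.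
by move: h1 h2 h3; rewrite /x /=; lra.
Qed.

Lemma hclosedI (S T : set H) : hclosed S -> hclosed T -> hclosed (S `&` T).
Proof.
by move=> hS hT v hv; split; [apply: hS|apply: hT] => e /hv[w [? ?] ?]; exists w.
Qed.

Lemma hclosed_ker (f : H -> H) (C : R) :
  (forall u v, hnorm (f u - f v) <= C * hnorm (u - v)) -> hclosed [set v | f v = 0].
Proof.
move=> hf v hv; apply/hnorm_eq0/eqP; rewrite eq_le hnorm_ge0 andbT.
apply/ler_addgt0Pr => e e0; rewrite add0r.
have C1 : 0 < `|C| + 1 by rewrite ltr_wpDl.
have [w /= fw hw] := hv _ (divr_gt0 e0 C1).
have := hf w v; rewrite fw sub0r hnormN => /le_trans; apply.
move: hw; rewrite ltr_pdivlMr // => /ltW; apply: le_trans; rewrite mulrC.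
by rewrite ler_wpM2l ?hnorm_ge0 //; have := ler_norm C; lra.
Qed.

Lemma hclosed_rip u : hclosed [set v | rip v u = 0].
Proof.
move=> v hv; apply/normr0_eq0/eqP; rewrite eq_le normr_ge0 andbT.
apply/ler_addgt0Pr => e e0; rewrite add0r.
have C1 : 0 < hnorm u + 1 by rewrite ltr_wpDl // hnorm_ge0.
have [w /= fw hw] := hv _ (divr_gt0 e0 C1).
have -> : rip v u = rip (v - w) u by rewrite ripBl fw subr0.
apply: le_trans (rip_le _ _) _; rewrite hnormB.
move: hw; rewrite ltr_pdivlMr // => /ltW; apply: le_trans.
by rewrite ler_wpM2l ?hnorm_ge0 //; lra.
Qed.

Lemma hclosed_dotp u : hclosed [set v | dotp v u = 0].
Proof.
move=> v hv; apply: dotp_rip0.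
  by apply: (@hclosed_rip u) => e /hv[w /rip_eq0 ? ?]; exists w.
have E w : rip ('i *: w) u = rip w (- ('i *: u)).
  rewrite ripNr /rip dotpZl dotpZr; case: (dotp w u) => x y /=; ring.
rewrite E; apply: (@hclosed_rip) => e /hv[w h ?]; exists w => //=.
by rewrite -E /rip dotpZl h mulr0.
Qed.

End Completeness.

Section BoundedOperators.
Context {R : realType} {H : hilbertType R}.
Implicit Types (u v w : H) (S T p q : H -> H).

Section bounded.
Variables (T : H -> H) (bT : bounded_op T).
Lemma bopP (a : R[i]) u v : T (a *: u + v) = a *: T u + T v.
Proof. by have [l _] := bT; exact: l. Qed.
Lemma bopD u v : T (u + v) = T u + T v.
Proof. by rewrite -[u in LHS]scale1r bopP scale1r. Qed.
Lemma bop0 : T 0 = 0.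
Proof. by apply: (addrI (T 0)); rewrite -bopD !addr0. Qed.
Lemma bopZ (a : R[i]) u : T (a *: u) = a *: T u.
Proof. by rewrite -[a *: u]addr0 bopP bop0 addr0. Qed.
Lemma bopN u : T (- u) = - T u.
Proof. by rewrite -scaleN1r bopZ scaleN1r. Qed.
Lemma bopB u v : T (u - v) = T u - T v.
Proof. by rewrite bopD bopN. Qed.
Lemma bop_sum I (s : seq I) (P : pred I) (F : I -> H) :
  T (\sum_(i <- s | P i) F i) = \sum_(i <- s | P i) T (F i).
Proof. by elim/big_rec2: _ => [|i y1 y2 _ <-]; rewrite ?bop0 ?bopD. Qed.
Lemma bop_bound : exists2 C : R, 0 < C & forall u, hnorm (T u) <= C * hnorm u.
Proof.
have [_ [C hC]] := bT; exists (`|C| + 1); first by rewrite ltr_wpDl.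
move=> u; apply: le_trans (hC u) _; rewrite ler_wpM2r ?hnorm_ge0 //.
by have := ler_norm C; lra.
Qed.
Lemma opnorm_set_bounded :
  has_sup [set hnorm (T u) | u in [set u | hnorm u <= 1]].
Proof.
have [C C0 hC] := bop_bound; split.
  by exists (hnorm (T 0)); exists 0 => //=; rewrite hnorm0.
exists C => _ [u /= u1 <-]; apply: le_trans (hC u) _.
by rewrite ler_piMr // ltW.
Qed.
Lemma opnorm_ge0 : 0 <= opnorm T.
Proof.
apply: (@sup_upper_bound _ _ opnorm_set_bounded).
by exists 0; rewrite /= ?bop0 hnorm0.
Qed.
Lemma le_opnorm u : hnorm (T u) <= opnorm T * hnorm u.
Proof.
have [->|/hnorm_gt0 u0] := pselect (u = 0); first by rewrite bop0 hnorm0 mulr0.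
rewrite -ler_pdivrMr //.
apply: (@sup_upper_bound _ _ opnorm_set_bounded).
exists (((hnorm u)^-1)%:C *: u); rewrite /= ?bopZ hnormZ_ge0 ?invr_ge0 ?(ltW u0) //.
  by rewrite mulVf ?gt_eqF // lexx.
by rewrite mulrC.
Qed.
Lemma opnorm_le (C : R) : 0 <= C -> (forall u, hnorm (T u) <= C * hnorm u) ->
  opnorm T <= C.
Proof.
move=> C0 hC; apply: ge_sup; first by have [] := opnorm_set_bounded.
move=> _ [u /= u1 <-]; apply: le_trans (hC u) _.
by rewrite ler_piMr // ltW.
Qed.
End bounded.

Lemma bop_id : bounded_op (idfun : H -> H).
Proof. by split => //; exists 1 => u; rewrite mul1r. Qed.

Lemma bop_comp S T : bounded_op S -> bounded_op T -> bounded_op (S \o T).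
Proof.
move=> bS bT; split; first by move=> a u v /=; rewrite (bopP bT) (bopP bS).
have [C C0 hC] := bop_bound bS; have [D D0 hD] := bop_bound bT.
exists (C * D) => u /=; apply: le_trans (hC _) _.
by rewrite -mulrA ler_wpM2l // ltW.
Qed.

Lemma bop_add S T : bounded_op S -> bounded_op T -> bounded_op (S \+ T).
Proof.
move=> bS bT; split.
  by move=> a u v /=; rewrite (bopP bS) (bopP bT) scalerDr addrACA.
have [C C0 hC] := bop_bound bS; have [D D0 hD] := bop_bound bT.
exists (C + D) => u /=; apply: le_trans (ler_hnormD _ _) _.
by rewrite mulrDl lerD.
Qed.

Lemma bop_scale (a : R[i]) T : bounded_op T -> bounded_op (fun u => a *: T u).
Proof.
move=> bT; split.
  by move=> b u v /=; rewrite (bopP bT) scalerDr !scalerA mulrC.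
have [C C0 hC] := bop_bound bT.
exists (complex.Re `|a| * C) => u /=; rewrite hnormZ -mulrA ler_wpM2l //.
by have : 0 <= `|a| by []; rewrite lecE => /andP[].
Qed.

Lemma bop_opp T : bounded_op T -> bounded_op (\- T).
Proof.
move=> /(bop_scale (-1)); suff -> : (fun u => -1 *: T u) = (\- T) by [].
by apply/funext => u; rewrite scaleN1r.
Qed.

Lemma bop_sub S T : bounded_op S -> bounded_op T -> bounded_op (S \- T).
Proof. by move=> bS /bop_opp; exact: bop_add. Qed.

Definition rank1 (x y : H) : H -> H := fun u => dotp u y *: x.

(** Complex Cauchy-Schwarz from the real one: a factor of modulus 1 on [u], the conjugate phase of
    the product, makes the product real and positive. *)
Lemma dotp_norm_le u v : complex.Re `|dotp u v| <= hnorm u * hnorm v.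
Proof.
case: (dotp u v =P 0) => [->|/eqP d0].
  by rewrite normr0 /= mulr_ge0 ?hnorm_ge0.
pose d := dotp u v.
have [r rE] : exists r : R, `|d| = r%:C.
  have : 0 <= `|d| by [].
  by case: `|d| => x y; rewrite lecE /= => /andP[/eqP -> _]; exists x.
have nd : `|d| != 0 by rewrite normr_eq0.
have E : dotp ((d^*%C / `|d|) *: u) v = `|d|.
  rewrite dotpZl -/d -mulrA [_ * d]mulrC mulrA.
  have -> : d^*%C * d = `|d| ^+ 2.
    by rewrite normCK mulrC.
  by rewrite expr2 mulfK.
rewrite -/d -E; apply: le_trans (rip_ler _ _) _.
rewrite hnormZ normrM normfV normr_id.
have -> : `|d^*%C| = `|d|.
  by case: (d) => x y; rewrite !normc_def /= sqrrN.
by rewrite divff // mul1r.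
Qed.

Lemma bop_rank1 x y : bounded_op (rank1 x y).
Proof.
split; first by move=> a u v; rewrite /rank1 dotpDl dotpZl scalerDl scalerA.
exists (hnorm y * hnorm x) => u; rewrite /rank1 hnormZ mulrAC ler_wpM2r ?hnorm_ge0 //.
by rewrite mulrC dotp_norm_le.
Qed.

(** Adjointness as a relation; the chosen [adjoint] falls back to the zero map when no bounded
    adjoint exists, so it is kept to the interface. *)
Definition adj S T := forall u v, dotp (S u) v = dotp u (T v).

Lemma adj_sym S T : adj S T -> adj T S.
Proof. by move=> h u v; rewrite dotpC -h -dotpC. Qed.

Lemma adj_rip S T u v : adj S T -> rip (S u) v = rip u (T v).
Proof. by move=> h; rewrite /rip h. Qed.

Lemma adj_uniq S T T' : adj S T -> adj S T' -> T = T'.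
Proof.
move=> h h'; apply/funext => u; apply: dotp_ext => w.
by rewrite dotpC -h h' -dotpC.
Qed.

Lemma adjointE S T : bounded_op T -> adj S T -> adjoint S = T.
Proof.
move=> bT h; apply: (adj_uniq (S := S)) => //.
rewrite /adjoint; case: xgetP => [U _ []//|/(_ T)]; by case.
Qed.

Lemma adj_norm S T (c : R) : adj S T -> 0 <= c ->
  (forall u, hnorm (S u) <= c * hnorm u) -> forall u, hnorm (T u) <= c * hnorm u.
Proof.
move=> h c0 hS u; apply: hnorm_le_rip => [|v]; first by rewrite mulr_ge0 ?hnorm_ge0.
rewrite (adj_rip _ _ (adj_sym h)); apply: le_trans (rip_ler _ _) _.
by rewrite -mulrA mulrCA ler_wpM2l ?hnorm_ge0.
Qed.

Lemma adj_comp S S' T T' : adj S S' -> adj T T' -> adj (S \o T) (T' \o S').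
Proof. by move=> h h' u v /=; rewrite h h'. Qed.
Lemma adj_add S S' T T' : adj S S' -> adj T T' -> adj (S \+ T) (S' \+ T').
Proof. by move=> h h' u v /=; rewrite dotpDl dotpDr h h'. Qed.
Lemma adj_sub S S' T T' : adj S S' -> adj T T' -> adj (S \- T) (S' \- T').
Proof. by move=> h h' u v /=; rewrite dotpBl dotpBr h h'. Qed.
Lemma adj_id : adj idfun idfun.
Proof. by []. Qed.
Lemma adj_scale (r : R) S S' : adj S S' ->
  adj (fun u => r%:C *: S u) (fun u => r%:C *: S' u).
Proof. by move=> h u v; rewrite dotpZl dotpZr h /= oppr0. Qed.
Lemma adj_rank1 x y : adj (rank1 x y) (rank1 y x).
Proof. by move=> u v; rewrite /rank1 dotpZl dotpZr -dotpC mulrC. Qed.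

Lemma projP p : projection p <->
  [/\ bounded_op p, (forall u, p (p u) = p u) & adj p p].
Proof.
split=> [[bp pp ap]|[bp pp ap]]; split=> //.
- by move=> u; rewrite -[in RHS]pp.
- have [ex|no] := pselect (exists S, bounded_op S /\ adj p S).
    have := xgetPex (fun=> 0 : H) ex; rewrite -[xget _ _]/(adjoint p) ap.
    by case.
  (* Without a bounded adjoint the default value forces [p = adjoint p = 0], which is self-adjoint
     all the same. *)
  move: ap; rewrite /adjoint xgetPN; first by move=> <- u v; rewrite dotp0l dotp0r.
  by move=> S hS; apply: no; exists S.
- by apply/funext => u /=.
- exact: adjointE.
Qed.

Section proj.
Variables (p : H -> H) (pp : projection p).
Lemma proj_bop : bounded_op p. Proof. by have /projP[] := pp. Qed.
Lemma projK u : p (p u) = p u. Proof. by have /projP[] := pp. Qed.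
Lemma proj_adj : adj p p. Proof. by have /projP[] := pp. Qed.
Lemma proj_rip u v : rip (p u) v = rip u (p v).
Proof. exact: (adj_rip _ _ proj_adj). Qed.
Lemma proj_rip2 u : rip (p u) u = hnorm (p u) ^+ 2.
Proof. by rewrite -ripuu [RHS]proj_rip projK -proj_rip. Qed.
Lemma proj_norm u : hnorm (p u) <= hnorm u.
Proof.
apply: hnorm_le_rip => [|v]; first exact: hnorm_ge0.
have := sqr_ge0 (hnorm (u - p u)); rewrite hnormB2 ripC proj_rip2 => h.
apply: le_trans (rip_ler _ _) _; rewrite ler_wpM2r ?hnorm_ge0 //.
by rewrite -hnorm_sqr_le; lra.
Qed.
Lemma projC : projection (idfun \- p).
Proof.
apply/projP; split; first exact: bop_sub bop_id proj_bop.
  by move=> u /=; rewrite (bopB proj_bop) projK subrr subr0.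
exact: adj_sub adj_id proj_adj.
Qed.
End proj.

Lemma proj_closed_ran p : projection p -> hclosed [set v | p v = v].
Proof.
move=> pp v hv; apply/eqP; rewrite eq_sym -subr_eq0; apply/eqP.
apply: (@hclosed_ker _ _ (idfun \- p) 1) => [u w|e /hv[w /= pw ?]].
  by have pC := projC pp; rewrite -(bopB (proj_bop pC)) mul1r; exact: proj_norm.
by exists w; rewrite //= pw subrr.
Qed.

End BoundedOperators.

(** * Compact operators *)

Section Compactness.
Context {R : realType} {H : hilbertType R}.
Implicit Types (u v w : H) (S T p q : H -> H) (A B : set H).

Lemma hcvgP (I : Type) (F : set_system I) (FF : Filter F) (f : I -> H) (l : H) :
  f x @[x --> F] --> l <->
  forall e : R, 0 < e -> \forall x \near F, hnorm (f x - l) < e.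
Proof.
split=> [/cvgrPdist_lt hf e e0|hf].
  have e0' : 0 < e%:C by rewrite ltcR.
  by apply: filterS (hf _ e0') => x; rewrite normE ltcR hnormB.
apply/cvgrPdist_lt => _ /gt0_real[e e0 ->].
by apply: filterS (hf _ e0) => x; rewrite normE ltcR hnormB.
Qed.

Lemma nbhs_hball v (e : R) : 0 < e -> nbhs v [set w | hnorm (w - v) < e].
Proof.
move=> e0; apply/nbhs_normP; exists e%:C; first by rewrite /= ltcR.
by move=> w /=; rewrite normE ltcR hnormB.
Qed.

Lemma lipschitz_continuous (f : H -> H) (C : R) :
  (forall u v, hnorm (f u - f v) <= C * hnorm (u - v)) -> continuous f.
Proof.
move=> hf v; apply/hcvgP => e e0.
have C1 : 0 < `|C| + 1 by rewrite ltr_wpDl.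
apply: filterS (nbhs_hball v (divr_gt0 e0 C1)) => w /=.
rewrite ltr_pdivlMr // => h; apply: le_lt_trans (hf _ _) _.
apply: le_lt_trans h; rewrite mulrC ler_wpM2l ?hnorm_ge0 //.
by have := ler_norm C; lra.
Qed.

Lemma bop_continuous T : bounded_op T -> continuous T.
Proof.
move=> bT; have [C C0 hC] := bop_bound bT.
by apply: (@lipschitz_continuous _ C) => u v; rewrite -(bopB bT).
Qed.

Lemma compact_precompactH A : compact A -> precompact A.
Proof. exact: compact_precompact (@norm_hausdorff _ _). Qed.

Lemma precompact_closure A : precompact A -> compact (closure A).
Proof. by rewrite precompactE. Qed.

Lemma precompact_image T A : continuous T -> precompact A -> precompact (T @` A).
Proof.
move=> cT /precompact_closure cA.
apply: (@precompact_subset _ _ (T @` closure A)).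
  by move=> _ [a Aa <-]; exists a => //; exact: subset_closure.
apply: compact_precompactH; apply: continuous_compact => //.
by move=> ?; exact: continuous_subspaceT.
Qed.

Lemma precompactD A B : precompact A -> precompact B ->
  precompact [set a + b | a in A & b in B].
Proof.
move=> /precompact_closure cA /precompact_closure cB.
apply: (@precompact_subset _ _
   ((fun z : H * H => z.1 + z.2) @` (closure A `*` closure B))).
  move=> _ [a Aa [b Bb <-]]; exists (a, b) => //=.
  by split; exact: subset_closure.
apply: compact_precompactH; apply: continuous_compact; last exact: compact_setX.
by apply: continuous_subspaceT; exact: add_continuous.
Qed.

Lemma compact_bop T : compact_op T -> bounded_op T.
Proof. by case. Qed.

Lemma compact_add S T : compact_op S -> compact_op T -> compact_op (S \+ T).
Proof.
move=> [bS cS] [bT cT]; split; first exact: bop_add.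
apply: precompact_subset (precompactD cS cT) => _ [u u1 <-] /=.
by exists (S u); [exists u|exists (T u); [exists u|]].
Qed.

Lemma compact_compl S T : bounded_op S -> compact_op T -> compact_op (S \o T).
Proof.
move=> bS [bT cT]; split; first exact: bop_comp.
apply: precompact_subset (precompact_image (bop_continuous bS) cT).
by move=> _ [u u1 <-] /=; exists (T u) => //; exists u.
Qed.

Lemma compact_scale (a : R[i]) T : compact_op T -> compact_op (fun u => a *: T u).
Proof. exact: (compact_compl (bop_scale a (@bop_id _ _))). Qed.

Lemma compact_opp T : compact_op T -> compact_op (\- T).
Proof. exact: (compact_compl (bop_opp (@bop_id _ _))). Qed.

Lemma compact_sub S T : compact_op S -> compact_op T -> compact_op (S \- T).
Proof. by move=> cS /compact_opp; exact: compact_add. Qed.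

Lemma compact_compr S T : compact_op S -> bounded_op T -> compact_op (S \o T).
Proof.
move=> [bS cS] bT; split; first exact: bop_comp.
have [C C0 hC] := bop_bound bT.
have bC := bop_scale C%:C (@bop_id _ H).
apply: precompact_subset (precompact_image (bop_continuous bC) cS).
move=> _ [u /= u1 <-] /=; exists (S ((C^-1)%:C *: T u)).
  exists ((C^-1)%:C *: T u) => //=.
  rewrite hnormZ_ge0 ?invr_ge0 ?(ltW C0) // ler_pdivrMl // mulr1.
  by apply: le_trans (hC u) _; rewrite ler_piMr // ltW.
by rewrite (bopZ bS) scalerA -rmorphM /= divff ?gt_eqF // scale1r.
Qed.

Lemma precompact_line (x : H) (M : R) :
  precompact [set r%:C *: x | r in [set r : R | `|r| <= M]].
Proof.
apply: (@precompact_subset _ _ [set r%:C *: x | r in `[-M, M]]).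
  by move=> _ [r /= rM <-]; exists r => //=; rewrite in_itv /= -ler_norml.
apply: compact_precompactH; apply: continuous_compact; last exact: segment_compact.
apply: continuous_subspaceT => r; apply/hcvgP => e e0.
have C1 : 0 < hnorm x + 1 by rewrite ltr_wpDl // hnorm_ge0.
have := @nbhsx_ballx R R r _ (divr_gt0 e0 C1).
apply: filterS => s; rewrite -ball_normE /= ltr_pdivlMr // => h.
rewrite -scalerBl -rmorphB hnormZR; apply: le_lt_trans h; rewrite distrC.
by apply: ler_wpM2l => //; lra.
Qed.

Lemma compact_rank1 (x y : H) : compact_op (rank1 x y).
Proof.
split; first exact: bop_rank1.
(* The image of the unit ball lies in the sum of two real segments, along [x] and along
   ['i *: x]. *)
apply: precompact_subset
  (precompactD (precompact_line x (hnorm y)) (precompact_line ('i *: x) (hnorm y))).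
move=> _ [u /= u1 <-].
have hn : complex.Re `|dotp u y| <= hnorm y.
  apply: le_trans (dotp_norm_le _ _) _.
  by rewrite ler_piMl ?hnorm_ge0.
rewrite /rank1; move: hn; case: (dotp u y) => a b; rewrite normc_def /= => hn.
have h1 (z : R) : z ^+ 2 <= a ^+ 2 + b ^+ 2 -> `|z| <= hnorm y.
  by move=> h; apply: le_trans hn; rewrite -sqrtr_sqr ler_wsqrtr.
exists (a%:C *: x).
  by exists a => //; apply: h1; rewrite lerDl sqr_ge0.
exists (b%:C *: ('i *: x)).
  by exists b => //; apply: h1; rewrite lerDr sqr_ge0.
by rewrite (complexE (a +i* b)) /= scalerDl; congr (_ + _); rewrite scalerA mulrC.
Qed.

Lemma compact_zero : compact_op (fun _ => 0 : H).
Proof.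
have <- : rank1 0 0 = (fun _ => 0 : H) by apply/funext => u; rewrite /rank1 scaler0.
exact: compact_rank1.
Qed.

Lemma compact_net T (e : R) : compact_op T -> 0 < e ->
  exists s : seq H, forall u, hnorm u <= 1 ->
    exists2 c, c \in s & hnorm (T u - c) < e.
Proof.
move=> [bT /precompact_closure]; rewrite compact_cover => cT e0.
have [||D _ hD] := cT H setT (fun c => ball c e%:C).
- by move=> c _; exact: ball_open.
- move=> v _; exists v => //; apply: ballxx; by rewrite ltcR.
exists (enum_fset D) => u u1.
have [|c /= cD] := hD (T u); first by apply: subset_closure; exists u.
by rewrite -ball_normE /= normE ltcR hnormB; exists c.
Qed.

(** Here [P e z] reads: [z] is a solution up to the error [e]. Only the images [T z] accumulate; for
    almost fixed vectors the [z] then accumulate too. *)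
Lemma compact_cluster T (P : R -> H -> Prop) : compact_op T ->
  (forall e e' z, e <= e' -> P e z -> P e' z) ->
  (forall e, 0 < e -> exists2 z, hnorm z <= 1 & P e z) ->
  exists y, forall e, 0 < e -> exists z, [/\ hnorm z <= 1, P e z & hnorm (T z - y) < e].
Proof.
move=> [bT /precompact_closure cT] Pm /(_ (_.+1%:R^-1)) hP.
have {}hP n : {z | hnorm z <= 1 /\ P (n.+1%:R^-1) z}.
  apply: cid; have [|z z1 Pz] := hP n; [by rewrite invr_gt0 | by exists z].
pose z n := projT1 (hP n).
have hz n : hnorm (z n) <= 1 /\ P n.+1%:R^-1 (z n) by exact: projT2 (hP n).
have [|y [_ hy]] := cT ((T \o z) @ \oo) _.
  exists 0%N => // n _ /=; apply: subset_closure; exists (z n) => //=.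
  by have [] := hz n.
exists y => e e0.
have := hy [set T (z n) | n in [set n | n.+1%:R^-1 <= e]] _ _ (nbhs_hball y e0).
case.
  have /cvgrPdist_lt/(_ e e0)[N _ hN] := @cvg_harmonic R.
  exists N => // n /hN /= h; exists n => //=.
  by move: h; rewrite /harmonic /= sub0r normrN ger0_norm ?invr_ge0 // => /ltW.
move=> _ [[n /= ne <-] lt]; exists (z n); have [z1 Pz] := hz n.
by split=> //; exact: Pm Pz.
Qed.

(* A cluster point of a sequence of almost fixed vectors is a fixed vector. *)
Lemma compact_gap T (S : set H) : compact_op T -> hclosed S ->
  (forall r v, S v -> S (r%:C *: v)) ->
  (forall v, S v -> T v = v -> v = 0) ->
  exists2 d : R, 0 < d & forall v, S v -> d * hnorm v <= hnorm (T v - v).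
Proof.
move=> cT clS Sscale S0; apply: contrapT => no.
have bT := compact_bop cT.
have [||y hy] := @compact_cluster T
    (fun e z => [/\ S z, hnorm z = 1 & hnorm (T z - z) <= e]) cT.
- by move=> e e' z le [? ? h]; split=> //; exact: le_trans le.
- move=> e e0; apply: contrapT => no'; apply: no; exists e => // v Sv.
  have [->|v0] := pselect (v = 0).
    by rewrite hnorm0 mulr0 hnorm_ge0.
  have n0 := hnorm_gt0 v0; rewrite leNgt; apply/negP => lt; apply: no'.
  have E : hnorm ((hnorm v)^-1%:C *: v) = 1.
    by rewrite hnormZ_ge0 ?invr_ge0 ?(ltW n0) // mulVf // gt_eqF.
  exists ((hnorm v)^-1%:C *: v); first by rewrite E.
  split=> //; first exact: Sscale.
  rewrite (bopZ bT) -scalerBr hnormZ_ge0 ?invr_ge0 ?(ltW n0) //.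
  by rewrite ler_pdivrMl // mulrC ltW.
have [C C0 hC] := bop_bound bT.
have hy' e : 0 < e -> exists z, [/\ S z, hnorm z = 1, hnorm (T z - z) < e &
    hnorm (z - y) < e].
  move=> e0; have e20 : 0 < e / 2 by rewrite divr_gt0.
  have [z [z1 [Sz nz Tz] lt]] := hy _ e20; exists z; split=> //; first lra.
  apply: le_lt_trans (ler_hdist _ (T z) _) _; rewrite (hnormB z); lra.
have Sy : S y by apply: clS => e /hy'[z [? ? ?]]; exists z.
have Ty : T y = y.
  apply/eqP; rewrite -subr_eq0; apply/eqP/hnorm_eq0/eqP.
  rewrite eq_le hnorm_ge0 andbT; apply/ler_addgt0Pr => e e0; rewrite add0r.
  (* The three summands of [T y - y] below contribute [C], 1 and 1 times the error. *)
  have D0 : 0 < C + 2 by lra.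
  have [z [_ _ h1 h2]] := hy' _ (divr_gt0 e0 D0).
  have -> : T y - y = (T (y - z) + (T z - z)) + (z - y).
    by rewrite (bopB bT) !subrKA.
  apply: le_trans (ler_hnormD _ _) _.
  have := ler_hnormD (T (y - z)) (T z - z); have := hC (y - z); rewrite (hnormB y) => h3 h4.
  have : (C + 2) * (e / (C + 2)) = e by rewrite mulrC divfK // gt_eqF.
  move: (e / _) h1 h2 => d h1 h2 E.
  have : C * hnorm (z - y) <= C * d by apply: ler_wpM2l; exact: ltW.
  by move: h3 h4; lra.
have y0 := S0 _ Sy Ty.
have [z [_ z1 _]] := hy' (1/2) ltac:(lra).
by rewrite y0 subr0 z1; lra.
Qed.

End Compactness.

(** * Dimension of subspaces *)

Section Dimension.
Context {R : realType} {H : hilbertType R}.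
Implicit Types (u v w x y : H) (A B : set H) (s t vs ws : seq H).

Definition subsp A := A 0 /\ forall (a : R[i]) u v, A u -> A v -> A (a *: u + v).

Lemma subspZ A (a : R[i]) u : subsp A -> A u -> A (a *: u).
Proof. by move=> [A0 hA] Au; rewrite -[_ *: _]addr0; exact: hA. Qed.

Lemma subspD A u v : subsp A -> A u -> A v -> A (u + v).
Proof. by move=> [A0 hA] Au Av; rewrite -[u]scale1r; exact: hA. Qed.

Lemma subspN A u : subsp A -> A u -> A (- u).
Proof. by move=> sA Au; rewrite -scaleN1r; exact: subspZ. Qed.

Lemma subspB A u v : subsp A -> A u -> A v -> A (u - v).
Proof. by move=> sA Au Av; apply: subspD => //; exact: subspN. Qed.

Lemma subsp_sum A (I : eqType) (r : seq I) (F : I -> H) : subsp A ->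
  (forall i, i \in r -> A (F i)) -> A (\sum_(i <- r) F i).
Proof.
move=> sA; elim: r => [|i r IH] h; first by rewrite big_nil; case: sA.
rewrite big_cons; apply: subspD => //; first by apply: h; rewrite mem_head.
by apply: IH => j jr; apply: h; rewrite inE jr orbT.
Qed.

Lemma subspI A B : subsp A -> subsp B -> subsp (A `&` B).
Proof.
move=> [A0 hA] [B0 hB]; split=> // a u v [? ?] [? ?].
by split; [exact: hA|exact: hB].
Qed.

Lemma subsp_range (T : H -> H) : bounded_op T -> subsp (range T).
Proof.
move=> bT; split; first by exists 0; rewrite ?(bop0 bT).
by move=> a _ _ [u _ <-] [v _ <-]; exists (a *: u + v); rewrite ?(bopP bT).
Qed.

Lemma subsp_ker (T : H -> H) : bounded_op T -> subsp [set v | T v = 0].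
Proof.
move=> bT; split => /=; first by rewrite ?(bop0 bT).
by move=> a u v /= Tu Tv; rewrite (bopP bT) Tu Tv scaler0 addr0.
Qed.

Lemma subsp_fix (T : H -> H) : bounded_op T -> subsp [set v | T v = v].
Proof.
move=> bT; split => /=; first by rewrite ?(bop0 bT).
by move=> a u v /= Tu Tv; rewrite (bopP bT) Tu Tv.
Qed.

Definition ortho ws : set H := [set v | forall w, w \in ws -> dotp v w = 0].

Lemma subsp_ortho ws : subsp (ortho ws).
Proof.
split=> [w _|a u v hu hv w wws]; first exact: dotp0l.
by rewrite dotpDl dotpZl hu // hv // mulr0 addr0.
Qed.

Lemma subsp0 : subsp [set 0].
Proof. by split=> //= a u v -> ->; rewrite scaler0 addr0. Qed.

Fixpoint ons s : Prop :=
  if s is x :: s' then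
    [/\ hnorm x = 1, (forall y, y \in s' -> dotp x y = 0) & ons s']
  else True.

(** The coefficients are functions on [nat], read only below the size, so that concatenating lists
    amounts to shifting an index. *)
Definition lfree vs := forall c : nat -> R[i],
  \sum_(i < size vs) c i *: vs`_i = 0 -> forall i, (i < size vs)%N -> c i = 0.

Lemma ons_norm s x : ons s -> x \in s -> hnorm x = 1.
Proof.
elim: s => //= y s IH [y1 ys os]; rewrite inE => /orP[/eqP-> //|]; exact: IH.
Qed.

Lemma ons_dotp s x y : ons s -> x \in s -> y \in s -> x <> y -> dotp x y = 0.
Proof.
elim: s => //= z s IH [z1 zs os]; rewrite !inE.
move=> /orP[/eqP->|xs] /orP[/eqP->|ys] xy //; first exact: zs.
- by rewrite dotpC zs // conjc0.
- exact: IH.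
Qed.

Lemma ons_uniq s : ons s -> uniq s.
Proof.
elim: s => //= x s IH [x1 xs os]; rewrite IH // andbT.
apply/negP => /xs; rewrite dotpE x1 expr1n => /eqP.
by rewrite oner_eq0.
Qed.

Lemma ons_coord s (c : H -> R[i]) y : ons s -> y \in s ->
  dotp (\sum_(x <- s) c x *: x) y = c y.
Proof.
move=> os ys; rewrite dotp_suml.
rewrite (bigD1_seq y) ?ons_uniq //= dotpZl dotpE (ons_norm os ys) expr1n mulr1.
rewrite big_seq_cond big1 ?addr0 // => x /andP[xs /eqP xy].
by rewrite dotpZl (ons_dotp os) ?mulr0.
Qed.

Lemma ons_free s : ons s -> lfree s.
Proof.
move=> os c h i il.
have := congr1 (fun v => dotp v s`_i) h; rewrite dotp0l dotp_suml.
rewrite (bigD1 (Ordinal il)) //= dotpZl dotpE (ons_norm os) ?mem_nth // expr1n mulr1.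
rewrite big1 ?addr0 // => j /eqP ji; rewrite dotpZl (ons_dotp os) ?mem_nth ?mulr0 //.
move/eqP; rewrite nth_uniq ?ons_uniq // => /eqP ij.
by apply: ji; apply/val_inj.
Qed.

Definition proj_on s v := \sum_(x <- s) dotp v x *: x.

Lemma proj_on_ortho s v y : ons s -> y \in s -> dotp (v - proj_on s v) y = 0.
Proof. by move=> os ys; rewrite dotpBl (ons_coord (dotp v)) // subrr. Qed.

Lemma proj_on_in s A v : subsp A -> (forall x, x \in s -> A x) -> A (proj_on s v).
Proof. by move=> sA h; apply: subsp_sum => // x xs; apply: subspZ => //; exact: h. Qed.

Lemma rV_kernel m n (M : 'M[R[i]]_(m, n)) : (n < m)%N ->
  exists2 c : 'rV_m, c != 0 & c *m M = 0.
Proof.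
move=> nm; have : kermx M != 0.
  rewrite -mxrank_eq0 mxrank_ker -lt0n subn_gt0.
  by apply: leq_ltn_trans nm; exact: rank_leq_col.
by move/rowV0Pn => [c /sub_kermxP cM c0]; exists c.
Qed.

(** The matrix of inner products has more rows than columns, and a vector in its left kernel gives
    the coefficients. *)
Lemma free_ortho A vs ws : subsp A -> lfree vs -> (forall v, v \in vs -> A v) ->
  (size ws < size vs)%N -> exists v, [/\ A v, v <> 0 & ortho ws v].
Proof.
move=> sA fvs vsA lt.
have [c c0 hc] := rV_kernel
  (\matrix_(i < size vs, j < size ws) dotp vs`_i ws`_j) lt.
pose cn (i : nat) := if insub i is Some j then c 0 j else 0.
have cnE (i : 'I_(size vs)) : cn i = c 0 i by rewrite /cn valK.
exists (\sum_(i < size vs) cn i *: vs`_i); split.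
- by apply: subsp_sum => // i _; apply: subspZ => //; apply: vsA; rewrite mem_nth.
- move=> /fvs h; move/eqP: c0; apply; apply/rowP => i; rewrite mxE -cnE.
  exact: h.
- move=> w /(nthP 0)[j jl <-]; rewrite dotp_suml.
  have := congr1 (fun M : 'rV_(size ws) => M 0 (Ordinal jl)) hc; rewrite !mxE => h.
  by apply: etrans h; apply: eq_bigr => i _; rewrite mxE dotpZl cnE.
Qed.

Lemma normalize A v : subsp A -> A v -> v <> 0 ->
  exists x, [/\ hnorm x = 1, A x & forall w, dotp v w = 0 -> dotp x w = 0].
Proof.
move=> sA Av /hnorm_gt0 v0; exists ((hnorm v)^-1%:C *: v); split.
- by rewrite hnormZ_ge0 ?invr_ge0 ?(ltW v0) // mulVf // gt_eqF.
- exact: subspZ.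
- by move=> w h; rewrite dotpZl h mulr0.
Qed.

Definition ons_in A s := ons s /\ forall x, x \in s -> A x.

Lemma ons_in_cons A s v : subsp A -> ons_in A s -> A v -> v <> 0 -> ortho s v ->
  exists x, ons_in A (x :: s).
Proof.
move=> sA [os As] Av v0 ov; have [x [x1 Ax ox]] := normalize sA Av v0.
exists x; split; first by split=> // y ys; apply/ox/ov.
by move=> y; rewrite inE => /orP[/eqP->|/As].
Qed.

Lemma ons_inS A B s : A `<=` B -> ons_in A s -> ons_in B s.
Proof. by move=> AB [os h]; split=> // x /h/AB. Qed.

(** Each new vector comes from [free_ortho] against [ws] together with the vectors already found:
    [size ws] linear conditions cost at most [size ws] dimensions. *)
Lemma ons_cut A vs ws : subsp A -> lfree vs -> (forall v, v \in vs -> A v) ->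
  exists2 t, ons_in (A `&` ortho ws) t & size t = (size vs - size ws)%N.
Proof.
move=> sA fvs vsA.
suff : forall m, (m <= size vs - size ws)%N ->
    exists2 t, ons_in (A `&` ortho ws) t & size t = m by apply.
elim=> [|m IH] hm; first by exists [::].
have [t ot st] := IH (ltnW hm).
have [|v [Av v0 ov]] := @free_ortho A vs (ws ++ t) sA fvs vsA.
  by rewrite size_cat st; lia.
have [|||x ox] := @ons_in_cons (A `&` ortho ws) t v _ ot _ v0.
- by apply: subspI => //; exact: subsp_ortho.
- by split=> // w hw; apply: ov; rewrite mem_cat hw.
- by move=> w hw; apply: ov; rewrite mem_cat hw orbT.
- by exists (x :: t); rewrite //= st.
Qed.

Definition obasis A s := ons_in A s /\ forall v, A v -> ortho s v -> v = 0.

Lemma obasis_max A s vs : subsp A -> obasis A s -> lfree vs ->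
  (forall v, v \in vs -> A v) -> (size vs <= size s)%N.
Proof.
move=> sA [os h] fvs vsA; rewrite leqNgt; apply/negP => lt.
by have [v [Av v0 ov]] := free_ortho sA fvs vsA lt; apply: v0; exact: h.
Qed.

Lemma obasis_size A s t : subsp A -> obasis A s -> obasis A t -> size s = size t.
Proof.
move=> sA hs ht; apply/eqP; rewrite eqn_leq.
have [[os As] _] := hs; have [[ot At] _] := ht.
rewrite (obasis_max sA ht (ons_free os) As).
by rewrite (obasis_max sA hs (ons_free ot) At).
Qed.

Lemma obasis_exists A N : subsp A -> (forall s, ons_in A s -> (size s <= N)%N) ->
  exists s, obasis A s.
Proof.
move=> sA hN; apply: contrapT => no.
suff : forall m, exists2 s, ons_in A s & size s = m.
  by move=> /(_ N.+1)[s /hN]; rewrite leqNgt => /negP h se; apply: h; rewrite se.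
elim=> [|m [s os se]]; first by exists [::].
have : ~ obasis A s by move=> h; apply: no; exists s.
move=> h; have [v [Av ov v0]] : exists v, [/\ A v, ortho s v & v <> 0].
  apply: contrapT => h'; apply: h; split=> // v Av ov; apply: contrapT => v0.
  by apply: h'; exists v.
by have [x ox] := ons_in_cons sA os Av v0 ov; exists (x :: s); rewrite //= se.
Qed.

Lemma obasisE A s v : subsp A -> obasis A s -> A v -> v = proj_on s v.
Proof.
move=> sA [[os As] h] Av; apply/eqP; rewrite -subr_eq0; apply/eqP/h.
  by apply: subspB => //; exact: proj_on_in.
by move=> y; exact: proj_on_ortho.
Qed.

Definition odim A n := exists2 s, obasis A s & size s = n.

Lemma odim_uniq A n m : subsp A -> odim A n -> odim A m -> n = m.
Proof. by move=> sA [s hs <-] [t ht <-]; exact: (obasis_size sA hs ht). Qed.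

Definition dimo A : nat := xget 0%N [set n | odim A n].

Lemma dimoE A n : subsp A -> odim A n -> dimo A = n.
Proof.
move=> sA h; apply: (odim_uniq sA _ h).
by apply: (@xgetI _ 0%N [set n | odim A n] n); exact: h.
Qed.

Lemma odim_dimo A : subsp A -> (exists n, odim A n) -> odim A (dimo A).
Proof. by move=> sA [n h]; rewrite (dimoE sA h). Qed.

Lemma ons_in_odim A n s : subsp A -> odim A n -> ons_in A s -> (size s <= n)%N.
Proof. by move=> sA [t ht <-] [os As]; exact: (obasis_max sA ht (ons_free os) As). Qed.

Lemma odim_sub A B n : subsp A -> subsp B -> A `<=` B -> odim B n ->
  exists2 m, odim A m & (m <= n)%N.
Proof.
move=> sA sB AB hB.
have hN s : ons_in A s -> (size s <= n)%N.
  by move=> /(ons_inS AB); exact: ons_in_odim.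
have [s hs] := obasis_exists sA hN; exists (size s); first by exists s.
by apply: hN; case: hs.
Qed.

Lemma infinite_ons A : subsp A -> ~ (exists n, odim A n) ->
  forall m, exists2 s, ons_in A s & size s = m.
Proof.
move=> sA no; elim=> [|m [s os se]]; first by exists [::].
have h : ~ obasis A s by move=> h; apply: no; exists (size s), s.
have [v [Av ov v0]] : exists v, [/\ A v, ortho s v & v <> 0].
  apply: contrapT => h'; apply: h; split=> // v Av ov; apply: contrapT => v0.
  by apply: h'; exists v.
by have [x ox] := ons_in_cons sA os Av v0 ov; exists (x :: s); rewrite //= se.
Qed.

Lemma odim_cut A n ws : subsp A -> odim A n ->
  exists m, [/\ odim (A `&` ortho ws) m, (m <= n)%N & (n <= m + size ws)%N].
Proof.
move=> sA hA; have sB : subsp (A `&` ortho ws) by exact: subspI (subsp_ortho _).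
have [m hm mn] := odim_sub sB sA (@subIsetl _ _ _) hA; exists m; split=> //.
have [s [[os As] _] <-] := hA.
have [t ot] := ons_cut ws sA (ons_free os) As.
have := ons_in_odim sB hm ot; lia.
Qed.

(** The kernel of a nonzero functional has codimension exactly one; [odim_cut] only says at most
    one. *)
Lemma odim_cut1 A n v w : subsp A -> odim A n -> A v -> dotp v w <> 0 ->
  (0 < n)%N /\ odim (A `&` ortho [:: w]) n.-1.
Proof.
move=> sA hA Av vw.
have sB : subsp (A `&` ortho [:: w]) by exact: subspI (subsp_ortho _).
have [m [hm mn nm]] := odim_cut [:: w] sA hA; rewrite /= addn1 in nm.
suff mltn : (m < n)%N.
  have -> : n.-1 = m by lia.
  by split=> //; lia.
have [s [[os Bs] hs] se] := hm.
(* The component of [v] orthogonal to a basis of the hyperplane section is nonzero. *)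
pose u := v - proj_on s v.
have Au : A u.
  by apply: subspB => //; apply: proj_on_in => // x /Bs[].
have u0 : u <> 0.
  move=> u0; apply: vw.
  have -> : v = proj_on s v by apply/eqP; rewrite -subr_eq0; apply/eqP.
  have [_] := proj_on_in v sB Bs; apply; exact: mem_head.
have os' : ons_in A s by split=> // x /Bs[].
have [|x ox] := ons_in_cons sA os' Au u0.
  by move=> y ys; exact: proj_on_ortho.
by have := ons_in_odim sA hA ox; rewrite /= se.
Qed.

(** Orthonormal vectors have squared distance 2, while two vectors within 1/2 of one point have
    distance below 1. So an orthonormal family of fixed vectors injects into a finite net. *)
Lemma compact_fix_dim (T : H -> H) A : compact_op T -> subsp A ->
  (forall v, A v -> T v = v) -> exists n, odim A n.
Proof.
move=> cT sA hT; have [s hs] := compact_net cT (ltac:(lra) : 0 < 1/2 :> R).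
have [|t ht] := @obasis_exists A (size s) sA; last by exists (size t), t.
move=> t [ot At].
have hc x : exists c, x \in t -> c \in s /\ hnorm (x - c) < 1/2.
  have [xt|] := boolP (x \in t); last by exists 0.
  have [|c cs hh] := hs x; first by rewrite (ons_norm ot).
  by exists c => _; move: hh; rewrite hT //; exact: At.
have [c {}hc] := choice hc.
have : (size (map c t) <= size s)%N; last by rewrite size_map.
apply: uniq_leq_size; last by move=> _ /mapP[x xt ->]; have [] := hc x xt.
rewrite map_inj_in_uniq ?ons_uniq // => x y xt yt cxy; apply: contrapT => xy.
have d0 := ons_dotp ot xt yt xy.
have := hnormB2 x y; rewrite (rip_eq0 d0) (ons_norm ot xt) (ons_norm ot yt) => h2.
have := ler_hdist x (c x) y; have [_ h3] := hc x xt; have [_ h4] := hc y yt.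
rewrite {2}cxy (hnormB (c y)) => h5; have := hnorm_ge0 (x - y).
have : hnorm (x - y) < 1 by lra.
nra.
Qed.

(** Exchange argument modulo [A]: were there more [e i] than [f j], a kernel vector of the
    coefficient matrix would be a nontrivial combination of the [e i] lying in [A]. *)
Lemma qdim_le A n m (e : 'I_n -> H) (f : 'I_m -> H) (c : 'I_n -> 'I_m -> R[i]) :
  subsp A ->
  (forall i : 'I_n, A (e i - \sum_j c i j *: f j)) ->
  (forall d : 'I_n -> R[i], A (\sum_i d i *: e i) -> forall i, d i = 0) ->
  (n <= m)%N.
Proof.
move=> sA ef fr; rewrite leqNgt; apply/negP => lt.
have [d d0 hd] := rV_kernel (\matrix_(i, j) c i j) lt.
move/eqP: d0; apply; apply/rowP => i; rewrite mxE; apply: (fr (d 0)).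
have -> : \sum_i d 0 i *: e i = \sum_i d 0 i *: (e i - \sum_j c i j *: f j).
  apply/eqP; rewrite -subr_eq0 -sumrB; apply/eqP.
  under eq_bigr => k _ do rewrite -scalerBr opprB addrC subrK scaler_sumr.
  rewrite exchange_big big1 // => j _.
  under eq_bigr => k _ do rewrite scalerA.
  rewrite -scaler_suml.
  have -> : \sum_(i < n) d 0 i * c i j = 0; last by rewrite scale0r.
  have := congr1 (fun M : 'rV_m => M 0 j) hd; rewrite !mxE => hj.
  by apply: etrans hj; apply: eq_bigr => k _; rewrite mxE.
by apply: subsp_sum => // k _; apply: subspZ.
Qed.
End Dimension.

(** * Pairs of projections with compact difference *)

Section ProjectionPairs.
Context {R : realType} {H : hilbertType R}.
Implicit Types (u v w x y z : H) (p q r : H -> H) (s t vs ws : seq H).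

Definition E1 p q : set H := [set v | p v = v /\ q v = 0].

(* For a compact difference [p - q] this is the essential codimension [p : q],
   see [esscodimE] below. *)
Definition ec p q : int := (dimo (E1 p q))%:Z - (dimo (E1 q p))%:Z.

Lemma ec_sym p q : ec q p = - ec p q.
Proof. by rewrite /ec opprB. Qed.

Lemma subsp_E1 p q : projection p -> projection q -> subsp (E1 p q).
Proof.
move=> hp hq; apply: (@subspI _ _ [set v | p v = v] [set v | q v = 0]).
  exact: subsp_fix (proj_bop hp).
exact: subsp_ker (proj_bop hq).
Qed.

Lemma proj_fix_norm p v : projection p -> hnorm v <= hnorm (p v) -> p v = v.
Proof.
move=> hp h; apply/eqP; rewrite eq_sym -subr_eq0; apply/eqP/hnorm_eq0/eqP.
rewrite -sqrf_eq0 hnormB2 ripC (proj_rip2 hp); apply/eqP.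
have := proj_norm hp v => h'.
have -> : hnorm (p v) = hnorm v by apply/eqP; rewrite eq_le h h'.
by ring.
Qed.

Section pair.
Variables (p q : H -> H) (hp : projection p) (hq : projection q).
Let a := p \- q.

Lemma rip_diff v : rip (a v) v = hnorm (p v) ^+ 2 - hnorm (q v) ^+ 2.
Proof. by rewrite /a /= ripBl !proj_rip2. Qed.

Lemma rip_diff_sym u v : rip (a u) v = rip u (a v).
Proof. by rewrite /a /= ripBl ripBr !proj_rip. Qed.

(** The identity [(p - q)^2 + (1 - p - q)^2 = 1], read as a quadratic form. *)
Lemma norm_diff_le v : hnorm (a v) <= hnorm v.
Proof.
rewrite -hnorm_sqr_le.
have := sqr_ge0 (hnorm (v - (p v + q v))); rewrite /a /= hnormB2 hnormD2 hnormB2.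
by rewrite ripDr (ripC v) (ripC v (q v)) !proj_rip2 //; lra.
Qed.

(** The form gives [|p v|^2 - |q v|^2 = |v|^2]; as [|p v| <= |v|], this forces [|p v| = |v|] and
    [q v = 0]. *)
Lemma diff_fix v : a v = v -> E1 p q v.
Proof.
move=> av; have := rip_diff v; rewrite av ripuu => h.
have h1 := proj_norm hp v; have h2 := hnorm_ge0 (q v).
have h3 := hnorm_ge0 v; have h4 := hnorm_ge0 (p v).
split; first by apply: proj_fix_norm => //; rewrite -hnorm_sqr_le; nra.
apply: hnorm_eq0; apply/eqP; rewrite -sqrf_eq0; apply/eqP.
by rewrite -hnorm_sqr_le in h1; apply/eqP; rewrite eq_le sqr_ge0 andbT; lra.
Qed.

Lemma E1_diff v : E1 p q v -> a v = v.
Proof. by move=> [pv qv]; rewrite /a /= pv qv subr0. Qed.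

Lemma E1_perp v w : E1 p q v -> E1 q p w -> dotp v w = 0.
Proof. by move=> [pv _] [_ pw]; rewrite -pv (proj_adj hp) pw dotp0r. Qed.

Hypothesis ca : compact_op a.

Lemma E1_finite : exists n, odim (E1 p q) n.
Proof. by apply: (compact_fix_dim ca (subsp_E1 hp hq)) => v; exact: E1_diff. Qed.

Lemma E1_odim : odim (E1 p q) (dimo (E1 p q)).
Proof. exact: odim_dimo (subsp_E1 hp hq) E1_finite. Qed.

(** By [diff_fix] only 0 is both fixed by [a] and orthogonal to [E1 p q], so [compact_gap] applies.
    With [|a v| <= |v|], squaring [d |v| <= |a v - v|] bounds the form by [(1 - d^2 / 2) |v|^2]. *)
Lemma diff_gap : exists2 d : R, 0 < d <= 1 &
  forall v, (forall w, E1 p q w -> dotp v w = 0) -> rip (a v) v <= (1 - d) * hnorm v ^+ 2.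
Proof.
have [|r v h w /h|v h av|d d0 hd] :=
  @compact_gap _ _ a [set v | forall w, E1 p q w -> dotp v w = 0] ca.
- move=> v hv w Ew; apply: (@hclosed_dotp _ _ w) => e /hv[z hz ?].
  by exists z => //; exact: hz.
- by rewrite dotpZl => ->; rewrite mulr0.
- by have := h _ (diff_fix av); rewrite dotpE => /eqP; rewrite -(rmorph0 (real_complex R))
    (inj_eq (@complexI _)) sqrf_eq0 => /eqP/hnorm_eq0.
exists (Num.min 1 (d ^+ 2 / 2)).
  by rewrite lt_min ge_min lexx andbT ltr01 /= divr_gt0 ?exprn_gt0.
move=> v /hd {}hd.
have h0 : 0 <= d * hnorm v by rewrite mulr_ge0 ?hnorm_ge0 // ltW.
have : (d * hnorm v) ^+ 2 <= hnorm (a v - v) ^+ 2.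
  by rewrite ler_sqr ?nnegrE ?hnorm_ge0.
have := norm_diff_le v; rewrite -hnorm_sqr_le (hnormB2 (a v)) exprMn => h1 h2.
have h3 : Num.min 1 (d ^+ 2 / 2) <= d ^+ 2 / 2 by rewrite ge_min lexx orbT.
have := ler_wpM2r (sqr_ge0 (hnorm v)) h3.
by rewrite mulrBl; lra.
Qed.
End pair.

(* [q p q] restricted to [ran q] is the identity plus a contraction on the
   orthogonal complement of its kernel [E1 q p]. *)
Lemma pair_closed_range p q w : projection p -> projection q -> compact_op (q \- p) ->
  q w = w -> (forall e, E1 q p e -> dotp w e = 0) ->
  exists u, p u = u /\ q u = w.
Proof.
move=> hp hq ca qw wE; have [d /andP[d0 d1] hd] := diff_gap hq hp ca.
have bp := proj_bop hp; have bq := proj_bop hq.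
pose K := [set v | q v = v] `&` [set v | forall e, E1 q p e -> dotp v e = 0].
(* A fixed point [v] of [f] solves [q (p v) = w]; the vector sought is [p v]. *)
pose f v := w + (v - q (p v)).
have KB u v : K u -> K v -> K (u - v).
  move=> [qu hu] [qv hv]; split => [|e Ee] /=; first by rewrite (bopB bq) qu qv.
  by rewrite dotpBl hu // hv // subrr.
have Kqp u : K (q (p u)).
  split=> [|e [qe pe]] /=; first exact: projK.
  by rewrite (proj_adj hq) qe (proj_adj hp) pe dotp0r.
have Kw : K w by [].
(* The rate: for [z] in [K], [|z - q p z|^2 <= |z|^2 - |p z|^2 <= (1 - d) |z|^2 <= (1 - d / 2)^2
   |z|^2]. *)
have [|||u Ku|u v Ku Kv|v Kv fv] := @hnorm_fixed_point _ _ K f (1 - d / 2).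
- by apply/andP; split; lra.
- apply: hclosedI; first exact: proj_closed_ran.
  move=> v hv e Ee; apply: (@hclosed_dotp _ _ e) => eps /hv[z hz ?].
  by exists z => //; exact: hz.
- by exists w.
(* [KB] provides differences only, so [w] is added by subtracting [(w - w) - w]. *)
- have := KB _ _ (KB _ _ Ku (Kqp u)) (KB _ _ (KB _ _ Kw Kw) Kw).
  by rewrite subrr sub0r opprK addrC.
- have -> : f u - f v = (u - v) - q (p (u - v)).
    rewrite /f (bopB bp) (bopB bq) opprD addrACA subrr add0r.
    by rewrite !opprB addrACA [RHS]addrACA; congr (_ + _); rewrite addrC.
  have [qz hz] := KB _ _ Ku Kv; move: (u - v) qz hz => z /= qz hz.
  have dz : 0 <= 1 - d / 2 by lra.
  rewrite -(ler_sqr (x := hnorm _)) ?nnegrE ?mulr_ge0 ?hnorm_ge0 //.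
  have := hd z hz; rewrite (rip_diff hq hp) qz hnormB2.
  have -> : rip z (q (p z)) = hnorm (p z) ^+ 2.
    by rewrite -(proj_rip hq) qz ripC (proj_rip2 hp).
  have := proj_norm hq (p z); rewrite -hnorm_sqr_le exprMn => h1 h2.
  have := sqr_ge0 (hnorm z); have := sqr_ge0 d => h3 h4; nra.
exists (p v); split; first exact: projK.
move: fv; rewrite /f addrCA => /eqP; rewrite -subr_eq0 addrAC subrr add0r subr_eq0.
by move=> /eqP->.
Qed.

Section rank_one_step.
Variables (p r : H -> H) (v : H).
Hypotheses (hp : projection p) (hr : projection r) (v1 : hnorm v = 1) (pv : p v = v).
Let p' := p \- rank1 v v.

Lemma proj_sub_rank1 : projection p'.
Proof.
have bp := proj_bop hp.
apply/projP; split.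
- exact: bop_sub bp (bop_rank1 v v).
- move=> u; rewrite /p' /= /rank1 (bopB bp) (bopZ bp) pv projK // dotpBl dotpZl dotpE v1.
  by rewrite (proj_adj hp) pv expr1n mulr1 subrr scale0r subr0.
- by apply: adj_sub (proj_adj hp) (adj_rank1 v v).
Qed.

(** Passing to [p'] cuts [E1 p r] by the orthogonality to [v], and [E1 r p] is the same cut of
    [E1 r p']. Exactly one of the two cuts is proper: either some [e] in [E1 p r] is not orthogonal
    to [v], which excludes a new vector in [E1 r p'], or [v] is orthogonal to [E1 p r] and the
    closed range supplies such a vector. *)
Lemma ec_sub_rank1 : compact_op (p \- r) -> ec p r = ec p' r + 1.
Proof.
move=> ca; have bp := proj_bop hp; have hp' := proj_sub_rank1.
have v2 : dotp v v = 1 by rewrite dotpE v1 expr1n.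
have p'E w : p' w = p w - dotp w v *: v by [].
have ca' : compact_op (p' \- r).
  have -> : p' \- r = (p \- r) \- rank1 v v.
    by apply/funext => w; rewrite /p' /= addrAC.
  exact: compact_sub ca (compact_rank1 _ _).
have caN : compact_op (r \- p).
  by have := compact_opp ca; congr compact_op; apply/funext => w /=; rewrite opprB.
have ca'N : compact_op (r \- p').
  by have := compact_opp ca'; congr compact_op; apply/funext => w /=; rewrite opprB.
have dotpv w : dotp (p w) v = dotp w v by rewrite (proj_adj hp) pv.
have EA : E1 p' r = E1 p r `&` ortho [:: v].
  apply/seteqP; split=> [w [p'w rw]|w [[pw rw] ow]].
    have pw : p w = w.
      rewrite -[in LHS]p'w p'E (bopB bp) (bopZ bp) projK // pv -p'E //.
    split=> // x; rewrite inE => /eqP->.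
    have := p'w; rewrite p'E pw => /eqP; rewrite subr_eq addrC -subr_eq subrr eq_sym.
    by rewrite scaler_eq0 => /orP[/eqP//|/eqP v0]; rewrite v0 dotp0r.
  split=> //; rewrite p'E pw ow ?mem_head // scale0r subr0 //.
have EB : E1 r p = E1 r p' `&` ortho [:: v].
  apply/seteqP; split=> [w [rw pw]|w [[rw p'w] ow]].
    have wv : dotp w v = 0 by rewrite -dotpv pw dotp0l.
    split; last by move=> x; rewrite inE => /eqP->.
    by split=> //; rewrite p'E pw wv scale0r subr0.
  by split=> //; move: p'w; rewrite p'E ow ?mem_head // scale0r subr0.
have sA := subsp_E1 hp hr; have sA' := subsp_E1 hp' hr.
have sB := subsp_E1 hr hp; have sB' := subsp_E1 hr hp'.
have [[e [Ae ev]]|no] := pselect (exists e, E1 p r e /\ dotp e v <> 0).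
  have [N0 hA'] := odim_cut1 sA (E1_odim hp hr ca) Ae ev.
  rewrite -EA in hA'; have EB' : E1 r p = E1 r p'.
    rewrite EB; apply/setIidPl => w [rw p'w] x; rewrite inE => /eqP->.
    have [pe re] := Ae.
    have : dotp e (p w) = 0 by rewrite -(proj_adj hp) pe -rw -(proj_adj hr) re dotp0l.
    have -> : p w = dotp w v *: v.
      by apply/eqP; rewrite -subr_eq0 -p'E p'w.
    rewrite dotpZr => /eqP; rewrite mulf_eq0 => /orP[/eqP h|/eqP//].
    by rewrite -[dotp w v]conjcK h conjc0.
  rewrite /ec -EB' (dimoE sA' hA'); lia.
have EA' : E1 p' r = E1 p r.
  rewrite EA; apply/setIidPl => w Aw x; rewrite inE => /eqP->.
  by apply: contrapT => h; apply: no; exists w.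
(* This [w] is the new vector: [p w = v] means that [p'] kills it. *)
have [w [rw pw]] : exists u, r u = u /\ p u = v.
  apply: pair_closed_range => // e Ae; apply: contrapT => h.
  apply: no; exists e; split=> // h'; apply: h.
  by rewrite dotpC h' conjc0.
have wv : dotp w v = 1 by rewrite -dotpv pw.
have B'w : E1 r p' w by split=> //; rewrite p'E pw wv scale1r subrr.
have [|N0 hB] := odim_cut1 sB' (E1_odim hr hp' ca'N) B'w (w := v).
  by rewrite wv; apply/eqP; rewrite oner_eq0.
rewrite -EB in hB.
rewrite /ec EA' (dimoE sB hB); lia.
Qed.
End rank_one_step.

Lemma lfree_cat vs ws : lfree ws ->
  (forall c d : nat -> R[i],
     \sum_(i < size vs) c i *: vs`_i + \sum_(i < size ws) d i *: ws`_i = 0 ->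
     forall i, (i < size vs)%N -> c i = 0) ->
  lfree (vs ++ ws).
Proof.
move=> fw h c.
rewrite -(big_mkord xpredT (fun i => c i *: (vs ++ ws)`_i)) size_cat.
rewrite (big_cat_nat _ (n := size vs)) ?leq_addr //=.
rewrite -{2}[size vs]add0n big_addn addKn !big_mkord.
under eq_bigr => i _ do rewrite nth_cat ltn_ord.
under [X in _ + X = 0]eq_bigr => i _ do
  rewrite nth_cat ltnNge leq_addl /= addnK.
move=> hc; have c0 := h _ (fun i => c (i + size vs)%N) hc.
have d0 := fw (fun i => c (i + size vs)%N).
move: hc; rewrite big1 ?add0r; last by move=> i _; rewrite c0 ?scale0r.
move=> /d0 {}d0 i hi; have [/c0//|le] := ltnP i (size vs).
by rewrite -(subnK le); apply: d0; lia.
Qed.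

(** Let [Z] be the vectors killed by [q'] that lie in the range of [p'] up to an element of
    [E1 q p]. It contains [E1 p' q'] and one further independent vector for each of at least
    [dim E1 q p - dim E1 q' p'] orthonormal vectors of [E1 q p]. For close pairs only 0 in [Z] is
    orthogonal to [E1 p q], so all these vectors number at most [dim E1 p q]. *)
Lemma ec_semicontinuous p q :
  projection p -> projection q -> compact_op (p \- q) ->
  exists2 e : R, 0 < e & exists ws, forall p' q',
    projection p' -> projection q' -> compact_op (p' \- q') ->
    (forall v, hnorm ((p' v - q' v) - (p v - q v)) <= e * hnorm v) ->
    (forall w, w \in ws -> hnorm (q' w - q w) <= e) -> ec p' q' <= ec p q.
Proof.
move=> hp hq ca; have [d /andP[d0 d1] hd] := diff_gap hp hq ca.
have caN : compact_op (q \- p).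
  by have := compact_opp ca; congr compact_op; apply/funext => w /=; rewrite opprB.
have sE := subsp_E1 hp hq; have sF := subsp_E1 hq hp.
have [ws hws sws] := E1_odim hq hp caN; have [[ows Fws] _] := hws.
set M := dimo (E1 q p) in sws.
have M1 : 0 < M%:R + 1 :> R by rewrite ltr_wpDl.
(* [M] basis vectors moved by at most [e] each let [q'] move a unit vector of [E1 q p] by [M e]; one
   more [e] pays for the change of [p - q]. So [p'] has norm at most [(M + 1) e = d / 10] on
   [E1 q p]. *)
pose e : R := d / (10 * (M%:R + 1)).
have e0 : 0 < e by rewrite divr_gt0 // mulr_gt0.
have eE : (M%:R + 1) * e = d / 10 by rewrite /e; field; rewrite gt_eqF.
have ed : e <= d / 10.
  by rewrite -eE ler_peMl ?(ltW e0) // lerDr.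
exists e => //; exists ws => p' q' hp' hq' ca' ha hw.
have caN' : compact_op (q' \- p').
  by have := compact_opp ca'; congr compact_op; apply/funext => w /=; rewrite opprB.
have sE' := subsp_E1 hp' hq'; have sF' := subsp_E1 hq' hp'.
have bp' := proj_bop hp'; have bq' := proj_bop hq'.
have bp := proj_bop hp; have bq := proj_bop hq.
have hq'w w : E1 q p w -> hnorm (q' w - w) <= M%:R * e * hnorm w.
  move=> Fw; have [qw _] := Fw.
  have -> : q' w - w = \sum_(x <- ws) dotp w x *: (q' x - q x).
    have E := obasisE sF hws Fw.
    transitivity (q' (proj_on ws w) - q (proj_on ws w)); first by rewrite -E qw.
    rewrite /proj_on (bop_sum bq') (bop_sum bq) -sumrB; apply: eq_bigr => x _.
    by rewrite (bopZ bq') (bopZ bq) scalerBr.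
  have -> : M%:R * e * hnorm w = \sum_(x <- ws) e * hnorm w.
    by rewrite big_const_seq count_predT sws iter_addr_0 -[RHS]mulr_natl mulrA.
  elim: (ws) (hw) (ows) => [|x s IH] hx /=; first by rewrite !big_nil hnorm0.
  move=> [x1 _ os]; rewrite !big_cons; apply: le_trans (ler_hnormD _ _) _.
  apply: lerD; last by apply: IH => // y ys; apply: hx; rewrite inE ys orbT.
  rewrite hnormZ mulrC.
  apply: ler_pM; rewrite ?hnorm_ge0 //.
  - by have : 0 <= `|dotp w x| by []; rewrite lecE => /andP[].
  - by apply: hx; rewrite mem_head.
  - by apply: le_trans (dotp_norm_le _ _) _; rewrite x1 mulr1.
have hp'w w : E1 q p w -> hnorm (p' w) <= d / 10 * hnorm w.
  move=> Fw; have [qw pw] := Fw.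
  have -> : p' w = ((p' w - q' w) - (p w - q w)) + (q' w - w).
    by rewrite qw pw; vring.
  apply: le_trans (ler_hnormD _ _) _; rewrite -eE mulrDl mul1r mulrDl addrC.
  by apply: lerD; [exact: hq'w|exact: ha].
pose Z := [set z | q' z = 0 /\ exists2 w, E1 q p w & p' (z - w) = z - w].
have sZ : subsp Z.
  split; first split; rewrite ?(bop0 bq') //.
    by exists 0; rewrite ?subrr ?(bop0 bp') //; case: sF.
  move=> c y z [qy [wy Fy hy]] [qz [wz Fz hz]]; split.
    by rewrite (bopP bq') qy qz scaler0 addr0.
  exists (c *: wy + wz); first by case: sF => _; apply.
  have -> : c *: y + z - (c *: wy + wz) = c *: (y - wy) + (z - wz).
    by rewrite scalerBr opprD addrACA.
  by rewrite (bopP bp') hy hz.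
(* Write [z = u + w] with [p' u = u]. As [q' z = 0], the square [|p' z|^2] exceeds the form of
   [p - q] at [z] by at most [e |z|^2]. That form is at most [(1 - d) |u|^2 - 2 rip u w - |w|^2],
   whereas [|p' z|^2] is at least [|u|^2 + 2 rip u w]. The mixed term is small because [p'] is small
   at [w], so [u = w = 0]. *)
have Z0 z : Z z -> (forall x, E1 p q x -> dotp z x = 0) -> z = 0.
  move=> [qz [w Fw]]; set u := z - w => p'u zE.
  have [qw pw] := Fw; have uE x : E1 p q x -> dotp u x = 0.
    move=> Ex; rewrite dotpBl zE // sub0r [dotp w x]dotpC (E1_perp hp Ex Fw).
    by rewrite conjc0 oppr0.
  have zuw : z = u + w by rewrite subrK.
  have h1 := hd u uE; have h2 := hp'w w Fw.
  have h3 : `|rip u w| <= d / 10 * hnorm w * hnorm u.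
    rewrite -p'u (proj_rip hp'); apply: le_trans (rip_le _ _) _.
    by rewrite mulrC p'u; apply: ler_wpM2r; rewrite ?hnorm_ge0.
  have h4 : hnorm (p' z) ^+ 2 <= rip (p z - q z) z + e * hnorm z ^+ 2.
    rewrite -(proj_rip2 hp') -lerBlDl.
    have -> : rip (p' z) z - rip (p z - q z) z =
        rip ((p' z - q' z) - (p z - q z)) z by rewrite qz subr0 [RHS]ripBl.
    apply: le_trans (rip_ler _ _) _; rewrite expr2 mulrA.
    by apply: ler_wpM2r; rewrite ?hnorm_ge0.
  have h5 : hnorm (p' z) ^+ 2 = hnorm u ^+ 2 + 2 * rip u w + hnorm (p' w) ^+ 2.
    by rewrite zuw (bopD bp') p'u hnormD2 -(proj_rip hp') p'u.
  have h6 : rip (p z - q z) z = rip (p u - q u) u - 2 * rip u w - hnorm w ^+ 2.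
    rewrite zuw (bopD bp) (bopD bq) pw qw addr0.
    have -> : p u - (q u + w) = (p u - q u) - w by rewrite opprD addrA.
    have := rip_diff_sym hp hq u w; rewrite /= pw qw sub0r ripNr => h.
    rewrite ripDr (ripBl (p u - q u) w u) (ripBl (p u - q u) w w) h (ripC w u) ripuu.
    by lra.
  have h7 := hnormD2 u w; rewrite -zuw in h7.
  have u0 := hnorm_ge0 u; have w0 := hnorm_ge0 w.
  move: h1; rewrite /= -/u => h1.
  set U := hnorm u in h1 h2 h3 h4 h5 h6 h7 u0.
  set W := hnorm w in h2 h3 h4 h5 h6 h7 w0.
  have p0 := sqr_ge0 (hnorm (p' w)).
  move: h3; rewrite ler_norml => /andP[h3 h3'].
  have UW : 2 * (U * W) <= U ^+ 2 + W ^+ 2 by have := sqr_ge0 (U - W); nra.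
  have dUW : d * (2 * (U * W)) <= d * (U ^+ 2 + W ^+ 2) by rewrite ler_wpM2l // ltW.
  have k1 : - (d / 20 * (U ^+ 2 + W ^+ 2)) <= rip u w.
    by apply: le_trans h3; rewrite lerN2; lra.
  have k2 : rip u w <= d / 20 * (U ^+ 2 + W ^+ 2).
    by apply: le_trans h3' _; lra.
  have S0 : 0 <= U ^+ 2 + W ^+ 2 by rewrite addr_ge0 ?sqr_ge0.
  have k3 : hnorm z ^+ 2 <= 2 * (U ^+ 2 + W ^+ 2).
    have : d * (U ^+ 2 + W ^+ 2) <= U ^+ 2 + W ^+ 2 by rewrite ler_piMl.
    by rewrite h7; lra.
  have k4 : e * hnorm z ^+ 2 <= d / 10 * (2 * (U ^+ 2 + W ^+ 2)).
    by apply: ler_pM; rewrite ?sqr_ge0 // ltW.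
  have W2 : d * W ^+ 2 <= W ^+ 2 by rewrite ler_piMl ?sqr_ge0.
  have k5 : d * (U ^+ 2 + W ^+ 2) <= 0 by lra.
  have k6 : U ^+ 2 + W ^+ 2 <= 0 by rewrite -(pmulr_rle0 _ d0).
  have := sqr_ge0 U; have := sqr_ge0 W => W20 U20.
  have U00 : U = 0 by apply/eqP; rewrite -sqrf_eq0; apply/eqP; lra.
  have W00 : W = 0 by apply/eqP; rewrite -sqrf_eq0; apply/eqP; lra.
  by rewrite zuw (hnorm_eq0 U00) (hnorm_eq0 W00) addr0.
have [es hes ses] := E1_odim hp hq ca.
have [es' hes' ses'] := E1_odim hp' hq' ca'.
have [fs' hfs' sfs'] := E1_odim hq' hp' caN'.
have [[oes' Ees'] _] := hes'.
have [t [ot ht] st] := ons_cut fs' sF (ons_free ows) Fws.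
(* As [w] is orthogonal to [E1 q' p'], its image [q' w] equals [q' u] for some [u] in the range of
   [p']; take [z = w - u]. *)
have hz w : exists z, w \in t -> q' z = 0 /\ p' (z - w) = z - w.
  have [wt|] := boolP (w \in t); last by exists 0.
  have [Fw ow] := ht w wt.
  have [||u [pu qu]] := @pair_closed_range p' q' (q' w) hp' hq' caN'.
  - exact: projK.
  - move=> x Ex; have [qx _] := Ex; rewrite (proj_adj hq') qx.
    rewrite (obasisE sF' hfs' Ex) dotp_sumr big_seq_cond big1 // => y.
    by rewrite andbT => yf; rewrite dotpZr ow ?mulr0.
  exists (w - u) => _; rewrite (bopB bq') qu subrr; split=> //.
  by rewrite addrC addKr (bopN bp') pu.
have [g hg] := choice hz.
have fr : lfree (map g t ++ es').
  apply: lfree_cat; first exact: ons_free.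
  move=> c d'; rewrite !size_map => hcd.
  apply: (ons_free ot).

  (* A linear relation makes this vector of [E1 q p] fixed by [p']; by [hp'w] and [d / 10 < 1] it is
     0. *)
  set w := \sum_(i < size t) c i *: t`_i.
  have Fw : E1 q p w.
    apply: subsp_sum => // i _; apply: subspZ => //.
    by have [] := ht t`_i (mem_nth _ (ltn_ord i)).
  have p'w : p' w = w.
    have -> : w = - (\sum_(i < size t) c i *: (g t`_i - t`_i) +
                     \sum_(i < size es') d' i *: es'`_i).
      apply/eqP; rewrite -subr_eq0 opprK /w addrA -big_split /=; apply/eqP.
      rewrite -[RHS]hcd; congr (_ + _); apply: eq_bigr => i _.
      by rewrite scalerBr addrC subrK (nth_map 0).
    rewrite (bopN bp') (bopD bp') !(bop_sum bp'); congr (- (_ + _));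
      apply: eq_bigr => i _; rewrite (bopZ bp'); congr (_ *: _).
      by have [] := hg _ (mem_nth 0 (ltn_ord i)).
    by have [] := Ees' _ (mem_nth 0 (ltn_ord i)).
  apply: hnorm_eq0; have := hp'w w Fw; rewrite p'w => h.
  by have := hnorm_ge0 w => h'; nra.
have Zvs v : v \in map g t ++ es' -> Z v.
  rewrite mem_cat => /orP[/mapP[w wt ->]|ve].
    have [qg pg] := hg w wt; split=> //; exists w => //.
    by have [] := ht w wt.
  have [pv qv] := Ees' v ve; split=> //; exists 0; first by case: sF.
  by rewrite subr0.
have : (size (map g t ++ es') <= size es)%N.
  rewrite leqNgt; apply/negP => lt.
  have [z [Zz z0 oz]] := free_ortho sZ fr Zvs lt; apply: z0; apply: Z0 => // x Ex.
  rewrite (obasisE sE hes Ex) dotp_sumr big_seq_cond big1 // => y.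
  by rewrite andbT => yf; rewrite dotpZr oz ?mulr0.
by rewrite size_cat size_map ses ses' st sws sfs' /ec -/M; lia.
Qed.

End ProjectionPairs.

(** * Fields of projections on the line *)

Section RealInduction.
Context {R : realType}.

(** The supremum of the points satisfying [P] cannot lie below [b]. The step starts at some [c']
    slightly below [c], because [P] is not known at the supremum itself. *)
Lemma real_induction (a b : R) (P : R -> Prop) : a <= b -> P a ->
  (forall c, a <= c <= b -> exists2 d : R, 0 < d &
     forall c' e, a <= c' <= c -> c - d < c' -> c' <= e <= b -> e < c + d ->
       P c' -> P e) -> P b.
Proof.
move=> ab Pa step.
pose S := [set c | a <= c <= b /\ P c].
have Sa : S a by split=> //; rewrite lexx ab.
have hS : has_sup S by split; [exists a | exists b => c [/andP[]]].
pose c := sup S.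
have ac : a <= c by apply: sup_upper_bound.
have cb : c <= b by apply: ge_sup; [exists a | move=> x [/andP[]]].
have [|d d0 hd] := step c; first by rewrite ac.
have [c' [/andP[ac' c'b] piece_set'] lt] := sup_adherent d0 hS.
have c'c : c' <= c by apply: sup_upper_bound => //; split=> //; rewrite ac'.
have PE e : c' <= e <= b -> e < c + d -> P e.
  by move=> h1 h2; apply: (hd c') => //; rewrite ac'.
have [bc|bc] := leP b c; first by apply: PE; [rewrite c'b lexx|lra].
pose e := Num.min b (c + d / 2).
have ce : c < e by rewrite lt_min bc; lra.
have eb : e <= b by rewrite ge_min lexx.
have ed : e < c + d by rewrite gt_min; apply/orP; right; lra.
have : S e.
  split; first by rewrite eb andbT; lra.
  by apply: PE => //; rewrite eb andbT; lra.
by move=> /(sup_upper_bound hS); rewrite leNgt ce.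
Qed.

Lemma locally_constant_le (T : Type) (D : set R) (f : R -> T) :
  (forall x y z, D x -> D y -> x <= z <= y -> D z) ->
  (forall t, D t -> exists2 d : R, 0 < d &
     forall s, D s -> `|s - t| < d -> f s = f t) ->
  forall x y, D x -> D y -> f x = f y.
Proof.
move=> convD loc.
suff le_case x y : D x -> D y -> x <= y -> f x = f y.
  move=> x y Dx Dy; have [|/ltW] := leP x y; first exact: le_case.
  by move=> yx; apply/esym; exact: le_case.
move=> Dx Dy xy; apply: (@real_induction x y (fun c => f x = f c)) => // c hc.
have [d d0 hd] := loc c (convD _ _ _ Dx Dy hc).
exists d => // c' e hc' lt he lt' ->.
have Dc' : D c' by apply: convD Dx Dy _; lra.
have De : D e by apply: convD Dx Dy _; lra.
rewrite hd //; last by rewrite ltr_norml; lra.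
by rewrite hd // ltr_norml; lra.
Qed.
End RealInduction.

(** * Strongly continuous fields of projections and norm continuous fields of compact operators *)

Section Fields.
Context {R : realType} {H : hilbertType R}.
Implicit Types (u v w x y z : H) (p q r S T : H -> H) (f g h : R -> H -> H) (D : set R).

Definition scont D f := forall u t, D t -> forall e : R, 0 < e -> exists2 d : R, 0 < d &
  forall s, D s -> `|s - t| < d -> hnorm (f s u - f t u) <= e.

(** Operator norm continuity written as an estimate on vectors, which avoids the supremum in
    [opnorm]. *)
Definition ncont D f := forall t, D t -> forall e : R, 0 < e -> exists2 d : R, 0 < d &
  forall s, D s -> `|s - t| < d -> forall u, hnorm (f s u - f t u) <= e * hnorm u.

Definition pfield D f := (forall t, D t -> projection (f t)) /\ scont D f.

Lemma near_and D (t : R) (P Q : R -> Prop) :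
  (exists2 d : R, 0 < d & forall s, D s -> `|s - t| < d -> P s) ->
  (exists2 d : R, 0 < d & forall s, D s -> `|s - t| < d -> Q s) ->
  exists2 d : R, 0 < d & forall s, D s -> `|s - t| < d -> P s /\ Q s.
Proof.
move=> [d d0 hd] [e e0 he]; exists (Num.min d e); first by rewrite lt_min d0.
by move=> s Ds; rewrite lt_min => /andP[? ?]; split; [exact: hd|exact: he].
Qed.

Lemma near_seq (I : eqType) D (t : R) (r : seq I) (P : I -> R -> Prop) :
  (forall i, i \in r ->
     exists2 d : R, 0 < d & forall s, D s -> `|s - t| < d -> P i s) ->
  exists2 d : R, 0 < d & forall s, D s -> `|s - t| < d -> forall i, i \in r -> P i s.
Proof.
elim: r => [|i r IH] h; first by exists 1.
have hr j : j \in r ->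
    exists2 d : R, 0 < d & forall s, D s -> `|s - t| < d -> P j s.
  by move=> jr; apply: h; rewrite inE jr orbT.
have [d d0 hd] := near_and (h i (mem_head _ _)) (IH hr).
by exists d => // s Ds lt j; have [? hj] := hd s Ds lt; rewrite inE => /orP[/eqP->|/hj].
Qed.

Lemma near_mono D (t : R) (P Q : R -> Prop) :
  (forall s, D s -> P s -> Q s) ->
  (exists2 d : R, 0 < d & forall s, D s -> `|s - t| < d -> P s) ->
  exists2 d : R, 0 < d & forall s, D s -> `|s - t| < d -> Q s.
Proof. by move=> PQ [d d0 hd]; exists d => // s Ds lt; apply: PQ => //; exact: hd. Qed.

(* Compactness of the adjoints is required so that a norm continuous field can be
   multiplied by a strongly continuous one on either side. *)
Definition Kfield D f := ncont D f /\ exists f', forall t, D t ->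
  [/\ adj (f t) (f' t), compact_op (f t) & compact_op (f' t)].

Lemma ncont_ext D f g : (forall t u, D t -> f t u = g t u) -> ncont D f -> ncont D g.
Proof.
move=> fg hf t Dt e e0; have [d d0 hd] := hf t Dt e e0; exists d => // s Ds lt u.
by rewrite -!fg //; exact: hd.
Qed.

Lemma ncont_add D f g : ncont D f -> ncont D g -> ncont D (fun t => f t \+ g t).
Proof.
move=> hf hg t Dt e e0; have e2 : 0 < e / 2 by rewrite divr_gt0.
apply: near_mono (near_and (hf t Dt _ e2) (hg t Dt _ e2)) => s Ds [h1 h2] u /=.
rewrite opprD addrACA; apply: le_trans (ler_hnormD _ _) _.
by have := h1 u; have := h2 u; lra.
Qed.

Lemma ncont_local_bound D f t : ncont D f -> D t -> bounded_op (f t) ->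
  exists2 C : R, 0 < C & exists2 d : R, 0 < d &
    forall s, D s -> `|s - t| < d -> forall u, hnorm (f s u) <= C * hnorm u.
Proof.
move=> hf Dt bt; have [C C0 hC] := bop_bound bt; exists (C + 1); first lra.
apply: near_mono (hf t Dt 1 ltr01) => s Ds h u.
rewrite -[f s u](subrK (f t u)) addrC; apply: le_trans (ler_hnormD _ _) _.
by have := hC u; have := h u; lra.
Qed.

Lemma ncont_comp D f g : (forall t, D t -> bounded_op (f t)) ->
  (forall t, D t -> bounded_op (g t)) ->
  ncont D f -> ncont D g -> ncont D (fun t => f t \o g t).
Proof.
move=> bf bg hf hg t Dt e e0.
have [C C0 hC] := bop_bound (bf t Dt).
have [B B0 hB] := ncont_local_bound hg Dt (bg t Dt).
have e1 : 0 < e / 2 / B by rewrite !divr_gt0.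
have e2 : 0 < e / 2 / C by rewrite !divr_gt0.
apply: near_mono (near_and hB (near_and (hf t Dt _ e1) (hg t Dt _ e2))).
move=> s Ds [h1 [h2 h3]] u /=.
have -> : f s (g s u) - f t (g t u) =
    (f s (g s u) - f t (g s u)) + f t (g s u - g t u).
  by rewrite (bopB (bf t Dt)); vring.
apply: le_trans (ler_hnormD _ _) _.
have n0 := hnorm_ge0 u.
have k1 : hnorm (f s (g s u) - f t (g s u)) <= e / 2 * hnorm u.
  apply: le_trans (h2 _) _; apply: le_trans (ler_wpM2l (ltW e1) (h1 u)) _.
  by rewrite mulrA divfK ?gt_eqF.
have k2 : hnorm (f t (g s u - g t u)) <= e / 2 * hnorm u.
  apply: le_trans (hC _) _; apply: le_trans (ler_wpM2l (ltW C0) (h3 u)) _.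
  by rewrite mulrA [C * _]mulrC divfK ?gt_eqF.
by lra.
Qed.

Definition rcont D (s : R -> R) := forall t, D t -> forall e : R, 0 < e ->
  exists2 d : R, 0 < d & forall x : R, D x -> `|x - t| < d -> `|s x - s t| <= e.

Lemma ncont_scale D f (s : R -> R) : (forall t, D t -> bounded_op (f t)) ->
  rcont D s -> ncont D f -> ncont D (fun t u => (s t)%:C *: f t u).
Proof.
move=> bf hs hf t Dt e e0.
have [B B0 hB] := ncont_local_bound hf Dt (bf t Dt).
have S0 : 0 < `|s t| + 1 by rewrite ltr_wpDl.
have e1 : 0 < e / 2 / B by rewrite !divr_gt0.
have e2 : 0 < e / 2 / (`|s t| + 1) by rewrite !divr_gt0.
apply: near_mono (near_and hB (near_and (hs t Dt _ e1) (hf t Dt _ e2))).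
move=> x Dx [h1 [h2 h3]] u /=.
have -> : (s x)%:C *: f x u - (s t)%:C *: f t u =
    (s x - s t)%:C *: f x u + (s t)%:C *: (f x u - f t u).
  by vring.
apply: le_trans (ler_hnormD _ _) _; rewrite !hnormZR.
have n0 := hnorm_ge0 u.
have k1 : `|s x - s t| * hnorm (f x u) <= e / 2 * hnorm u.
  apply: le_trans (ler_pM (normr_ge0 _) (hnorm_ge0 _) h2 (h1 u)) _.
  by rewrite mulrA divfK ?gt_eqF.
have k2 : `|s t| * hnorm (f x u - f t u) <= e / 2 * hnorm u.
  have le1 : `|s t| <= `|s t| + 1 by lra.
  apply: le_trans (ler_pM (normr_ge0 _) (hnorm_ge0 _) le1 (h3 u)) _.
  by rewrite mulrA [_ * (e / 2 / _)]mulrC divfK ?gt_eqF.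
by lra.
Qed.

Lemma ncont_const D T : ncont D (fun=> T).
Proof.
move=> t Dt e e0; exists 1 => // s _ _ u.
by rewrite subrr hnorm0 mulr_ge0 ?hnorm_ge0 // ltW.
Qed.

Lemma ncont_adj D f f' : (forall t, D t -> adj (f t) (f' t)) ->
  ncont D f -> ncont D f'.
Proof.
move=> ha hf t Dt e e0; apply: near_mono (hf t Dt e e0) => s Ds h.
apply: (@adj_norm _ _ (f s \- f t) (f' s \- f' t)) (ltW e0) _ => //.
by apply: adj_sub; exact: ha.
Qed.

Lemma Kfield_compact D f t : Kfield D f -> D t -> compact_op (f t).
Proof. by move=> [_ [f' hf]] /hf[]. Qed.

Lemma Kfield_ext D f g : (forall t, D t -> f t = g t) -> Kfield D f -> Kfield D g.
Proof.
move=> fg [nf [f' hf]]; split; last by exists f' => t Dt; rewrite -fg //; exact: hf.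
by apply: ncont_ext nf => t u Dt; rewrite fg.
Qed.

Lemma Kfield_add D f g : Kfield D f -> Kfield D g -> Kfield D (fun t => f t \+ g t).
Proof.
move=> [nf [f' hf]] [ng [g' hg]]; split; first exact: ncont_add.
exists (fun t => f' t \+ g' t) => t Dt; have [? ? ?] := hf t Dt; have [? ? ?] := hg t Dt.
by split; [exact: adj_add|exact: compact_add|exact: compact_add].
Qed.

Lemma Kfield_comp D f g : Kfield D f -> Kfield D g -> Kfield D (fun t => f t \o g t).
Proof.
move=> [nf [f' hf]] [ng [g' hg]].
have bf t : D t -> bounded_op (f t) by move=> /hf[_ /compact_bop].
have bg t : D t -> bounded_op (g t) by move=> /hg[_ /compact_bop].
split; first exact: ncont_comp.
exists (fun t => g' t \o f' t) => t Dt; have [? ? cf'] := hf t Dt; have [? ? ?] := hg t Dt.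
split; [exact: adj_comp | apply: compact_compr => //; exact: bg|].
by apply: compact_compr => //; exact: compact_bop.
Qed.

Lemma Kfield_scale D f (s : R -> R) : rcont D s -> Kfield D f ->
  Kfield D (fun t u => (s t)%:C *: f t u).
Proof.
move=> hs [nf [f' hf]]; split.
  by apply: ncont_scale => // t /hf[_ /compact_bop].
exists (fun t u => (s t)%:C *: f' t u) => t Dt; have [? ? ?] := hf t Dt.
by split; [exact: adj_scale|exact: compact_scale|exact: compact_scale].
Qed.

Lemma Kfield_adj D f f' : (forall t, D t -> adj (f t) (f' t)) -> Kfield D f ->
  Kfield D f'.
Proof.
move=> ha [nf [f'' hf]]; split; first exact: ncont_adj ha nf.
exists f => t Dt; have [h ? ?] := hf t Dt; have h' := ha t Dt.
by split=> //; [exact: adj_sym|rewrite (adj_uniq h' h)].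
Qed.

Lemma Kfield_const D T T' : compact_op T -> compact_op T' -> adj T T' ->
  Kfield D (fun=> T).
Proof. by move=> ? ? ?; split; [exact: ncont_const|exists (fun=> T')]. Qed.

Lemma Kfield_opp D f : Kfield D f -> Kfield D (fun t => \- f t).
Proof.
move=> [nf [f' hf]]; split.
  move=> t Dt e e0; apply: near_mono (nf t Dt e e0) => s Ds h u /=.
  by rewrite -opprD hnormN.
exists (fun t => \- f' t) => t Dt; have [h ? ?] := hf t Dt; split.
- by move=> u v /=; rewrite dotpNl dotpNr h.
- exact: compact_opp.
- exact: compact_opp.
Qed.

(* On the precompact image of the unit ball under [f t], strong convergence of
   projections is uniform. *)
Lemma Kfield_compl D g f : pfield D g -> Kfield D f -> Kfield D (fun t => g t \o f t).
Proof.
move=> [pg sg] [nf [f' hf]]; split; last first.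
  exists (fun t => f' t \o g t) => t Dt; have [h ? ?] := hf t Dt; have hp := pg t Dt.
  split; [exact: adj_comp (proj_adj hp) h | exact: compact_compl (proj_bop hp) _|].
  exact: compact_compr (proj_bop hp).
move=> t Dt e e0; have [_ cf _] := hf t Dt; have bf := compact_bop cf.
have hg := pg t Dt.
have e8 : 0 < e / 8 by rewrite divr_gt0.
have [net hnet] := compact_net cf e8.
have hn c : c \in net -> exists2 d : R, 0 < d &
    forall s, D s -> `|s - t| < d -> hnorm (g s c - g t c) <= e / 8.
  by move=> _; exact: sg.
apply: near_mono (near_and (near_seq hn) (nf t Dt _ e8)) => s Ds [h1 h2] u /=.
have hgs := pg s Ds; have bgs := proj_bop hgs; have bgt := proj_bop hg.
have -> : g s (f s u) - g t (f t u) = g s (f s u - f t u) + (g s (f t u) - g t (f t u)).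
  by rewrite (bopB bgs); vring.
have k1 : hnorm (g s (f s u - f t u)) <= e / 8 * hnorm u.
  exact: le_trans (proj_norm hgs _) (h2 u).
have k2 w : hnorm w <= 1 -> hnorm (g s (f t w) - g t (f t w)) <= e / 2.
  move=> w1; have [c cn hc] := hnet w w1.
  have -> : g s (f t w) - g t (f t w) =
     g s (f t w - c) + (g s c - g t c) - g t (f t w - c).
    by rewrite (bopB bgs) (bopB bgt); vring.
  apply: le_trans (ler_hnormB _ _) _.
  have := ler_hnormD (g s (f t w - c)) (g s c - g t c).
  have := proj_norm hgs (f t w - c); have := proj_norm hg (f t w - c).
  by have := h1 c cn; lra.
have [u0|u0] := pselect (u = 0).
  have z0 : g s (f t u) = g t (f t u) by rewrite u0 (bop0 bf) (bop0 bgs) (bop0 bgt).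
  rewrite z0 subrr addr0; apply: le_trans k1 _.
  by rewrite ler_wpM2r ?hnorm_ge0 //; lra.
have n0 := hnorm_gt0 u0.
have := k2 ((hnorm u)^-1%:C *: u).
rewrite hnormZ_ge0 ?invr_ge0 ?(ltW n0) // mulVf ?gt_eqF // => /(_ (lexx _)).
rewrite (bopZ bf) (bopZ bgs) (bopZ bgt) -scalerBr hnormZ_ge0 ?invr_ge0 ?(ltW n0) //.
rewrite ler_pdivrMl // => k3.
apply: le_trans (ler_hnormD _ _) _.
by have : 0 < e * hnorm u by [rewrite mulr_gt0]; lra.
Qed.

(** Norm continuity passes to adjoints, and the adjoint of [f t \o g t] has the projection on the
    left, where [Kfield_compl] applies. *)
Lemma Kfield_compr D g f : pfield D g -> Kfield D f -> Kfield D (fun t => f t \o g t).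
Proof.
move=> hg hf; have [_ [f' hf']] := hf; have [pg _] := hg.
have hK : Kfield D f' by apply: Kfield_adj hf => t /hf'[].
apply: Kfield_adj (Kfield_compl hg hK) => t Dt; have [h _ _] := hf' t Dt.
exact: adj_comp (proj_adj (pg t Dt)) (adj_sym h).
Qed.

Lemma Kfield_sym D f g : Kfield D (fun t => f t \- g t) -> Kfield D (fun t => g t \- f t).
Proof.
move=> /Kfield_opp; apply: Kfield_ext => t Dt; apply/funext => u /=.
by rewrite opprB.
Qed.

Lemma Kfield_trans D f g h : Kfield D (fun t => f t \- g t) ->
  Kfield D (fun t => g t \- h t) -> Kfield D (fun t => f t \- h t).
Proof.
move=> h1 h2; apply: Kfield_ext (Kfield_add h1 h2) => t Dt; apply/funext => u /=.
by rewrite subrKA.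
Qed.

Lemma pfield_sub D D' f : D' `<=` D -> pfield D f -> pfield D' f.
Proof.
move=> DD [pf sf]; split; first by move=> t /DD/pf.
move=> u t /DD Dt e e0; have [d d0 hd] := sf u t Dt e e0.
by exists d => // s /DD; exact: hd.
Qed.

Lemma scont_Kfield D f g : scont D g -> Kfield D (fun t => f t \- g t) -> scont D f.
Proof.
move=> sg [nf _] u t Dt e e0.
have n0 : 0 < hnorm u + 1 by rewrite ltr_wpDl // hnorm_ge0.
have e1 : 0 < e / 2 / (hnorm u + 1) by rewrite !divr_gt0.
have e2 : 0 < e / 2 by rewrite divr_gt0.
apply: near_mono (near_and (nf t Dt _ e1) (sg u t Dt _ e2)) => s Ds [h1 h2].
have -> : f s u - f t u = (f s u - g s u - (f t u - g t u)) + (g s u - g t u).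
  by vring.
apply: le_trans (ler_hnormD _ _) _; have := h1 u => /= h3.
have : e / 2 / (hnorm u + 1) * hnorm u <= e / 2.
  rewrite mulrAC ler_pdivrMr // ler_wpM2l ?ltW //; lra.
by lra.
Qed.

Lemma pfieldC D f : pfield D f -> pfield D (fun t => idfun \- f t).
Proof.
move=> [pf sf]; split; first by move=> t /pf/projC.
move=> u t Dt e e0; apply: near_mono (sf u t Dt e e0) => s Ds.
have -> : (idfun \- f s) u - (idfun \- f t) u = f t u - f s u by move=> /=; vring.
by rewrite hnormB.
Qed.

(** Semicontinuity applied to the pair and to the exchanged pair gives both inequalities near each
    point, by [ec_sym]. *)
Lemma ec_constant D f g : (forall x y z : R, D x -> D y -> x <= z <= y -> D z) ->
  pfield D f -> pfield D g -> Kfield D (fun t => f t \- g t) ->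
  forall s t, D s -> D t -> ec (f s) (g s) = ec (f t) (g t).
Proof.
move=> convD [pf sf] [pg sg] hK; apply: locally_constant_le => // t Dt.
have half f1 f2 : (forall t, D t -> projection (f1 t)) -> (forall t, D t -> projection (f2 t)) ->
    scont D f2 -> Kfield D (fun t => f1 t \- f2 t) ->
    exists2 d : R, 0 < d & forall s, D s -> `|s - t| < d ->
      ec (f1 s) (f2 s) <= ec (f1 t) (f2 t).
  move=> p1 p2 s2 K12; have [n12 _] := K12.
  have [e e0 [ws hws]] := ec_semicontinuous (p1 t Dt) (p2 t Dt) (Kfield_compact K12 Dt).
  have hn w : w \in ws -> exists2 d : R, 0 < d &
      forall s, D s -> `|s - t| < d -> hnorm (f2 s w - f2 t w) <= e.
    by move=> _; exact: s2.
  apply: near_mono (near_and (near_seq hn) (n12 t Dt e e0)) => s Ds [h1 h2].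
  by apply: hws; [exact: p1|exact: p2|exact: Kfield_compact K12 Ds|exact: h2|exact: h1].
have h1 := half f g pf pg sg hK; have h2 := half g f pg pf sf (Kfield_sym hK).
apply: near_mono (near_and h1 h2) => s Ds [h3 h4].
by apply/eqP; rewrite eq_le h3 /= -lerN2 -!ec_sym.
Qed.

End Fields.

(** * Moving the end value of a field *)

Section RangeProjection.
Context {R : realType} {H : hilbertType R}.
Implicit Types (u v w x y z : H).
Variables (g c y : H -> H) (rho : R).
Hypotheses (pg : projection g) (bc : bounded_op c) (ac : adj c c).
Hypotheses (rho0 : 0 <= rho) (rho1 : rho < 1).
Hypothesis c_le : forall v, hnorm (c v) <= rho * hnorm v.
Hypothesis yE : forall v, y v = g v + g (c (y v)).

Let bg := proj_bop pg.

(** [y] stands for [(1 - g c)^-1 g] but is known only through the equation [yE]. Linearity and the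
    other identities follow from uniqueness of the fixed point of a contraction. *)
Lemma cfix_uniq w x : x = g w + g (c x) -> x = y w.
Proof.
move=> xE; apply/eqP; rewrite -subr_eq0; apply/eqP/hnorm_eq0.
have E : x - y w = g (c (x - y w)).
  by rewrite (bopB bc) (bopB bg) {1}xE {1}yE; vring.
have h1 : hnorm (x - y w) <= rho * hnorm (x - y w).
  by rewrite {1}E; apply: le_trans (proj_norm pg _) _; exact: c_le.
have k : (1 - rho) * hnorm (x - y w) <= 0 by lra.
have p0 : 0 < 1 - rho by rewrite subr_gt0.
by apply/eqP; rewrite eq_le hnorm_ge0 andbT -(pmulr_rle0 _ p0).
Qed.

Lemma cfix_proj v : g (y v) = y v.
Proof. by rewrite yE (bopD bg) !projK. Qed.

Lemma cfix_bop : bounded_op y.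
Proof.
split.
  move=> a u v; apply/esym/cfix_uniq.
  rewrite (bopP bg) (bopP bc) (bopP bg) {1}(yE u) {1}(yE v) scalerDr.
  by rewrite addrACA.
exists ((1 - rho)^-1) => v; rewrite ler_pdivlMl ?subr_gt0 //.
have := ler_hnormD (g v) (g (c (y v))); rewrite -yE.
have := proj_norm pg v; have := proj_norm pg (c (y v)); have := c_le (y v).
by lra.
Qed.

(** The product of [y u] with [v] rewrites as the form of [1 - c] at [y u], [y v], which is
    hermitian because [c] is self-adjoint. *)
Lemma cfix_adj : adj y y.
Proof.
have h u v : dotp (y u) v = dotp (y u) (y v) - dotp (y u) (c (y v)).
  rewrite -{1}(cfix_proj u) (proj_adj pg).
  have -> : g v = y v - g (c (y v)) by rewrite {1}(yE v); vring.
  by rewrite dotpBr -(proj_adj pg) cfix_proj.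
move=> u v; rewrite h [RHS]dotpC (h v u) rmorphB /=; congr (_ - _).
  exact: dotpC.
by rewrite -ac; exact: dotpC.
Qed.

Lemma cfix_idem v : y (y v - c (y v)) = y v.
Proof. by apply/esym/cfix_uniq; rewrite (bopB bg) cfix_proj subrK. Qed.

Variables (z z' : H -> H).
Hypotheses (bz : bounded_op z) (bz' : bounded_op z') (az : adj z z').
Hypothesis zE : forall v, z' (z v) = v - c v.

(** The range projection of [z g] is [z (g z^* z g)^-1 z^*], with the inverse taken on the range of
    [g]. As [z^* z = 1 - c], that inverse, extended by 0, is [y]. *)
Let g' := z \o y \o z'.

Lemma range_proj : projection g'.
Proof.
apply/projP; split.
- by apply: bop_comp => //; apply: bop_comp => //; exact: cfix_bop.
- by move=> v; rewrite /g' /= zE cfix_idem.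
- by apply: adj_comp (adj_sym az); apply: adj_comp az cfix_adj.
Qed.

Lemma range_projP v : g' v = v <-> exists w, v = z (g w).
Proof.
split=> [<-|[w ->]]; first by exists (y (z' v)); rewrite cfix_proj.
rewrite /g' /= zE; congr (z _); apply/esym/cfix_uniq.
by rewrite (bopB bg) projK // subrK.
Qed.
End RangeProjection.

(** * Corrections of a field and turnable pairs of projections *)

Section Correction.
Context {R : realType} {H : hilbertType R}.
Implicit Types (u v w x y z : H) (p q r : H -> H) (f g : R -> H -> H) (D : set R).

(* With [z = 1 + s k] and [z^* = 1 + s k'] this is [1 - z^* z]. *)
Definition defect (k k' : H -> H) (s : R) : H -> H :=
  fun v => (- s)%:C *: (k v + k' v + s%:C *: k' (k v)).

Lemma rcontN D (s : R -> R) : rcont D s -> rcont D (fun t => - s t).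
Proof.
move=> hs t Dt e e0; have [d d0 hd] := hs t Dt e e0; exists d => // x Dx lt.
by rewrite -opprD normrN; exact: hd.
Qed.

Lemma bop_perturb (k : H -> H) (s : R) : bounded_op k ->
  bounded_op (fun v => v + s%:C *: k v).
Proof. by move=> bk; apply: (bop_add (@bop_id _ _)); exact: bop_scale. Qed.

Lemma adj_perturb (k k' : H -> H) (s : R) : adj k k' ->
  adj (fun v => v + s%:C *: k v) (fun v => v + s%:C *: k' v).
Proof. by move=> ak; apply: (adj_add (@adj_id _ _)); exact: adj_scale. Qed.

Lemma defectE (k k' : H -> H) (s : R) v : bounded_op k' ->
  (v + s%:C *: k v) + s%:C *: k' (v + s%:C *: k v) = v - defect k k' s v.
Proof.
move=> bk'; rewrite /defect (bopD bk') (bopZ bk').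
by vring.
Qed.

(* The corrected field is the range projection of [z g]. *)
Lemma correction D g (k k' : H -> H) (rho : R) (s : R -> R) :
  pfield D g -> compact_op k -> compact_op k' -> adj k k' ->
  0 <= rho < 1 -> rcont D s ->
  (forall t, D t -> forall v, hnorm (defect k k' (s t) v) <= rho * hnorm v) ->
  exists g', [/\ pfield D g', Kfield D (fun t => g' t \- g t),
    forall t, D t -> s t = 0 -> g' t = g t &
    forall t, D t -> s t = 1 ->
      forall v, g' t v = v <-> exists w, v = g t w + k (g t w)].
Proof.
move=> hg ck ck' ak /andP[rho0 rho1] hs hrho; have [pg sg] := hg.
have bk := compact_bop ck; have bk' := compact_bop ck'.
pose c t := defect k k' (s t).
have Kk : Kfield D (fun=> k) := Kfield_const D ck ck' ak.
have Kk' : Kfield D (fun=> k') := Kfield_const D ck' ck (adj_sym ak).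
have Kc : Kfield D c.
  apply: Kfield_scale; first exact: rcontN.
  apply: Kfield_add; first exact: Kfield_add.
  exact: (Kfield_scale hs (Kfield_comp Kk' Kk)).
have bc t : D t -> bounded_op (c t) by move=> /(Kfield_compact Kc)/compact_bop.
have ac t : adj (c t) (c t).
  move=> u v; rewrite /c /defect dotpZl dotpZr; congr (_ * _).
    by rewrite /= oppr0.
  rewrite !dotpDl !dotpDr dotpZl dotpZr ak (adj_sym ak) (adj_sym ak) ak.
  by rewrite [dotp u (k v) + _]addrC /= oppr0.
have ex t v : exists x, D t -> x = g t v + g t (c t x).
  have [Dt|] := pselect (D t); last by exists 0.
  have [|//||//|x x' _ _|x _ xE] := @hnorm_fixed_point _ _ setT (fun x => g t v + g t (c t x)) rho.
  - by rewrite rho0.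
  - by exists 0.
  - have -> : g t v + g t (c t x) - (g t v + g t (c t x')) = g t (c t (x - x')).
      by rewrite (bopB (bc t Dt)) (bopB (proj_bop (pg t Dt))); vring.
    by apply: le_trans (proj_norm (pg t Dt) _) _; exact: hrho.
  - by exists x.
have [y yE] := choice (fun tv : R * H => ex tv.1 tv.2).
pose Y t v := y (t, v).
have YE t v : D t -> Y t v = g t v + g t (c t (Y t v)) by move=> Dt; exact: (yE (t, v)).
have bY t : D t -> bounded_op (Y t).
  by move=> Dt; apply: (cfix_bop (pg t Dt) (bc t Dt) rho1 (hrho t Dt)) => // v; exact: YE.
have aY t : D t -> adj (Y t) (Y t).
  by move=> Dt; apply: (cfix_adj (pg t Dt) (ac t)) => // v; exact: YE.
pose W t := Y t \- g t.
have WE t v : D t -> W t v = g t (c t (Y t v)).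
  by move=> Dt; rewrite /W /= {1}(YE t v Dt); vring.
have Kgc : Kfield D (fun t => g t \o c t) := Kfield_compl hg Kc.
have Kgcg : Kfield D (fun t => (g t \o c t) \o g t) := Kfield_compr hg Kgc.
have aW t : D t -> adj (W t) (W t).
  by move=> Dt; apply: adj_sub; [exact: aY|exact: proj_adj (pg t Dt)].
have cW t : D t -> compact_op (W t).
  move=> Dt; have -> : W t = (g t \o c t) \o Y t by apply/funext => v; exact: WE.
  by apply: compact_compr (bY t Dt); exact: Kfield_compact Kgc Dt.
have KW : Kfield D W.
  split; last by exists W => t Dt; split; [exact: aW|exact: cW|exact: cW].
  move=> t Dt e e0.
  have [C C0 hC] := bop_bound (compact_bop (cW t Dt)).
  have e1 : 0 < e * (1 - rho) / 2 by rewrite divr_gt0 // mulr_gt0 //; lra.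
  have e2 : 0 < e * (1 - rho) / 2 / C by rewrite divr_gt0.
  apply: near_mono (near_and (Kgcg.1 t Dt _ e1) (Kgc.1 t Dt _ e2)) => a Da [h1 h2] v.
  have W2 b u : D b -> W b u = g b (c b (g b u)) + g b (c b (W b u)).
    move=> Db; rewrite {1}WE // -(bopD (proj_bop (pg b Db))) -(bopD (bc b Db)).
    by rewrite /W /= addrC subrK.
  have k1 := h1 v; have k2 := h2 (W t v); have k3 := hC v; rewrite /= in k1 k2.
  (* The last summand is at most [rho] times the left side and is absorbed by it; the factor
     [1 - rho] in [e1] and [e2] pays for this. *)
  have E : W a v - W t v = (g a (c a (g a v)) - g t (c t (g t v))) +
      (g a (c a (W t v)) - g t (c t (W t v))) + g a (c a (W a v - W t v)).
    move: (W2 a v Da) (W2 t v Dt); move: (W a v) (W t v) => x x' E2 E3.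
    rewrite (bopB (bc a Da)) (bopB (proj_bop (pg a Da))).
    by rewrite {1}E2 {1}E3; vring.
  have k4 : hnorm (g a (c a (W a v - W t v))) <= rho * hnorm (W a v - W t v).
    by apply: le_trans (proj_norm (pg a Da) _) _; exact: hrho.
  have k5 : hnorm (g a (c a (W t v)) - g t (c t (W t v))) <=
      e * (1 - rho) / 2 * hnorm v.
    apply: le_trans k2 _; apply: le_trans (ler_wpM2l (ltW e2) k3) _.
    by rewrite mulrA divfK ?gt_eqF.
  have := ler_hnormD (g a (c a (g a v)) - g t (c t (g t v)) +
      (g a (c a (W t v)) - g t (c t (W t v)))) (g a (c a (W a v - W t v))).
  rewrite -E.
  have := ler_hnormD (g a (c a (g a v)) - g t (c t (g t v)))
      (g a (c a (W t v)) - g t (c t (W t v))).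
  move=> k6 k7; have p0 : 0 < 1 - rho by rewrite subr_gt0.
  by rewrite -(ler_pM2l p0); lra.
pose Z t v : H := v + (s t)%:C *: k v.
pose Z' t v : H := v + (s t)%:C *: k' v.
have bZ t : bounded_op (Z t) by exact: bop_perturb.
have bZ' t : bounded_op (Z' t) by exact: bop_perturb.
have aZ t : adj (Z t) (Z' t) by exact: adj_perturb.
have ZE t v : Z' t (Z t v) = v - c t v by rewrite /Z /Z' defectE.
pose g' t := Z t \o Y t \o Z' t.
have pg' t : D t -> projection (g' t).
  move=> Dt; apply: (range_proj (pg t Dt) (bc t Dt) (ac t) rho1 (hrho t Dt)) => //.
  by move=> v; exact: YE.
have rg' t v : D t -> g' t v = v <-> exists w, v = Z t (g t w).
  move=> Dt.
  apply: (range_projP (pg t Dt) (bc t Dt) rho1 (hrho t Dt)) => //.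
  by move=> u; exact: YE.
have KsY f : Kfield D f -> Kfield D (fun t => (fun v => (s t)%:C *: f t v)).
  exact: Kfield_scale.
have KY f : Kfield D f -> Kfield D (fun t => Y t \o f t).
  move=> Kf; apply: Kfield_ext (Kfield_add (Kfield_compl hg Kf) (Kfield_comp KW Kf)).
  by move=> t Dt; apply/funext => v; rewrite /W /=; vring.
have KY' f : Kfield D f -> Kfield D (fun t => f t \o Y t).
  move=> Kf; apply: Kfield_ext (Kfield_add (Kfield_compr hg Kf) (Kfield_comp Kf KW)).
  move=> t Dt; apply/funext => v; rewrite /W /= (bopB (compact_bop (Kfield_compact Kf Dt))).
  by vring.
have Kg' : Kfield D (fun t => g' t \- g t).
  (* [g' - g] expands as [W + s k Y + s Y k' + s^2 k Y k'], each term having a compact norm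
     continuous factor. *)
  have K1 := KsY _ (KY' _ Kk).
  have K2 := KsY _ (KY _ Kk').
  have K3 := KsY _ (Kfield_comp Kk K2).
  apply: Kfield_ext (Kfield_add (Kfield_add KW K1) (Kfield_add K2 K3)) => t Dt.
  apply/funext => v; rewrite /g' /Z /Z' /W /=.
  by rewrite (bopD (bY t Dt)) (bopZ (bY t Dt)) (bopD bk) (bopZ bk); vring.
exists g'; split=> //.
- by split=> //; exact: scont_Kfield sg Kg'.
- move=> t Dt s0; apply/funext => v.
  rewrite /g' /Z /Z' /= s0 !scale0r !addr0 YE // /c /defect s0 oppr0 scale0r.
  by rewrite (bop0 (proj_bop (pg t Dt))) addr0.
- move=> t Dt s1 v; rewrite rg' //; split=> -[w ->]; exists w;
  by rewrite /Z s1 scale1r.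
Qed.

(** Quantifying over all fields with value [p] at [b], rather than fixing one, makes the relation
    transitive and lets a constant field serve as a path from [p] to [q]. *)
Definition turnable p q := forall D g (a b : R), pfield D g -> D b -> g b = p -> a < b ->
  exists g', [/\ pfield D g', Kfield D (fun t => g' t \- g t),
    forall t, D t -> t <= a -> g' t = g t & g' b = q].

Definition ramp (a b t : R) := Num.max 0 (Num.min 1 ((t - a) / (b - a))).

Lemma ramp01 a b t : 0 <= ramp a b t <= 1.
Proof. by rewrite /ramp le_max lexx ge_max ler01 /= ge_min lexx. Qed.

Lemma ramp_left a b t : a < b -> t <= a -> ramp a b t = 0.
Proof.
move=> ab ta; rewrite /ramp max_l // ge_min; apply/orP; right.
by rewrite pmulr_lle0 ?invr_gt0; lra.
Qed.

Lemma ramp_right a b t : a < b -> b <= t -> ramp a b t = 1.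
Proof.
move=> ab bt; rewrite /ramp (min_l (y := _ / _)) ?max_r //.
by rewrite ler_pdivlMr ?mul1r; lra.
Qed.

Lemma clip_lipschitz (x y : R) :
  `|Num.max 0 (Num.min 1 x) - Num.max 0 (Num.min 1 y)| <= `|x - y|.
Proof.
wlog xy : x y / y <= x.
  move=> W; have [/W//|/ltW/W] := leP y x.
  by rewrite distrC [leRHS]distrC.
rewrite (ger0_norm (_ : 0 <= x - y)) ?subr_ge0 //.
rewrite ler_norml; apply/andP.
rewrite /Num.max /Num.min.
by do 4! [case: ifPn => /=]; rewrite -?leNgt; lra.
Qed.

Lemma rcont_ramp D a b : a < b -> rcont D (ramp a b).
Proof.
move=> ab t Dt e e0; have ba : 0 < b - a by rewrite subr_gt0.
exists (e * (b - a)); first by rewrite mulr_gt0.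
move=> x Dx lt; apply: le_trans (clip_lipschitz _ _) _.
rewrite -mulrBl opprB addrA subrK normrM normfV (gtr0_norm ba).
by rewrite ler_pdivrMr // ltW.
Qed.

Lemma proj_ext p q : projection p -> projection q ->
  (forall v, p v = v <-> q v = v) -> p = q.
Proof.
move=> hp hq h; apply/funext => v; apply: dotp_ext => w.
have qp u : q (p u) = p u by apply/h; rewrite projK.
have pq u : p (q u) = q u by apply/h; rewrite projK.
have E : dotp (p v) w = dotp (p v) (q w) by rewrite -(proj_adj hq) qp.
by rewrite E (proj_adj hp) pq -(proj_adj hq).
Qed.

Lemma turnable_step p q (k k' : H -> H) (rho : R) : projection q ->
  compact_op k -> compact_op k' -> adj k k' -> 0 <= rho < 1 ->
  (forall s : R, 0 <= s <= 1 -> forall v, hnorm (defect k k' s v) <= rho * hnorm v) ->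
  (forall v, q v = v <-> exists w, v = p w + k (p w)) -> turnable p q.
Proof.
move=> hq ck ck' ak hrho hd hran D g a b hg Db gb ab.
have [|g' [hg' Kg' g'0 g'1]] :=
  correction hg ck ck' ak hrho (rcont_ramp (D := D) ab).
  by move=> t Dt; apply: hd; exact: ramp01.
exists g'; split=> //; first by move=> t Dt ta; apply: g'0 => //; exact: ramp_left.
have [pg' _] := hg'; apply: proj_ext => //; first exact: pg'.
by move=> v; rewrite g'1 ?(ramp_right ab (lexx b)) // gb hran.
Qed.


Lemma turnable_trans p q r : turnable p q -> turnable q r -> turnable p r.
Proof.
move=> pq qr D g a b hg Db gb ab.
have [g1 [hg1 K1 e1 b1]] := pq D g a b hg Db gb ab.
have [g2 [hg2 K2 e2 b2]] := qr D g1 a b hg1 Db b1 ab.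
exists g2; split=> //; first exact: Kfield_trans K2 K1.
by move=> t Dt ta; rewrite e2 // e1.
Qed.

(** Turning the constant field [p] over [[0, 1]] gives a path to [q], along which [ec] against the
    constant [r] does not change. *)
Lemma turnable_ec p q r : projection p -> projection r -> compact_op (p \- r) ->
  turnable p q -> ec p r = ec q r.
Proof.
move=> hp hr cpr pq.
have pconst (s : H -> H) : projection s -> pfield [set: R] (fun=> s).
  move=> hs; split=> // u t _ e e0; exists 1 => // x _ _.
  by rewrite subrr hnorm0 ltW.
have [g [hg Kg e1 g1]] := pq setT (fun=> p) 0 1 (pconst p hp) Logic.I erefl ltr01.
have Kgr : Kfield [set: R] (fun t => g t \- r).
  apply: Kfield_trans Kg _; apply: (Kfield_const _ cpr cpr).
  by apply: adj_sub; exact: proj_adj.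
rewrite -g1 -[in LHS](e1 0 Logic.I (lexx _)).
by apply: (ec_constant (D := setT) _ hg (pconst r hr) Kgr).
Qed.

End Correction.

(** * Additivity of the essential codimension *)

Section EssentialCodimension.
Context {R : realType} {H : hilbertType R}.
Implicit Types (u v w x y z e f : H) (p q r : H -> H).

Ltac cvring := apply: dotp_ext => ?;
  rewrite ?(dotpDl, dotpNl, dotpZl, dotp0l); ring.

Lemma compact_diffC p q : compact_op (p \- q) -> compact_op (q \- p).
Proof.
move=> h; have := compact_opp h; congr compact_op; apply/funext => w /=.
by rewrite opprB.
Qed.

Lemma compact_diff_trans p q r : compact_op (p \- q) -> compact_op (q \- r) ->
  compact_op (p \- r).
Proof.
move=> h1 h2; have := compact_add h1 h2; congr compact_op; apply/funext => w /=.
by rewrite subrKA.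
Qed.

Lemma proj_zero : projection (fun _ => 0 : H).
Proof.
apply/projP; split=> //; first by case: (@compact_zero R H).
by move=> u v; rewrite dotp0l dotp0r.
Qed.

Lemma proj_add_rank1 p f : projection p -> hnorm f = 1 -> p f = 0 ->
  projection (p \+ rank1 f f).
Proof.
move=> hp f1 pf; have bp := proj_bop hp; apply/projP; split.
- exact: bop_add bp (bop_rank1 f f).
- move=> u; rewrite /= /rank1 (bopD bp) (bopZ bp) pf projK // dotpDl dotpZl dotpE f1.
  by rewrite (proj_adj hp) pf dotp0r expr1n mulr1 scaler0 addr0 add0r.
- exact: adj_add (proj_adj hp) (adj_rank1 f f).
Qed.

Lemma ec_add_rank1 p r f : projection p -> projection r -> hnorm f = 1 -> p f = 0 ->
  compact_op (p \- r) -> ec (p \+ rank1 f f) r = ec p r + 1.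
Proof.
move=> hp hr f1 pf ca; have hp' := proj_add_rank1 hp f1 pf.
have E : (p \+ rank1 f f) \- rank1 f f = p.
  by apply/funext => v; rewrite /= addrK.
rewrite -{2}E; apply: ec_sub_rank1 => //.
  by rewrite /= pf /rank1 dotpE f1 expr1n scale1r add0r.
apply: compact_diff_trans ca.
have -> : (p \+ rank1 f f) \- p = rank1 f f.
  by apply/funext => v; rewrite /= addrC addKr.
exact: compact_rank1.
Qed.

Lemma ec_self p : projection p -> ec p p = 0.
Proof. by move=> hp; rewrite /ec subrr. Qed.

(** If [v] is fixed by the square of [a], then [v + a v] is in [E1 p q] and [v - a v] in [E1 q p];
    both vanish, hence [v = 0] and [compact_gap] applies to the square. *)
Lemma sqr_diff_contraction p q : projection p -> projection q -> compact_op (p \- q) ->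
  (forall v, E1 p q v -> v = 0) -> (forall v, E1 q p v -> v = 0) ->
  exists2 rho : R, 0 <= rho < 1 &
    forall v, hnorm ((p \- q) ((p \- q) v)) <= rho * hnorm v.
Proof.
move=> hp hq ca E10 E20; set a := p \- q in ca *.
have ba : bounded_op a := compact_bop ca.
have [//|//|v _ aav|d d0 hd] := @compact_gap _ _ (a \o a) setT
  (compact_compr ca ba).
  have h1 : v + a v = 0.
    by apply/E10/(diff_fix hp hq); rewrite -/a (bopD ba) [a (a v)]aav addrC.
  have h2 : v - a v = 0.
    apply/E20/(diff_fix hq hp).
    have aN u : (q \- p) u = - a u by rewrite /a /= opprB.
    by rewrite aN (bopB ba) [a (a v)]aav opprB.
  have : v + v = 0.
    move: (a v) h1 h2 => x h1 h2; transitivity ((v + x) + (v - x)); first by vring.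
    by rewrite h1 h2 addr0.
  move=> vv; apply: rip_ext => w; have := congr1 (fun u => rip u w) vv.
  by rewrite /= ripDl rip0l; lra.
(* Capping at 1 keeps [rho = 1 - d1^2 / 2] nonnegative; the half makes [1 - d1^2 <= rho^2]. *)
pose d1 := Num.min 1 d.
have d10 : 0 < d1 by rewrite lt_min ltr01.
have d1d : d1 <= d by rewrite ge_min lexx orbT.
have d11 : d1 <= 1 by rewrite ge_min lexx.
exists (1 - d1 ^+ 2 / 2); first by apply/andP; split; nra.
move=> v; have h1 := norm_diff_le hp hq (a v); rewrite -/a in h1.
have h2 := hd v Logic.I.
have h3 : d1 * hnorm v <= hnorm (a (a v) - v).
  by apply: le_trans h2; rewrite ler_wpM2r ?hnorm_ge0.
have s0 : 0 <= d1 * hnorm v by rewrite mulr_ge0 ?hnorm_ge0 // ltW.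
have h4 : (d1 * hnorm v) ^+ 2 <= hnorm (a (a v) - v) ^+ 2.
  by rewrite ler_sqr ?nnegrE ?hnorm_ge0.
move: h4; rewrite hnormB2 exprMn (rip_diff_sym hp hq (a v) v) -/a ripuu => h4.
have h5 : hnorm (a (a v)) ^+ 2 <= hnorm (a v) ^+ 2 by rewrite hnorm_sqr_le.
have rho0 : 0 <= 1 - d1 ^+ 2 / 2 by nra.
rewrite -(ler_sqr (x := hnorm _)) ?nnegrE ?mulr_ge0 ?hnorm_ge0 // exprMn.
have := sqr_ge0 (hnorm v); have := sqr_ge0 (d1 ^+ 2) => h6 h7.
have : hnorm (a (a v)) ^+ 2 <= (1 - d1 ^+ 2) * hnorm v ^+ 2 by lra.
move=> /le_trans; apply; rewrite ler_wpM2r //; nra.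
Qed.

(* [1 + k = q p + (1 - q) (1 - p)] intertwines [p] and [q]. *)
Lemma turnable_close p q : projection p -> projection q -> compact_op (p \- q) ->
  (forall v, E1 p q v -> v = 0) -> (forall v, E1 q p v -> v = 0) -> turnable p q.
Proof.
move=> hp hq ca E10 E20.
have bp := proj_bop hp; have bq := proj_bop hq.
have [rho hrho ha] := sqr_diff_contraction hp hq ca E10 E20.
pose k v : H := 2%:C *: q (p v) - p v - q v.
pose k' v : H := 2%:C *: p (q v) - p v - q v.
have ck : compact_op k.
  have := compact_sub ca (compact_scale 2%:C (compact_compr ca bp)).
  by congr compact_op; apply/funext => v; rewrite /k /= projK //; vring.
have ck' : compact_op k'.
  have := compact_sub ca (compact_scale 2%:C (compact_compl bp ca)).
  by congr compact_op; apply/funext => v; rewrite /k' /= (bopB bp) projK //; vring.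
have ak : adj k k'.
  move=> u v; rewrite /k /k' !dotpBl !dotpBr dotpZl dotpZr !(proj_adj hp, proj_adj hq).
  by rewrite /= oppr0.
apply: (turnable_step hq ck ck' ak hrho) => [s /andP[s0 s1] v|v].
  (* That is, [z^* z = 1 - (2 s - s^2) (p - q)^2], and on [[0, 1]] the coefficient stays between 0
     and 1. *)
  have -> : defect k k' s v = (2 * s - s ^+ 2)%:C *: (p \- q) ((p \- q) v).
    rewrite /defect /k /k' /=.
    rewrite ?(bopD bp, bopD bq, bopN bp, bopN bq, bopZ bp, bopZ bq, projK hp, projK hq).
    by vring.
  rewrite hnormZ_ge0; last by nra.
  by apply: le_trans (ha v); rewrite ler_piMl ?hnorm_ge0 //; nra.
have E w : p w + k (p w) = q (p w) by rewrite /k projK //; vring.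
split=> [qv|[w ->]]; last by rewrite E projK.
have [e Ee|u [pu qu]] := @pair_closed_range _ _ p q v hp hq (compact_diffC ca) qv.
  by rewrite (E20 e Ee) dotp0r.
by exists u; rewrite E pu qu.
Qed.

(* The quarter turn of the plane spanned by [e] and [f]. *)
Lemma turnable_swap p e f : projection p -> hnorm e = 1 -> hnorm f = 1 ->
  p e = e -> p f = 0 -> turnable p ((p \- rank1 e e) \+ rank1 f f).
Proof.
move=> hp e1 f1 pe pf; have bp := proj_bop hp.
have ee : dotp e e = 1 by rewrite dotpE e1 expr1n.
have ff : dotp f f = 1 by rewrite dotpE f1 expr1n.
have ef : dotp e f = 0 by rewrite -pe (proj_adj hp) pf dotp0r.
have fe : dotp f e = 0 by rewrite dotpC ef conjc0.
have hp1 := proj_sub_rank1 hp e1 pe.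
have p1f : (p \- rank1 e e) f = 0 by rewrite /= pf /rank1 fe scale0r subr0.
have hq := proj_add_rank1 hp1 f1 p1f.
pose k := (rank1 f e \- rank1 e f) \- (rank1 e e \+ rank1 f f).
pose k' := (rank1 e f \- rank1 f e) \- (rank1 e e \+ rank1 f f).
have cP : compact_op (rank1 e e \+ rank1 f f).
  by apply: compact_add; exact: compact_rank1.
have ck : compact_op k.
  by apply: compact_sub cP; apply: compact_sub; exact: compact_rank1.
have ck' : compact_op k'.
  by apply: compact_sub cP; apply: compact_sub; exact: compact_rank1.
have ak : adj k k'.
  by apply: adj_sub; [apply: adj_sub|apply: adj_add]; exact: adj_rank1.
have hP : projection (rank1 e e \+ rank1 f f).
  have h0 := proj_add_rank1 proj_zero e1 erefl.
  have -> : rank1 e e = (fun=> 0) \+ rank1 e e by apply/funext => v; rewrite /= add0r.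
  apply: proj_add_rank1 => //.
  by rewrite /= /rank1 fe scale0r addr0.
apply: (turnable_step (rho := 1/2) hq ck ck' ak) => [|s /andP[s0 s1] v|v].
- by apply/andP; split; lra.
(* On the plane [z] is [1 - s] plus [s] times a quarter turn, so [z^* z = (1 - s)^2 + s^2] there;
   [2 s (1 - s) <= 1 / 2] explains the choice of [rho]. *)
- have -> : defect k k' s v = (2 * s * (1 - s))%:C *: (rank1 e e \+ rank1 f f) v.
    have -> : (2 * s * (1 - s))%:C = 2 * s%:C * (1 - s%:C) :> R[i].
      by rewrite !rmorphM rmorphB /= rmorphD.
    rewrite /defect rmorphN /k /k' /rank1 /=.
    rewrite ?(dotpDl, dotpNl, dotpZl, ee, ff, ef, fe).
    by cvring.
  rewrite hnormZ_ge0; last by nra.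
  have s2 : 0 <= s * (1 - s) by rewrite mulr_ge0 //; lra.
  have s3 := sqr_ge0 (s - 1 / 2).
  apply: ler_pM; rewrite ?hnorm_ge0 //; [by lra|by lra|].
  exact: proj_norm hP v.
split=> [qv|[w ->]].
  (* The preimage under the turn: the component of [v] along [f] is moved back to [e]. *)
  exists (v - rank1 f f v + rank1 e f v); rewrite -[LHS]qv /k /rank1 /=.
  rewrite ?(bopD bp, bopN bp, bopZ bp, pe, pf).
  have := congr1 (fun u => dotp u e) qv.
  rewrite /= /rank1 ?(dotpDl, dotpNl, dotpZl, ee, ff, ef, fe) (proj_adj hp) pe => h.
  rewrite ?(dotpDl, dotpNl, dotpZl, ee, ff, ef, fe) ?(proj_adj hp) ?pe ?pf ?dotp0r.
  have ve : dotp v e = 0 by rewrite -h; ring.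
  by rewrite ve; cvring.
rewrite /k /rank1 /=.
rewrite ?(dotpDl, dotpNl, dotpZl, ee, ff, ef, fe) ?(proj_adj hp) ?pe ?pf ?dotp0r.
rewrite ?(bopD bp, bopN bp, bopZ bp, pe, pf, projK hp).
rewrite ?(dotpDl, dotpNl, dotpZl, ee, ff, ef, fe) ?(proj_adj hp) ?pe ?pf ?dotp0r.
by cvring.
Qed.

Lemma odim0 (A : set H) v : odim A 0 -> A v -> v = 0.
Proof. by move=> [[|? ?] [_ h] //] _ Av; apply: h. Qed.

Lemma dimo_gt0 (A : set H) n : subsp A -> odim A n.+1 -> exists2 e, hnorm e = 1 & A e.
Proof.
move=> sA [[|e s] [[os As] _] //] _; have [e1 _ _] := os.
by exists e => //; apply: As; exact: mem_head.
Qed.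

Lemma turnable_ec0 p q : projection p -> projection q -> compact_op (p \- q) ->
  ec p q = 0 -> turnable p q.
Proof.
have [n] := ubnP (dimo (E1 p q)); elim: n p => // n IH p le hp hq ca ec0.
have caN := compact_diffC ca.
have hA := E1_odim hp hq ca; have hB := E1_odim hq hp caN.
have AB : dimo (E1 p q) = dimo (E1 q p).
  by move: ec0; rewrite /ec; lia.
rewrite -AB in hB; have sA := subsp_E1 hp hq; have sB := subsp_E1 hq hp.
move: le hA hB; case N: (dimo (E1 p q)) => [|m] le hA hB.
  by apply: turnable_close => // v; exact: odim0.
have [e e1 Ae] := dimo_gt0 sA hA; have [f f1 Bf] := dimo_gt0 sB hB.
have [pe qe] := Ae; have [qf pf] := Bf.
have fe : dotp f e = 0 by rewrite -pe -(proj_adj hp) pf dotp0l.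
apply: turnable_trans (turnable_swap hp e1 f1 pe pf) _.
have hp1 := proj_sub_rank1 hp e1 pe.
have p1f : (p \- rank1 e e) f = 0 by rewrite /= pf /rank1 fe scale0r subr0.
have ca1 : compact_op ((p \- rank1 e e) \- q).
  have := compact_sub ca (compact_rank1 e e); congr compact_op.
  by apply/funext => v /=; rewrite addrAC.
have hp2 := proj_add_rank1 hp1 f1 p1f.
have ca2 : compact_op (((p \- rank1 e e) \+ rank1 f f) \- q).
  have := compact_add ca1 (compact_rank1 f f); congr compact_op.
  by apply/funext => v /=; rewrite addrAC.
apply: IH => //; last first.
  by rewrite ec_add_rank1 // -ec_sub_rank1.
have ee : dotp e e <> 0 by rewrite dotpE e1 expr1n; apply/eqP; rewrite oner_eq0.
have [_ hC] := odim_cut1 sA hA Ae ee.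
have sC : subsp (E1 p q `&` ortho [:: e]) by exact: subspI (subsp_ortho _).
(* The swap lowers the dimension: a vector killed by [q] is orthogonal to [f = q f], so being fixed
   by the swapped projection makes it a vector of [E1 p q] orthogonal to [e]. *)
have [|k hk km] := odim_sub (subsp_E1 hp2 hq) sC _ hC.
  move=> w [p2w qw].
  have wf : dotp w f = 0 by rewrite -qf -(proj_adj hq) qw dotp0l.
  move: p2w; rewrite /= /rank1 wf scale0r addr0 => p1w.
  have pw : p w = w.
    by rewrite -{1}p1w (bopB (proj_bop hp)) (bopZ (proj_bop hp)) pe projK.
  split=> // x; rewrite inE => /eqP->.
  move: p1w; rewrite pw => /eqP; rewrite subr_eq addrC -subr_eq subrr eq_sym.
  rewrite scaler_eq0 => /orP[/eqP//|/eqP e0].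
  by rewrite e0 dotp0r.
by rewrite (dimoE (subsp_E1 hp2 hq) hk); move: le km => /=; lia.
Qed.

(** Removing from [p] or adding to it a rank one projection shifts [ec p q] and [ec p r] alike, so
    one may assume [ec p q = 0]. Then [p] turns into [q], which leaves the value against [r]
    unchanged. *)
Lemma ec_additive p q r : projection p -> projection q -> projection r ->
  compact_op (p \- q) -> compact_op (q \- r) -> ec p q + ec q r = ec p r.
Proof.
have [n] := ubnP `|ec p q|%N; elim: n p => // n IH p le hp hq hr cpq cqr.
have cpr := compact_diff_trans cpq cqr.
have [ec0|ecn0] := eqVneq (ec p q) 0.
  by rewrite ec0 add0r (turnable_ec hp hr cpr (turnable_ec0 hp hq cpq ec0)).
have sA := subsp_E1 hp hq; have sB := subsp_E1 hq hp.
have hA := E1_odim hp hq cpq; have hB := E1_odim hq hp (compact_diffC cpq).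
case A0: (dimo (E1 p q)) hA => [|m] hA; last first.
  case: (ltrP 0 (ec p q)) => [ecp|ecn].
    have [e e1 [pe qe]] := dimo_gt0 sA hA.
    have hp1 := proj_sub_rank1 hp e1 pe.
    have c1 s : compact_op (p \- s) -> compact_op ((p \- rank1 e e) \- s).
      move=> cps; have := compact_sub cps (compact_rank1 e e); congr compact_op.
      by apply/funext => v /=; rewrite addrAC.
    have h1 := ec_sub_rank1 hp hq e1 pe cpq; have h2 := ec_sub_rank1 hp hr e1 pe cpr.
    have := IH (p \- rank1 e e) _ hp1 hq hr (c1 _ cpq) cqr.
    rewrite h1 h2; move: le ecp; rewrite h1 => le ecp <-; last by lia.
    by ring.
  case B0: (dimo (E1 q p)) hB => [|m'] hB.
    by move: ecn ecn0; rewrite /ec A0 B0; lia.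
  have [f f1 [qf pf]] := dimo_gt0 sB hB.
  have hp1 := proj_add_rank1 hp f1 pf.
  have c1 s : compact_op (p \- s) -> compact_op ((p \+ rank1 f f) \- s).
    move=> cps; have := compact_add cps (compact_rank1 f f); congr compact_op.
    by apply/funext => v /=; rewrite addrAC.
  have h1 := ec_add_rank1 hp hq f1 pf cpq; have h2 := ec_add_rank1 hp hr f1 pf cpr.
  have := IH (p \+ rank1 f f) _ hp1 hq hr (c1 _ cpq) cqr.
  rewrite h1 h2 => h; apply: (addIr 1); rewrite -h; first by ring.
  by move: le ecn ecn0; lia.
have B0 : dimo (E1 q p) != 0%N by move: ecn0; rewrite /ec A0; lia.
case B1: (dimo (E1 q p)) B0 hB => [//|m'] _ hB.
have [f f1 [qf pf]] := dimo_gt0 sB hB.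
have hp1 := proj_add_rank1 hp f1 pf.
have c1 s : compact_op (p \- s) -> compact_op ((p \+ rank1 f f) \- s).
  move=> cps; have := compact_add cps (compact_rank1 f f); congr compact_op.
  by apply/funext => v /=; rewrite addrAC.
have h1 := ec_add_rank1 hp hq f1 pf cpq; have h2 := ec_add_rank1 hp hr f1 pf cpr.
have := IH (p \+ rank1 f f) _ hp1 hq hr (c1 _ cpq) cqr.
rewrite h1 h2 => h; apply: (addIr 1); rewrite -h; first by ring.
by move: le; rewrite /ec A0 B1; lia.
Qed.
End EssentialCodimension.

(** * Continuous sections *)

Section Sections.
Context {R : realType} {H : hilbertType R}.
Implicit Types (u v w : H) (f g h : R -> H -> H) (D : set R) (xi : R -> H).

Definition vcont D xi := forall t, D t -> forall e : R, 0 < e -> exists2 d : R, 0 < d &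
  forall s, D s -> `|s - t| < d -> hnorm (xi s - xi t) <= e.

Definition seg (a b : R) : set R := [set t | a <= t <= b].

Lemma near_glue D (c t : R) (P : R -> Prop) :
  (t <= c -> exists2 d : R, 0 < d &
     forall s, D s -> s <= c -> `|s - t| < d -> P s) ->
  (c <= t -> exists2 d : R, 0 < d &
     forall s, D s -> c <= s -> `|s - t| < d -> P s) ->
  exists2 d : R, 0 < d & forall s, D s -> `|s - t| < d -> P s.
Proof.
move=> h1 h2; case: (ltrgtP t c) => tc.
- have [|d d0 hd] := h1; first exact: ltW.
  exists (Num.min d (c - t)); first by rewrite lt_min d0 subr_gt0.
  move=> s Ds; rewrite lt_min => /andP[l1 l2]; apply: hd => //.
  by move: l2; rewrite ltr_norml; lra.
- have [|d d0 hd] := h2; first exact: ltW.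
  exists (Num.min d (t - c)); first by rewrite lt_min d0 subr_gt0.
  move=> s Ds; rewrite lt_min => /andP[l1 l2]; apply: hd => //.
  by move: l2; rewrite ltr_norml; lra.
- have [|d d0 hd] := h1; first by rewrite tc.
  have [|d' d0' hd'] := h2; first by rewrite tc.
  exists (Num.min d d'); first by rewrite lt_min d0.
  move=> s Ds; rewrite lt_min => /andP[l1 l2].
  by have [sc|/ltW cs] := leP s c; [exact: hd|exact: hd'].
Qed.

Lemma vcont_glue (a c b : R) xi eta : a <= c <= b -> xi c = eta c ->
  vcont (seg a c) xi -> vcont (seg c b) eta ->
  vcont (seg a b) (fun t => if t <= c then xi t else eta t).
Proof.
move=> /andP[ac cb] E h1 h2 t /andP[at_ tb] e e0.
have K s : c <= s -> (if s <= c then xi s else eta s) = eta s.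
  move=> cs; case: ifPn => // sc; have -> : s = c by apply/eqP; rewrite eq_le sc.
  exact: E.
apply: (@near_glue _ c) => tc.
- have [|d d0 hd] := h1 t _ e e0; first by rewrite /seg /= at_.
  exists d => // s /andP[as_ _] sc lt; rewrite sc tc; apply: hd => //.
  by rewrite /seg /= as_.
- have [|d d0 hd] := h2 t _ e e0; first by rewrite /seg /= tc.
  exists d => // s /andP[_ sb] cs lt; rewrite !K //; apply: hd => //.
  by rewrite /seg /= cs.
Qed.

Lemma vcont_field D h xi : pfield D h -> vcont D xi -> vcont D (fun t => h t (xi t)).
Proof.
move=> [ph sh] hx t Dt e e0; have e2 : 0 < e / 2 by rewrite divr_gt0.
apply: near_mono (near_and (hx t Dt _ e2) (sh (xi t) t Dt _ e2)) => s Ds [h1 h2].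
have -> : h s (xi s) - h t (xi t) = h s (xi s - xi t) + (h s (xi t) - h t (xi t)).
  by rewrite (bopB (proj_bop (ph s Ds))); vring.
apply: le_trans (ler_hnormD _ _) _; have := proj_norm (ph s Ds) (xi s - xi t).
by lra.
Qed.

Lemma vcont_line D (s : R -> R) w v : rcont D s ->
  vcont D (fun t => w + (s t)%:C *: (v - w)).
Proof.
move=> hs t Dt e e0; have n0 : 0 < hnorm (v - w) + 1 by rewrite ltr_wpDl // hnorm_ge0.
apply: near_mono (hs t Dt _ (divr_gt0 e0 n0)) => x Dx.
rewrite ler_pdivlMr // => h.
have -> : w + (s x)%:C *: (v - w) - (w + (s t)%:C *: (v - w)) = (s x - s t)%:C *: (v - w).
  by vring.
rewrite hnormZR; apply: le_trans h; rewrite ler_wpM2l //; lra.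
Qed.

Lemma vcontN D xi : vcont D xi -> vcont D (fun t => - xi t).
Proof.
move=> hx t Dt e e0; apply: near_mono (hx t Dt e e0) => s Ds.
by rewrite -opprD hnormN.
Qed.

(** With a nonnegative mixed term the squared norm is at least [((1 - s)^2 + s^2) m^2], hence at
    least [m^2 / 2]. *)
Lemma segment_norm_lb (w v : H) (s m : R) : 0 <= rip w v -> 0 <= s <= 1 -> 0 < m ->
  m <= hnorm w -> m <= hnorm v -> m / 2 <= hnorm (w + s%:C *: (v - w)).
Proof.
move=> wv /andP[s0 s1] m0 mw mv.
rewrite -ler_sqr ?nnegrE ?hnorm_ge0 ?divr_ge0 ?(ltW m0) //.
have -> : w + s%:C *: (v - w) = (1 - s)%:C *: w + s%:C *: v by vring.
rewrite hnormD2 !ripE !hnormZ_ge0 //; last lra.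
have : m ^+ 2 <= hnorm w ^+ 2 by rewrite ler_sqr ?nnegrE ?hnorm_ge0 // ltW.
have : m ^+ 2 <= hnorm v ^+ 2 by rewrite ler_sqr ?nnegrE ?hnorm_ge0 // ltW.
move: (hnorm w) (hnorm v) (rip w v) wv {mw mv} => W V r r0 h1 h2.
have k0 : 0 <= 2 * ((1 - s) * (s * r)) by rewrite !mulr_ge0 //; lra.
have k1 : s ^+ 2 * m ^+ 2 <= s ^+ 2 * V ^+ 2 by rewrite ler_wpM2l ?sqr_ge0.
have k2 : (1 - s) ^+ 2 * m ^+ 2 <= (1 - s) ^+ 2 * W ^+ 2 by rewrite ler_wpM2l ?sqr_ge0.
have k3 : 0 <= (s - 1 / 2) ^+ 2 * m ^+ 2 by rewrite mulr_ge0 ?sqr_ge0.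
have k4 : 0 <= m ^+ 2 by rewrite sqr_ge0.
have -> : (m / 2) ^+ 2 = m ^+ 2 / 4 by field.

by rewrite !(exprMn _ (1 - s)) !(exprMn _ s); lra.
Qed.

(* Extending a section beyond [c']: on a short interval the value [w] at [c'] is
   moved to the local section [h t v]; the segment from [w] to [h c' v] avoids 0
   after a change of sign. *)
Lemma section_exists (a b : R) h : a <= b -> pfield (seg a b) h ->
  (forall t, seg a b t -> exists2 v, h t v = v & v <> 0) ->
  exists2 xi, vcont (seg a b) xi &
    forall t, seg a b t -> h t (xi t) = xi t /\ xi t <> 0.
Proof.
move=> ab hh nz; have [ph sh] := hh.
pose P c := exists2 xi, vcont (seg a c) xi &
    forall t, seg a c t -> h t (xi t) = xi t /\ xi t <> 0.
apply: (@real_induction _ a b P) => //.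
  have [|v hv v0] := nz a; first by rewrite /seg /= lexx.
  exists (fun=> v).
    by move=> t _ e e0; exists 1 => // s _ _; rewrite subrr hnorm0 ltW.
  by move=> t /andP[h1 h2]; have -> : t = a by apply/eqP; rewrite eq_le h1 h2.
move=> c acb; have [v hv v0] := nz c acb; have n0 := hnorm_gt0 v0.
have [d d0 hd] := sh v c acb (hnorm v / 2) ltac:(rewrite divr_gt0 //).
exists d => // c' e /andP[ac' c'c] lt /andP[c'e eb] ltd [xi0 cxi0 hxi0].
have {}hd s : seg a b s -> `|s - c| < d -> h s v <> 0.
  move=> Ds ls E; have := hd s Ds ls; rewrite E hv sub0r hnormN; lra.
have Dc' : seg a b c' by rewrite /seg /= ac' /=; move/andP: acb => [_]; lra.
have u0 : h c' v <> 0 by apply: hd => //; rewrite ltr_norml; lra.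
have Sc' : seg a c' c' by rewrite /seg /= ac' lexx.
have [xi [cxi hxi pos]] : exists xi, [/\ vcont (seg a c') xi,
    forall t, seg a c' t -> h t (xi t) = xi t /\ xi t <> 0 & 0 <= rip (xi c') (h c' v)].
  have [le|/ltW le] := leP 0 (rip (xi0 c') (h c' v)); first by exists xi0.
  exists (fun t => - xi0 t); split; [exact: vcontN| |by rewrite ripNl oppr_ge0].
  move=> t Dt; have [E N] := hxi0 t Dt.
  have Dt' : seg a b t by move: Dt => /andP[? ?]; rewrite /seg /=; lra.
  rewrite (bopN (proj_bop (ph t Dt'))) E; split=> // /eqP; rewrite oppr_eq0 => /eqP.
  exact: N.
set w := xi c' in pos *; have [hw w0] := hxi c' Sc'; rewrite -/w in hw w0.
pose m := Num.min (hnorm w) (hnorm (h c' v)).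
have m0 : 0 < m by rewrite lt_min !hnorm_gt0.
have mw : m <= hnorm w by rewrite ge_min lexx.
have mv : m <= hnorm (h c' v) by rewrite ge_min lexx orbT.
(* Passing from the vectors at [c'] to those at [t] costs at most twice [m / 8], less than the bound
   [m / 2] of [segment_norm_lb]. *)
have m8 : 0 < m / 8 by rewrite divr_gt0.
have [d' d0' hd'] := near_and (sh w c' Dc' _ m8) (sh v c' Dc' _ m8).
(* The ramp is complete while the estimates on [d'] still hold; beyond it [eta t] is [h t v], which
   is nonzero by the choice of [d]. *)
pose s t := ramp c' (c' + d' / 2) t.
have c'd : c' < c' + d' / 2 by lra.
pose eta t := h t (w + (s t)%:C *: (v - w)).
exists (fun t => if t <= c' then xi t else eta t).
  apply: vcont_glue => //; first by rewrite ac'.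
    by rewrite /eta /s (ramp_left c'd (lexx c')) scale0r addr0 hw.
  apply: vcont_field; last by apply: vcont_line; exact: rcont_ramp.
  by apply: pfield_sub hh => t /andP[? ?]; rewrite /seg /=; lra.
move=> t /andP[at_ te]; case: ifPn => [tc|]; first by apply: hxi; rewrite /seg /= at_.
rewrite -ltNge => c't; have Dt : seg a b t by rewrite /seg /=; lra.
split; first by rewrite /eta projK //; exact: ph.
have [tl|tl] := leP (c' + d' / 2) t.
  rewrite /eta /s (ramp_right c'd tl) scale1r addrC subrK; apply: hd => //.
  by rewrite ltr_norml; lra.
have [|h1 h2] := hd' t Dt; first by rewrite ltr_norml; lra.
have s01 := ramp01 c' (c' + d' / 2) t; rewrite -/(s t) in s01.
have := segment_norm_lb pos s01 m0 mw mv.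
have bt := proj_bop (ph t Dt).
have -> : w + (s t)%:C *: (h c' v - w) = eta t - ((1 - s t)%:C *: (h t w - h c' w) +
    (s t)%:C *: (h t v - h c' v)).
  rewrite /eta (bopD bt) (bopZ bt) (bopB bt) hw; vring.
move=> + e0; rewrite e0 sub0r hnormN => /le_trans/(_ (ler_hnormD _ _)).
move/andP: s01 => [s0 s1]; rewrite !hnormZ_ge0 //; last lra.
have k1 : (1 - s t) * hnorm (h t w - h c' w) <= m / 8.
  by apply: le_trans h1; rewrite ler_piMl ?hnorm_ge0 //; lra.
have k2 : s t * hnorm (h t v - h c' v) <= m / 8.
  by apply: le_trans h2; rewrite ler_piMl ?hnorm_ge0.
by lra.
Qed.

Lemma unit_section_exists (a b : R) h : a <= b -> pfield (seg a b) h ->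
  (forall t, seg a b t -> exists2 v, h t v = v & v <> 0) ->
  exists2 xi, vcont (seg a b) xi &
    forall t, seg a b t -> h t (xi t) = xi t /\ hnorm (xi t) = 1.
Proof.
move=> ab hh nz; have [xi cxi hxi] := section_exists ab hh nz; have [ph sh] := hh.
exists (fun t => (hnorm (xi t))^-1%:C *: xi t); last first.
  move=> t Dt; have [E /hnorm_gt0 N] := hxi t Dt.
  rewrite (bopZ (proj_bop (ph t Dt))) E; split=> //.
  by rewrite hnormZ_ge0 ?invr_ge0 ?(ltW N) // mulVf // gt_eqF.
move=> t Dt e e0; have [_ /hnorm_gt0 N] := hxi t Dt.
have e1 : 0 < e * hnorm (xi t) / 2 by rewrite divr_gt0 // mulr_gt0.
apply: near_mono (cxi t Dt _ e1) => s Ds hle; have [_ /hnorm_gt0 N'] := hxi s Ds.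
move: (xi s) (xi t) N N' hle => x y y0 x0 hle.
have -> : (hnorm x)^-1%:C *: x - (hnorm y)^-1%:C *: y =
    (hnorm y)^-1%:C *: (x - y) + ((hnorm x)^-1 - (hnorm y)^-1)%:C *: x by vring.
apply: le_trans (ler_hnormD _ _) _.
rewrite hnormZ_ge0 ?invr_ge0 ?(ltW y0) // hnormZR.
have -> : `|(hnorm x)^-1 - (hnorm y)^-1| * hnorm x = (hnorm y)^-1 * `|hnorm y - hnorm x|.
  have -> : (hnorm x)^-1 - (hnorm y)^-1 = (hnorm y - hnorm x) / (hnorm x * hnorm y).
    by field; rewrite !gt_eqF.
  rewrite normrM normfV (gtr0_norm (mulr_gt0 x0 y0)).
  by field; rewrite !gt_eqF.
have k : `|hnorm y - hnorm x| <= hnorm (x - y).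
  rewrite ler_norml; have := ler_hnormD (x - y) y; have := ler_hnormD (y - x) x.
  by rewrite !subrK (hnormB y); lra.
rewrite -mulrDr ler_pdivrMl //; lra.
Qed.

Lemma Kfield_rank1 D xi : vcont D xi -> (forall t, D t -> hnorm (xi t) = 1) ->
  Kfield D (fun t => rank1 (xi t) (xi t)).
Proof.
move=> cx x1; split; last first.
  by exists (fun t => rank1 (xi t) (xi t)) => t Dt; split;
    [exact: adj_rank1|exact: compact_rank1|exact: compact_rank1].
move=> t Dt e e0; have e2 : 0 < e / 2 by rewrite divr_gt0.
apply: near_mono (cx t Dt _ e2) => s Ds hle u.
have -> : rank1 (xi s) (xi s) u - rank1 (xi t) (xi t) u =
    dotp u (xi s) *: (xi s - xi t) + dotp u (xi s - xi t) *: xi t.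
  by rewrite /rank1 dotpBr scalerBl scalerBr addrA subrK.
apply: le_trans (ler_hnormD _ _) _; rewrite !hnormZ.
have k1 := dotp_norm_le u (xi s); have k2 := dotp_norm_le u (xi s - xi t).
rewrite x1 // mulr1 in k1; rewrite x1 // mulr1.
have n0 := hnorm_ge0 u; have m0 := hnorm_ge0 (xi s - xi t).
have k3 : hnorm u * hnorm (xi s - xi t) <= hnorm u * (e / 2) by rewrite ler_wpM2l.
have k4 : complex.Re `|dotp u (xi s)| * hnorm (xi s - xi t) <=
    hnorm u * hnorm (xi s - xi t) by rewrite ler_wpM2r.
by lra.
Qed.

Lemma pfield_grow (a b : R) (n : nat) f : a <= b -> pfield (seg a b) f ->
  (forall t, seg a b t -> exists2 s, ons_in [set v | f t v = 0] s & size s = n) ->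
  exists g, [/\ pfield (seg a b) g, Kfield (seg a b) (fun t => g t \- f t) &
    forall t, seg a b t -> ec (g t) (f t) = n%:Z].
Proof.
move=> ab; elim: n f => [|n IH] f hf hn; have [pf sf] := hf.
  exists f; split=> //; last by move=> t Dt; exact: ec_self (pf t Dt).
  have : Kfield (seg a b) (fun=> (fun _ => 0 : H)).
    by apply: (@Kfield_const _ _ _ _ (fun=> 0)); try exact: compact_zero;
      move=> u v; rewrite dotp0l dotp0r.
  by apply: Kfield_ext => t Dt; apply/funext => v; rewrite /= subrr.
have [|xi cxi hxi] := unit_section_exists ab (pfieldC hf).
  move=> t Dt; have [[//|v s] [os hs] _] := hn t Dt.
  exists v; first by rewrite /= (hs v (mem_head _ _)) subr0.
  by move=> v0; have := ons_norm os (mem_head _ _); rewrite v0 hnorm0 => /eqP;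
    rewrite eq_sym oner_eq0.
have fxi t : seg a b t -> f t (xi t) = 0.
  move=> Dt; have [/= E _] := hxi t Dt.
  by move/eqP: E; rewrite subr_eq addrC -subr_eq subrr eq_sym => /eqP.
have x1 t : seg a b t -> hnorm (xi t) = 1 by move=> /hxi[].
pose f1 t := f t \+ rank1 (xi t) (xi t).
have K1 : Kfield (seg a b) (fun t => f1 t \- f t).
  apply: Kfield_ext (Kfield_rank1 cxi x1) => t Dt; apply/funext => v.
  by rewrite /f1 /= addrC addKr.
have pf1 t : seg a b t -> projection (f1 t).
  by move=> Dt; apply: proj_add_rank1; [exact: pf|exact: x1|exact: fxi].
have hf1 : pfield (seg a b) f1 by split=> //; exact: scont_Kfield sf K1.
have [|g [hg Kg eg]] := IH f1 hf1.
  (* Orthogonality to the new vector [xi t] costs at most one of the [n.+1] vectors available. *)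
  move=> t Dt; have [s [os hs] ss] := hn t Dt.
  have [s' os' ss'] :=
    ons_cut [:: xi t] (subsp_ker (proj_bop (pf t Dt))) (ons_free os) hs.
  exists s'; last by rewrite ss' ss /=; lia.
  apply: ons_inS os' => v [/= fv ov].
  by rewrite /f1 /= fv /rank1 ov ?mem_head // scale0r addr0.
exists g; split=> //; first exact: Kfield_trans Kg K1.
move=> t Dt; have [pg _] := hg.
rewrite -(ec_additive (pg t Dt) (pf1 t Dt) (pf t Dt)); first last.
- exact: Kfield_compact K1 Dt.
- exact: Kfield_compact Kg Dt.
rewrite eg // ec_add_rank1 ?ec_self ?x1 ?fxi //; [lia|exact: pf|exact: pf|exact: pf|].
by have := @compact_zero R H; congr compact_op; apply/funext => v; rewrite /= subrr.
Qed.

Lemma ec_compl (p q : H -> H) : ec (idfun \- p) (idfun \- q) = - ec p q.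
Proof.
have E (p1 q1 : H -> H) : E1 (idfun \- p1) (idfun \- q1) = E1 q1 p1.
  apply/seteqP; split=> v [/= h1 h2]; split.
  - by apply/esym/eqP; rewrite -subr_eq0 h2.
  - by move/eqP: h1; rewrite subr_eq addrC -subr_eq subrr eq_sym => /eqP.
  - by rewrite /= h2 subr0.
  - by rewrite /= h1 subrr.
by rewrite /ec !E opprB.
Qed.

Lemma pfield_shift (a b : R) (l : int) f : a <= b -> pfield (seg a b) f ->
  (forall t, seg a b t -> l < 0 ->
     exists2 s, ons_in [set v | f t v = v] s & size s = `|l|%N) ->
  (forall t, seg a b t -> 0 <= l ->
     exists2 s, ons_in [set v | f t v = 0] s & size s = `|l|%N) ->
  exists g, [/\ pfield (seg a b) g, Kfield (seg a b) (fun t => g t \- f t) &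
    forall t, seg a b t -> ec (g t) (f t) = l].
Proof.
move=> ab hf hneg hpos; have [l0|l0] := leP 0 l.
  have [|g [hg Kg eg]] := @pfield_grow a b `|l|%N f ab hf.
    by move=> t Dt; exact: hpos.
  by exists g; split=> // t Dt; rewrite eg // gez0_abs.
have [|g [hg Kg eg]] := @pfield_grow a b `|l|%N (fun t => idfun \- f t) ab (pfieldC hf).
  move=> t Dt; have [s os ss] := hneg t Dt l0; exists s => //.
  by apply: ons_inS os => v /= ->; rewrite subrr.
exists (fun t => idfun \- g t); split; first exact: pfieldC.
  apply: Kfield_ext (Kfield_opp Kg) => t Dt; apply/funext => v /=.
  by vring.
move=> t Dt; have -> : f t = idfun \- (idfun \- f t).
  by apply/funext => v /=; rewrite opprB addrC subrK.
by rewrite ec_compl eg // ltz0_abs // opprK.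
Qed.

End Sections.

(** * The Fredholm index *)

Section OrthonormalSequences.
Context {R : realType} {H : hilbertType R}.
Implicit Types (u v w x y : H) (p q : H -> H) (s t : seq H) (e g : nat -> H).

Lemma dotp_eq_rip u v u' v' : rip u v = rip u' v' ->
  rip ('i *: u) v = rip ('i *: u') v' -> dotp u v = dotp u' v'.
Proof.
rewrite /rip !dotpZl; case: (dotp u v) => a b; case: (dotp u' v') => c d /=.
by rewrite !mul0r !mul1r !sub0r => -> /oppr_inj ->.
Qed.

Lemma isometry_dotp (V : H -> H) : isometry_op V -> forall u v, dotp (V u) (V v) = dotp u v.
Proof.
move=> [bV nV]; have h u v : rip (V u) (V v) = rip u v.
  by have := hnormD2 (V u) (V v); rewrite -(bopD bV) !nV hnormD2; lra.
by move=> u v; apply: dotp_eq_rip; rewrite -?(bopZ bV) h.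
Qed.

Definition onseq e := forall i j, dotp (e i) (e j) = (i == j)%:R.

Definition psum (c : nat -> R[i]) e n : H := \sum_(i < n) c i *: e i.

Definition csq (c : nat -> R[i]) n : R := \sum_(i < n) (complex.Re `|c i|) ^+ 2.

Lemma psumS (c : nat -> R[i]) e n : psum c e n.+1 = psum c e n + c n *: e n.
Proof. by rewrite /psum big_ord_recr. Qed.

Lemma csqS (c : nat -> R[i]) n : csq c n.+1 = csq c n + (complex.Re `|c n|) ^+ 2.
Proof. by rewrite /csq big_ord_recr. Qed.

Lemma Re_norm_eq0 (a : R[i]) : complex.Re `|a| = 0 -> a = 0.
Proof.
move=> a0; apply: normr0_eq0; have : 0 <= `|a| by [].
by move: a0; case: `|a| => x y /= ->; rewrite lecE /= => /andP[/eqP->].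
Qed.

Lemma onseq_norm e i : onseq e -> hnorm (e i) = 1.
Proof.
move=> he; have := ripuu (e i); rewrite /rip he eqxx /= => h.
by apply/eqP; rewrite -(@eqrXn2 _ 2) ?hnorm_ge0 // expr1n -h.
Qed.

Lemma psum_dotp (c : nat -> R[i]) e n j : onseq e ->
  dotp (psum c e n) (e j) = if (j < n)%N then c j else 0.
Proof.
move=> he; rewrite /psum dotp_suml.
under eq_bigr => i _ do rewrite dotpZl he.
case: ltnP => jn; last first.
  rewrite big1 // => i _; rewrite (_ : (val i == j) = false) ?mulr0 //.
  by apply/negbTE; rewrite neq_ltn (leq_trans (ltn_ord i) jn).
rewrite (bigD1 (Ordinal jn)) //= eqxx mulr1 big1 ?addr0 // => i /negbTE.
by rewrite -val_eqE /= => ->; rewrite mulr0.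
Qed.

Lemma psum_dist (c : nat -> R[i]) e n m : onseq e -> (n <= m)%N ->
  hnorm (psum c e m - psum c e n) ^+ 2 = csq c m - csq c n.
Proof.
move=> he; elim: m => [|m IH]; first by rewrite leqn0 => /eqP->; rewrite !subrr hnorm0 expr0n.
rewrite leq_eqVlt => /orP[/eqP->|]; first by rewrite !subrr hnorm0 expr0n.
rewrite ltnS => nm; rewrite psumS csqS addrAC.
rewrite hnormD2 IH //.
have -> : rip (psum c e m - psum c e n) (c m *: e m) = 0.
  apply: rip_eq0; rewrite dotpZr dotpBl !psum_dotp // ltnn.
  by rewrite ltnNge nm subrr mulr0.
by rewrite hnormZ onseq_norm // mulr1; ring.
Qed.

Lemma bessel g u n : onseq g -> csq (fun i => dotp u (g i)) n <= hnorm u ^+ 2.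
Proof.
move=> hg; set c := fun i => dotp u (g i).
have h0 := psum_dist c hg (leq0n n); rewrite /psum /csq !big_ord0 !subr0 in h0.
have h1 : rip u (psum c g n) = csq c n.
  rewrite /psum /csq; elim: n {h0} => [|n IH]; first by rewrite !big_ord0 rip0r.
  rewrite !big_ord_recr /= ripDr IH; congr (_ + _).
  rewrite /rip dotpZr -/(c n); case: (c n) => x y /=.
  by rewrite sqr_sqrtr ?addr_ge0 ?sqr_ge0 //; ring.
have := sqr_ge0 (hnorm (u - psum c g n)); rewrite hnormB2 h1 {1}/psum h0 -/(csq c n).
by lra.
Qed.

(* Riesz-Fischer: the coefficients of [u] along [g] are the coefficients along [e]
   of a vector of norm at most that of [u]. *)
Lemma coordinate_transfer q e g u : projection q -> (forall n, q (e n) = e n) ->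
  onseq e -> onseq g ->
  exists w, [/\ q w = w, forall n, dotp w (e n) = dotp u (g n) & hnorm w <= hnorm u].
Proof.
move=> hq qe he hg; pose c i := dotp u (g i).
have csq_mono n m : (n <= m)%N -> csq c n <= csq c m.
  by move=> nm; rewrite -subr_ge0 -(psum_dist c he nm) sqr_ge0.
have bc n : csq c n <= hnorm u ^+ 2 by exact: bessel.
pose A := [set csq c n | n in [set: nat]].
have hA : has_sup A.
  by split; [exists (csq c 0), 0%N | exists (hnorm u ^+ 2) => _ [n _ <-]].
have [eps eps0|w hw] := @hnorm_complete _ _ (psum c e).
  have e2 : 0 < (eps / 2) ^+ 2 by rewrite exprn_gt0 // divr_gt0.
  have [_ [N _ <-] hN] := sup_adherent e2 hA; exists N.
  have dN m : (N <= m)%N -> hnorm (psum c e m - psum c e N) < eps / 2.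
    move=> Nm; rewrite -ltr_sqr ?nnegrE ?hnorm_ge0 ?divr_ge0 ?(ltW eps0) //.
    rewrite psum_dist //; have : csq c m <= sup A.
      by apply: sup_upper_bound => //; exists m.
    by lra.
  move=> m n Nm Nn; apply: le_lt_trans (ler_hdist _ (psum c e N) _) _.
  by rewrite (hnormB (psum c e N)); have := dN m Nm; have := dN n Nn; lra.
have lim0 (x : R) : 0 <= x -> (forall d : R, 0 < d -> x <= d) -> x = 0.
  by move=> x0 h; apply/eqP; rewrite eq_le x0 andbT; apply/ler_addgt0Pr => d d0;
    rewrite add0r; exact: h.
have qpsum n : q (psum c e n) = psum c e n.
  rewrite /psum (bop_sum (proj_bop hq)); apply: eq_bigr => i _.
  by rewrite (bopZ (proj_bop hq)) qe.
exists w; split.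
- apply: (proj_closed_ran hq) => d /hw[N hN]; exists (psum c e N); first exact: qpsum.
  exact: hN.
- move=> n; apply/eqP; rewrite -subr_eq0; apply/eqP/Re_norm_eq0.
  apply: lim0; first by have : 0 <= `|dotp w (e n) - dotp u (g n)| by []; rewrite lecE => /andP[].
  move=> d /hw[N hN]; pose m := maxn N n.+1.
  have -> : dotp w (e n) - dotp u (g n) = dotp (w - psum c e m) (e n).
    by rewrite dotpBl psum_dotp // (leq_maxr N n.+1).
  apply: le_trans (dotp_norm_le _ _) _; rewrite onseq_norm // mulr1 hnormB.
  by apply/ltW/hN; rewrite leq_maxl.
- apply/ler_addgt0Pr => d /hw[N hN].
  have := ler_hnormD (psum c e N) (w - psum c e N); rewrite addrC subrK => h.
  have := hN N (leqnn N); rewrite hnormB => h'.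
  have : hnorm (psum c e N) <= hnorm u; last by lra.
  have := psum_dist c he (leq0n N); rewrite /psum /csq !big_ord0 !subr0 => h2.
  by rewrite -hnorm_sqr_le h2; exact: bc.
Qed.

Definition total_in q e := forall v, q v = v -> (forall n, dotp v (e n) = 0) -> v = 0.

Lemma onb_exists q : separable_hilbert H -> projection q ->
  ~ (exists n, odim [set v | q v = v] n) ->
  exists e, [/\ forall n, q (e n) = e n, onseq e & total_in q e].
Proof.
move=> [D [/countable_injP[f finj] dD]] hq inf; have bq := proj_bop hq.
set A := [set v | q v = v] in inf; have sA : subsp A := subsp_fix bq.
pose d n : H := q (xget 0 [set x | D x /\ f x = n]).
have Ad n : A (d n) by exact: projK.
have stepP s n : exists x, ons_in A s ->
    ons_in A (x :: s) /\ forall v, ortho (x :: s) v -> dotp v (d n) = 0.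
  have [os|] := pselect (ons_in A s); last by exists 0.
  pose r := d n - proj_on s (d n).
  have Ar : A r by apply: subspB => //; apply: proj_on_in => //; case: os.
  have sub v x : ortho (x :: s) v -> dotp v (proj_on s (d n)) = 0.
    move=> ov; rewrite /proj_on dotp_sumr big_seq_cond big1 // => y.
    by rewrite andbT => ys; rewrite dotpZr ov ?mulr0 // inE ys orbT.
  (* If [d n] lies in the span already built, any new unit vector of [A] is taken, so that the
     sequence never stops. *)
  have [r0|/hnorm_gt0 r0] := pselect (r = 0).
    have dE : d n = proj_on s (d n) by apply/eqP; rewrite -subr_eq0; apply/eqP.
    have [t [ot At] st] := infinite_ons sA inf (size s).+1.
    have [|v [Av v0 ov]] := free_ortho (ws := s) sA (ons_free ot) At; first by rewrite st.
    have [x ox] := ons_in_cons sA os Av v0 ov.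
    by exists x => _; split=> // w ow; rewrite dE; exact: (sub w x).
  exists ((hnorm r)^-1%:C *: r) => _; split.
    split; first split.
    - by rewrite hnormZ_ge0 ?invr_ge0 ?(ltW r0) // mulVf // gt_eqF.
    - by move=> y ys; rewrite dotpZl proj_on_ortho ?mulr0 //; case: os.
    - by case: os.
    - move=> y; rewrite inE => /orP[/eqP->|ys]; first exact: subspZ.
      by case: os => _; apply.
  move=> v ov; have -> : d n = r + proj_on s (d n) by rewrite subrK.
  rewrite dotpDr (sub v _ ov) addr0.
  have := ov _ (mem_head _ _); rewrite dotpZr => /eqP.
  rewrite mulf_eq0 => /orP[|/eqP//].
  rewrite conjc_eq0 -(rmorph0 (real_complex R)) (inj_eq (@complexI _)) invr_eq0.
  by rewrite gt_eqF.
have [next nextP] := choice (fun sn : seq H * nat => stepP sn.1 sn.2).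
pose S := fix S n := if n is m.+1 then next (S m, m) :: S m else [::].
pose e n := next (S n, n).
have oS n : ons_in A (S n).
  by elim: n => [//|n IH]; have [] := nextP (S n, n) IH.
have eS i n : (i < n)%N -> e i \in S n.
  elim: n => // n IH; rewrite ltnS leq_eqVlt => /orP[/eqP->|/IH h] /=.
    exact: mem_head.
  by rewrite inE h orbT.
exists e; split.
- by move=> n; have [_ h] := oS n.+1; exact: (h _ (eS n n.+1 (ltnSn n))).
- move=> i j; wlog ij : i j / (i <= j)%N.
    move=> W; have [/W//|/ltnW ji] := leqP i j.
    by rewrite dotpC (W _ _ ji) eq_sym conjc_nat.
  move: ij; rewrite leq_eqVlt => /orP[/eqP->|ij].
    rewrite eqxx dotpE (_ : hnorm _ = 1) ?expr1n //.
    by have [[h _ _] _] := oS j.+1.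
  rewrite (ltn_eqF ij) dotpC; have [[_ h _] _] := oS j.+1.
  by rewrite [dotp (e j) _]h ?conjc0 //; exact: eS.
- move=> v qv hv.
  have vd n : dotp v (d n) = 0.
    have [_ h] := nextP (S n, n) (oS n); apply: (h v) => y yS.
    have : y \in S n.+1 by [].
    elim: n.+1 => //= m IH; rewrite inE => /orP[/eqP->|/IH//]; exact: hv.
  (* Some [x] in [D] is closer to [v] than [|v|]; since [v] is orthogonal to [x],
     [|v|^2 = rip v (v - x) < |v|^2]. *)
  apply: contrapT => /hnorm_gt0 v0.
  have [|x [/= vx Dx]] := dD [set x | hnorm (x - v) < hnorm v]° _ (@open_interior _ _).
    exists v; rewrite /interior; exact: nbhs_hball.
  have {}vx := interior_subset vx; rewrite /= in vx.
  have dx : d (f x) = q x.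
    rewrite /d; congr (q _); case: xgetP => [y -> [Dy fy]|/(_ x)]; last by case.
    by apply: finj => //; exact: mem_set.
  have : dotp v x = 0 by rewrite -qv (proj_adj hq) -dx.
  move=> /rip_eq0 r0; have : rip v (v - x) = hnorm v ^+ 2 by rewrite ripBr r0 subr0 ripuu.
  have := rip_ler v (v - x); rewrite (hnormB v) => + h2.
  by rewrite h2 expr2 ler_pM2l // leNgt vx.
Qed.

(** [V] sends an orthonormal basis [g] of [H] to a basis [e] of the range of [q], and [W] reads the
    coordinates along [e] back along [g]. Totality of the bases makes both linear and [W] the
    adjoint of [V]. *)
Lemma range_isometry_exists q : separable_hilbert H -> infinite_dimensional H ->
  projection q -> ~ (exists n, odim [set v | q v = v] n) ->
  exists V, isometry_op V /\ V \o adjoint V = q.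
Proof.
move=> Hsep Hinf hq infq; have bq := proj_bop hq.
have hid : projection (idfun : H -> H) by apply/projP; split=> //; exact: bop_id.
have [e [qe he te]] := onb_exists Hsep hq infq.
have [|g [_ hg tg]] := onb_exists Hsep hid.
  move=> [n [s [[os _] hs] ss]]; apply: Hinf; exists n.
  exists (fun i : 'I_n => s`_i); split=> [//|v _|c c0].
    exists (fun i : 'I_n => dotp v s`_i); rewrite -ss.
    apply/hs => // y ys.
    have := proj_on_ortho v os ys.
    by rewrite /proj_on (big_nth 0) big_mkord.
  move=> i; have := @ons_free _ _ s os (fun k => if insub k is Some j then c j else 0).
  rewrite ss => /(_ _ i (ltn_ord i)); rewrite valK; apply.
  by rewrite -[RHS]c0; apply: eq_bigr => j _; rewrite valK.
have exV u := coordinate_transfer u hq qe he hg.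
have exW u := coordinate_transfer u hid (fun=> erefl) hg he.
have [V hV] := choice exV; have [W hW] := choice exW.
have Vu u v : q v = v -> (forall n, dotp v (e n) = dotp u (g n)) -> v = V u.
  move=> qv hv; have [qVu hVu _] := hV u.
  apply/eqP; rewrite -subr_eq0; apply/eqP/te; first by rewrite (bopB bq) qv qVu.
  by move=> n; rewrite dotpBl hv hVu subrr.
have Wu u v : (forall n, dotp v (g n) = dotp u (e n)) -> v = W u.
  move=> hv; have [_ hWu _] := hW u.
  apply/eqP; rewrite -subr_eq0; apply/eqP/tg => // n.
  by rewrite dotpBl hv hWu subrr.
have bV : bounded_op V.
  split; last by exists 1 => u; rewrite mul1r; have [] := hV u.
  move=> a u v; have [q1 h1 _] := hV u; have [q2 h2 _] := hV v.
  apply/esym/Vu; first by rewrite (bopP bq) q1 q2.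
  by move=> n; rewrite !dotpDl !dotpZl h1 h2.
have bW : bounded_op W.
  split; last by exists 1 => u; rewrite mul1r; have [] := hW u.
  move=> a u v; have [q1 h1 _] := hW u; have [q2 h2 _] := hW v.
  by apply/esym/Wu => n; rewrite !dotpDl !dotpZl h1 h2.
have WV u : W (V u) = u by apply/esym/Wu => n; have [_ ->] := hV u.
have VW u : V (W u) = q u.
  apply/esym/Vu; first exact: projK.
  by move=> n; have [_ -> _] := hW u; rewrite (proj_adj hq) qe.
have iV : isometry_op V.
  split=> // u; apply/eqP; rewrite eq_le; have [_ _ ->] := hV u.
  by rewrite -{1}(WV u); have [_ _ ->] := hW (V u).
have aV : adj V W.
  move=> u w; have [qVu _ _] := hV u.
  by rewrite -qVu (proj_adj hq) -VW (isometry_dotp iV).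
exists V; split=> //; rewrite (adjointE bW aV).
by apply/funext => u /=.
Qed.
End OrthonormalSequences.

(** * The essential codimension as a difference of ranks or a Fredholm index *)

Section Index.
Context {R : realType} {H : hilbertType R}.
Implicit Types (u v w x y : H) (p q : H -> H) (s t : seq H) (A B : set H).

Lemma has_qdim_uniq A B n m : subsp A -> has_qdim A B n -> has_qdim A B m -> n = m.
Proof.
move=> sA.
suff le n1 m1 : has_qdim A B n1 -> has_qdim A B m1 -> (n1 <= m1)%N.
  by move=> hn hm; apply/eqP; rewrite eqn_leq !le.
move=> [e [Be _ fe]] [f [_ cf _]].
have [c hc] := choice (fun i => cf (e i) (Be i)).
exact: (qdim_le sA hc fe).
Qed.

Lemma qdimE A B n : subsp A -> has_qdim A B n -> qdim A B = n.
Proof.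
move=> sA h; apply: (has_qdim_uniq sA _ h).
by apply: (@xgetI _ 0%N [set n | has_qdim A B n] n); exact: h.
Qed.

Lemma odim_has_qdim A n : subsp A -> odim A n -> has_qdim [set 0] A n.
Proof.
move=> sA [s hs ss]; have [[os As] _] := hs.
exists (fun i : 'I_n => s`_i); split=> [i|v Av|c c0].
- by apply: As; rewrite mem_nth // ss.
- exists (fun i : 'I_n => dotp v s`_i) => /=; rewrite -ss.
  by rewrite {1}(obasisE sA hs Av) /proj_on (big_nth 0) big_mkord subrr.
- move=> i; have := @ons_free _ _ s os (fun k => if insub k is Some j then c j else 0).
  rewrite ss => /(_ _ i (ltn_ord i)); rewrite valK; apply.
  by rewrite -[RHS]c0; apply: eq_bigr => j _; rewrite valK.
Qed.

Lemma has_qdim_odim A n : subsp A -> has_qdim [set 0] A n -> odim A n.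
Proof.
move=> sA h; have [f [_ cf _]] := h.
have [|s hs] := @obasis_exists _ _ A n sA.
  move=> s [os As].
  have [c hc] := choice (fun i : 'I_(size s) => cf s`_i (As _ (mem_nth 0 (ltn_ord i)))).
  apply: (qdim_le (subsp0 (H := H)) hc) => d d0 i.
  have := @ons_free _ _ s os (fun k => if insub k is Some j then d j else 0).
  move=> /(_ _ i (ltn_ord i)); rewrite valK; apply.
  by rewrite -[RHS]d0; apply: eq_bigr => j _; rewrite valK.
have hm : odim A (size s) by exists s.
by rewrite (has_qdim_uniq (subsp0 (H := H)) h (odim_has_qdim sA hm)).
Qed.

Lemma range_proj_fix p : projection p -> range p = [set v | p v = v].
Proof.
by move=> hp; apply/seteqP; split=> [_ [u _ <-]|v pv]; [exact: projK|exists v].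
Qed.

Lemma finite_rankP p : projection p ->
  finite_rank p <-> exists n, odim [set v | p v = v] n.
Proof.
move=> hp; have sA := subsp_fix (proj_bop hp).
rewrite /finite_rank range_proj_fix //; split=> -[n h]; exists n.
  exact: has_qdim_odim.
exact: odim_has_qdim.
Qed.

Lemma rank_odim p n : projection p -> odim [set v | p v = v] n -> rank p = n.
Proof.
move=> hp h; rewrite /rank range_proj_fix //; apply: qdimE; first exact: subsp0.
exact: odim_has_qdim (subsp_fix (proj_bop hp)) h.
Qed.

Lemma finite_rank_compact p : projection p -> finite_rank p -> compact_op p.
Proof.
move=> hp /(finite_rankP hp)[n [s hs _]].
have sA := subsp_fix (proj_bop hp).
have E v : p v = proj_on s v.
  rewrite (obasisE sA hs (projK hp v)); apply: eq_big_seq => x xs.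
  by have [[_ As] _] := hs; rewrite (proj_adj hp) As.
have -> : p = proj_on s by apply/funext.
elim: s {hs E} => [|x s IH].
  by have := @compact_zero R H; congr compact_op; apply/funext => v; rewrite /proj_on big_nil.
have := compact_add (compact_rank1 x x) IH; congr compact_op.
by apply/funext => v; rewrite /proj_on big_cons.
Qed.

Lemma compact_finite_rank p : projection p -> compact_op p -> finite_rank p.
Proof.
move=> hp cp; apply/finite_rankP => //.
exact: compact_fix_dim cp (subsp_fix (proj_bop hp)) _.
Qed.

Lemma ec_zero p : projection p -> finite_rank p -> ec p (fun=> 0) = (rank p)%:Z.
Proof.
move=> hp fp; have [n hn] := (finite_rankP hp).1 fp.
have E : E1 p (fun=> 0) = [set v | p v = v] by apply/seteqP; split=> v // [].
have E' : odim (E1 (fun=> 0) p) 0.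
  by exists [::] => //; split=> // v [<-].
rewrite /ec (dimoE (subsp_E1 (@proj_zero R H) hp) E') E subr0 (rank_odim hp hn).
by rewrite (dimoE (subsp_fix (proj_bop hp)) hn).
Qed.

(** [adjoint W] carries [E1 p q] isometrically onto the kernel of [adjoint V \o W], and [adjoint V]
    carries [E1 q p] onto a complement of its range. *)
Lemma fredholm_index_ec p q (V W : H -> H) : projection p -> projection q ->
  compact_op (p \- q) -> ~ finite_rank p -> ~ finite_rank q ->
  isometry_op V -> isometry_op W -> V \o adjoint V = q -> W \o adjoint W = p ->
  fredholm_index (adjoint V \o W) = ec p q.
Proof.
move=> hp hq ca ip iq iV iW VV WW.
(* Were there no bounded adjoint, the default value would make [r = 0], of finite rank; so
   [adjoint U] is a true adjoint. *)
have adjP (U r : H -> H) : isometry_op U -> ~ finite_rank r -> U \o adjoint U = r ->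
    bounded_op (adjoint U) /\ adj U (adjoint U).
  move=> [bU _] infr rE.
  have [ex|no] := pselect (exists S, bounded_op S /\ adj U S).
    by have := xgetPex (fun=> 0 : H) ex.
  exfalso; apply: infr.
  have r0 : r = fun=> 0.
    apply/funext => v; rewrite -rE /= /adjoint xgetPN ?(bop0 bU) //.
    by move=> S hS; apply: no; exists S.
  rewrite r0; apply: compact_finite_rank; first exact: proj_zero.
  exact: compact_zero.
have [bVa aV] := adjP V q iV iq VV; have [bWa aW] := adjP W p iW ip WW.
set Va := adjoint V in VV bVa aV *; set Wa := adjoint W in WW bWa aW.
have [bV _] := iV; have [bW _] := iW.
have VVa v : V (Va v) = q v by rewrite -VV.
have WWa v : W (Wa v) = p v by rewrite -WW.
have VaV v : Va (V v) = v.
  by apply: dotp_ext => w; rewrite (adj_sym aV) isometry_dotp.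
have WaW v : Wa (W v) = v.
  by apply: dotp_ext => w; rewrite (adj_sym aW) isometry_dotp.
have caN := compact_diffC ca.
have sA := subsp_E1 hp hq; have sB := subsp_E1 hq hp.
have [s hs ss] := E1_odim hp hq ca; have [t ht st] := E1_odim hq hp caN.
have [[os As] hs'] := hs; have [[ot Bt] ht'] := ht.
have bT : bounded_op (Va \o W) by exact: bop_comp.
have ons_map (f : H -> H) (l : seq H) : ons l ->
    (forall x y, x \in l -> y \in l -> dotp (f x) (f y) = dotp x y) -> ons (map f l).
  elim: l => //= x l IH [x1 xl ol] hf; split.
  - apply/eqP; rewrite -(@eqrXn2 _ 2) ?hnorm_ge0 // -!ripuu /rip hf ?mem_head //.
    by rewrite dotpE x1 expr1n.
  - by move=> _ /mapP[y yl ->]; rewrite hf ?mem_head ?inE ?yl ?orbT // xl.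
  - by apply: IH => // y z yl zl; apply: hf; rewrite inE ?yl ?zl orbT.
have hker : odim ((Va \o W) @^-1` [set 0]) (dimo (E1 p q)).
  exists (map Wa s); last by rewrite size_map.
  split; first split.
  - apply: ons_map => // x y xs ys; have [py _] := As y ys.
    by rewrite -aW WWa (proj_adj hp) py.
  - move=> _ /mapP[x xs ->] /=; have [px qx] := As x xs.
    by rewrite WWa px -[Va x]VaV VVa qx (bop0 bVa).
  - move=> v /= Tv ov; rewrite -(WaW v) (_ : W v = 0) ?(bop0 bWa) //.
    apply: hs'; first split; first by rewrite -WWa WaW.
      by rewrite -VVa Tv (bop0 bV).
    by move=> x xs; rewrite aW; apply: ov; exact: map_f.
have sK : subsp ((Va \o W) @^-1` [set 0]) by exact: subsp_ker bT.
have hcoker : has_qdim (range (Va \o W)) setT (dimo (E1 q p)).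
  exists (fun i : 'I_(dimo (E1 q p)) => Va t`_i); split=> // [v _|c [u _ /= hu] i].
    have qVv : q (V v) = V v by rewrite -VVa VaV.
    pose w := V v - proj_on t (V v).
    have qw : q w = w.
      rewrite /w (bopB (proj_bop hq)) qVv; congr (_ - _).
      by have [] := proj_on_in (V v) sB Bt.
    (* Off its component in [E1 q p], [V v] is [q u] with [u] in the range of [p]; applying [Va]
       lands in the range of [Va \o W]. *)
    have [e Be|u [pu qu]] := pair_closed_range hp hq caN qw.
      rewrite (obasisE sB ht Be) dotp_sumr big_seq_cond big1 // => x.
      by rewrite andbT => xt; rewrite dotpZr proj_on_ortho ?mulr0.
    exists (fun i : 'I_(dimo (E1 q p)) => dotp (V v) t`_i).
    exists (Wa u) => //=; rewrite WWa pu -[Va u]VaV VVa qu /w (bopB bVa) VaV.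
    congr (_ - _); rewrite /proj_on (bop_sum bVa) (big_nth 0) big_mkord st.
    by apply: eq_bigr => i _; rewrite (bopZ bVa).
  have it : (i < size t)%N by rewrite st.
  have [qti pti] := Bt _ (mem_nth 0 it).
  have := congr1 (fun x => dotp (V x) t`_i) hu.
  have pWu : p (W u) = W u by rewrite -WWa WaW.
  rewrite VVa (proj_adj hq) qti -pWu (proj_adj hp) pti dotp0r.
  have -> : \sum_(j < dimo (E1 q p)) c j *: Va t`_j =
      Va (\sum_(j < dimo (E1 q p)) c j *: t`_j).
    by rewrite (bop_sum bVa); apply: eq_bigr => j _; rewrite (bopZ bVa).
  rewrite VVa (proj_adj hq) qti dotp_suml (bigD1 i) //= dotpZl.
  rewrite dotpE (ons_norm ot) ?mem_nth // expr1n mulr1 big1 ?addr0 // => j /eqP ji.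
  rewrite dotpZl (ons_dotp ot) ?mem_nth ?mulr0 ?st //.
  move/eqP; rewrite nth_uniq ?ons_uniq ?st // => /eqP ij.
  by apply: ji; apply/val_inj.
rewrite /fredholm_index (qdimE (subsp0 (H := H)) (odim_has_qdim sK hker)).
by rewrite (qdimE (subsp_range bT) hcoker).
Qed.

Lemma esscodimE p q : separable_hilbert H -> infinite_dimensional H ->
  projection p -> projection q -> compact_op (p \- q) -> esscodim p q = ec p q.
Proof.
move=> Hsep Hinf hp hq ca; rewrite /esscodim.
(* A projection has finite rank exactly when it is compact, and compactness survives a compact
   difference. *)
have finite_transfer (p1 q1 : H -> H) : projection p1 -> projection q1 ->
    compact_op (p1 \- q1) -> finite_rank p1 -> finite_rank q1.
  move=> hp1 hq1 c1 /(finite_rank_compact hp1) cp.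
  apply: compact_finite_rank => //.
  have := compact_sub cp c1; congr compact_op; apply/funext => v /=.
  by rewrite opprB addrC subrK.
case: asboolP => [[fp fq]|no].
  (* A rank is [ec] against 0, so additivity yields the difference of ranks. *)
  rewrite -(ec_zero hp fp) -(ec_zero hq fq).
  have cq : compact_op (q \- (fun=> 0)).
    have := finite_rank_compact hq fq; congr compact_op.
    by apply/funext => v /=; rewrite subr0.
  by rewrite -(ec_additive hp hq (@proj_zero R H) ca cq) addrK.
have ip : ~ finite_rank p.
  by move=> fp; apply: no; split=> //; exact: finite_transfer hp hq ca fp.
have iq : ~ finite_rank q.
  by move=> fq; apply: no; split=> //; exact: finite_transfer hq hp (compact_diffC ca) fq.
have inf (r : H -> H) : projection r -> ~ finite_rank r -> ~ exists n, odim [set v | r v = v] n.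
  by move=> hr ir /(finite_rankP hr).
have [V [iV VV]] := range_isometry_exists Hsep Hinf hq (inf q hq iq).
have [W [iW WW]] := range_isometry_exists Hsep Hinf hp (inf p hp ip).
(* Every pair of isometries has index [ec p q], so the choice does not matter; the existing pair
   rules out the default 0. *)
case: xgetP => [k _ [V' [W' [[iV' iW'] VV' WW' ->]]]|/(_ (ec p q)) []].
  exact: fredholm_index_ec.
by exists V, W; split=> //; rewrite (fredholm_index_ec hp hq).
Qed.
End Index.

(** * Continuity in the sense of filters, and the pieces of the ground space *)

Section Topology.
Context {R : realType} {H : hilbertType R}.
Implicit Types (u v w : H) (f g h : R -> H -> H) (D : set R) (J : interval R).

Lemma near_within D (t : R) (P : R -> Prop) :
  (\forall s \near within D (nbhs t), P s) <->
  exists2 d : R, 0 < d & forall s, D s -> `|s - t| < d -> P s.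
Proof.
split=> [/nbhs_ballP[d /= d0 hd]|[d d0 hd]].
  exists d => // s Ds lt; apply: hd => //.
  by rewrite -ball_normE /= distrC.
apply/nbhs_ballP; exists d => //= s; rewrite -ball_normE /= distrC => lt Ds.
exact: hd.
Qed.

Lemma scontP D f :
  (forall u, {within D, continuous (fun t => f t u)}) <-> scont D f.
Proof.
split=> [hf u t Dt e e0|hf u].
  have /subspace_continuousP/(_ t Dt)/hcvgP/(_ e e0)/near_within[d d0 hd] := hf u.
  by exists d => // s Ds lt; apply/ltW; exact: hd.
apply/subspace_continuousP => t Dt; apply/hcvgP => e e0; apply/near_within.
have [d d0 hd] := hf u t Dt (e / 2) (divr_gt0 e0 (ltr0n _ 2)).
exists d => // s Ds lt; apply: le_lt_trans (hd s Ds lt) _; lra.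
Qed.

Lemma cvg0P (F : set_system R) (FF : Filter F) (phi : R -> R) :
  phi t @[t --> F] --> (0 : R) <->
  forall e : R, 0 < e -> \forall t \near F, `|phi t| < e.
Proof.
split=> [/cvgrPdist_lt hf e e0|hf].
  by apply: filterS (hf _ e0) => x; rewrite sub0r normrN.
apply/cvgrPdist_lt => e e0; apply: filterS (hf _ e0) => x.
by rewrite sub0r normrN.
Qed.

Lemma ncontP D f : (forall t, D t -> bounded_op (f t)) ->
  (forall t, D t -> opnorm (f s \- f t) @[s --> within D (nbhs t)] --> (0 : R)) <->
  ncont D f.
Proof.
move=> bf; split=> hf t Dt.
  move=> e e0; have /cvg0P/(_ e e0)/near_within[d d0 hd] := hf t Dt.
  exists d => // s Ds lt u; have bd := bop_sub (bf s Ds) (bf t Dt).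
  apply: le_trans (le_opnorm bd u) _; rewrite ler_wpM2r ?hnorm_ge0 //.
  by apply: le_trans (ltW (hd s Ds lt)); exact: ler_norm.
apply/cvg0P => e e0; apply/near_within.
have e2 : 0 < e / 2 by rewrite divr_gt0.
have [d d0 hd] := hf t Dt _ e2; exists d => // s Ds lt.
have bd := bop_sub (bf s Ds) (bf t Dt); rewrite ger0_norm ?opnorm_ge0 //.
apply: le_lt_trans (opnorm_le bd (ltW e2) (hd s Ds lt)) _; lra.
Qed.

Definition closed_itv J := exists a b : itv_bound R,
  [/\ J = Interval a b, a = -oo%O \/ exists r, a = BLeft r &
      b = +oo%O \/ exists r, b = BRight r].

Lemma left_infinite_mem J : closed_itv J -> left_infinite J ->
  exists m, forall t, t <= m -> t \in J.
Proof.
move=> [a [b [-> _ hb]]] /eqP /= ->; case: hb => [->|[r ->]].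
  by exists 0 => t _; rewrite in_itv.
by exists r => t tr; rewrite in_itv.
Qed.

Lemma right_infinite_mem J : closed_itv J -> right_infinite J ->
  exists m, forall t, m <= t -> t \in J.
Proof.
move=> [a [b [-> ha _]]] /eqP /= ->; case: ha => [->|[r ->]].
  by exists 0 => t _; rewrite in_itv.
by exists r => t tr; rewrite in_itv /= tr.
Qed.

Definition C0field J f := [/\ forall t, t \in J -> compact_op (f t),
  ncont [set` J] f,
  left_infinite J -> forall e : R, 0 < e ->
    exists m, forall t, t <= m -> forall u, hnorm (f t u) <= e * hnorm u &
  right_infinite J -> forall e : R, 0 < e ->
    exists m, forall t, m <= t -> forall u, hnorm (f t u) <= e * hnorm u].

(** An infinite end puts a whole half-line inside [J], where the operators are bounded and [opnorm]
    can be compared with estimates on vectors. *)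
Lemma C0KP J f : closed_itv J -> C0K J f <-> C0field J f.
Proof.
move=> cJ; split=> -[cf nf lf rf].
  have bf t : t \in J -> bounded_op (f t) by move=> /cf/compact_bop.
  split=> // [|Li e e0|Ri e e0].
  - by apply/(@ncontP [set` J]) => //; exact: bf.
  - have [m hm] := left_infinite_mem cJ Li.
    have /cvg0P/(_ e e0)[M [_ hM]] := lf Li.
    exists (Num.min m (M - 1)) => t; rewrite le_min => /andP[tm tM] u.
    apply: le_trans (le_opnorm (bf t (hm t tm)) u) _.
    rewrite ler_wpM2r ?hnorm_ge0 //; apply: le_trans (ler_norm _) _.
    by apply/ltW/hM; lra.
  - have [m hm] := right_infinite_mem cJ Ri.
    have /cvg0P/(_ e e0)[M [_ hM]] := rf Ri.
    exists (Num.max m (M + 1)) => t; rewrite ge_max => /andP[tm tM] u.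
    apply: le_trans (le_opnorm (bf t (hm t tm)) u) _.
    rewrite ler_wpM2r ?hnorm_ge0 //; apply: le_trans (ler_norm _) _.
    by apply/ltW/hM; lra.
have bf t : t \in J -> bounded_op (f t) by move=> /cf/compact_bop.
split=> // [|Li|Ri].
- by apply/(@ncontP [set` J]).
- have [m hm] := left_infinite_mem cJ Li.
  apply/cvg0P => e e0; have e2 : 0 < e / 2 by rewrite divr_gt0.
  have [M hM] := lf Li _ e2.
  exists (Num.min m M); split; first exact: num_real.
  move=> t; rewrite lt_min => /andP[/ltW tm /ltW tM].
  have bt := bf t (hm t tm); rewrite ger0_norm ?opnorm_ge0 //.
  by apply: le_lt_trans (opnorm_le bt (ltW e2) (hM t tM)) _; lra.
- have [m hm] := right_infinite_mem cJ Ri.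
  apply/cvg0P => e e0; have e2 : 0 < e / 2 by rewrite divr_gt0.
  have [M hM] := rf Ri _ e2.
  exists (Num.max m M); split; first exact: num_real.
  move=> t; rewrite gt_max => /andP[/ltW tm /ltW tM].
  have bt := bf t (hm t tm); rewrite ger0_norm ?opnorm_ge0 //.
  by apply: le_lt_trans (opnorm_le bt (ltW e2) (hM t tM)) _; lra.
Qed.

Lemma C0field_add J f g : C0field J f -> C0field J g -> C0field J (fun t => f t \+ g t).
Proof.
move=> [cf nf lf rf] [cg ng lg rg].
have sum_le (e : R) (t : R) : (forall u, hnorm (f t u) <= e / 2 * hnorm u) ->
    (forall u, hnorm (g t u) <= e / 2 * hnorm u) ->
    forall u, hnorm (f t u + g t u) <= e * hnorm u.
  move=> h1 h2 u; apply: le_trans (ler_hnormD _ _) _.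
  by have := h1 u; have := h2 u; lra.
split.
- by move=> t Jt; apply: compact_add; [exact: cf|exact: cg].
- exact: ncont_add.
- move=> Li e e0; have e2 : 0 < e / 2 by rewrite divr_gt0.
  have [m hm] := lf Li _ e2; have [m' hm'] := lg Li _ e2.
  exists (Num.min m m') => t; rewrite le_min => /andP[tm tm'].
  by apply: sum_le; [exact: hm|exact: hm'].
- move=> Ri e e0; have e2 : 0 < e / 2 by rewrite divr_gt0.
  have [m hm] := rf Ri _ e2; have [m' hm'] := rg Ri _ e2.
  exists (Num.max m m') => t; rewrite ge_max => /andP[tm tm'].
  by apply: sum_le; [exact: hm|exact: hm'].
Qed.

Lemma C0field_opp J f : C0field J f -> C0field J (fun t => \- f t).
Proof.
move=> [cf nf lf rf]; split.
- by move=> t Jt; exact: compact_opp (cf t Jt).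
- move=> t Dt e e0; apply: near_mono (nf t Dt e e0) => s Ds h u /=.
  by rewrite -opprD hnormN.
- move=> Li e e0; have [m hm] := lf Li e e0; exists m => t tm u.
  by rewrite /= hnormN; exact: hm.
- move=> Ri e e0; have [m hm] := rf Ri e e0; exists m => t tm u.
  by rewrite /= hnormN; exact: hm.
Qed.

Lemma C0field_trans J f g h : C0field J (fun t => f t \- g t) ->
  C0field J (fun t => g t \- h t) -> C0field J (fun t => f t \- h t).
Proof.
move=> h1 h2; have := C0field_add h1 h2; congr C0field.
by apply/funext => t; apply/funext => u /=; rewrite subrKA.
Qed.

Lemma C0field_sym J f g : C0field J (fun t => f t \- g t) -> C0field J (fun t => g t \- f t).
Proof.
move=> /C0field_opp; congr C0field.
by apply/funext => t; apply/funext => u /=; rewrite opprB.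
Qed.

Lemma C0field_Kfield J f g : (forall t, t \in J -> projection (f t)) ->
  (forall t, t \in J -> projection (g t)) ->
  C0field J (fun t => f t \- g t) -> Kfield [set` J] (fun t => f t \- g t).
Proof.
move=> pf pg [cfg nfg _ _]; split=> //; exists (fun t => f t \- g t) => t Jt.
split; [|exact: cfg|exact: cfg].
by apply: adj_sub; [exact: proj_adj (pf t Jt)|exact: proj_adj (pg t Jt)].
Qed.

Lemma Kfield_C0field J f : Kfield [set` J] f ->
  (left_infinite J -> exists m, forall t, t <= m -> f t = fun=> 0) ->
  (right_infinite J -> exists m, forall t, m <= t -> f t = fun=> 0) -> C0field J f.
Proof.
move=> Kf lf rf; split.
- by move=> t Jt; exact: Kfield_compact Kf Jt.
- by case: Kf.
- move=> /lf[m hm] e e0; exists m => t /hm -> u.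
  by rewrite hnorm0 mulr_ge0 ?hnorm_ge0 // ltW.
- move=> /rf[m hm] e e0; exists m => t /hm -> u.
  by rewrite hnorm0 mulr_ge0 ?hnorm_ge0 // ltW.
Qed.

Lemma Cb_pfield J f : Cb J f -> (forall t, t \in J -> projection (f t)) ->
  pfield [set` J] f.
Proof. by move=> [_ _ sf _] pf; split=> //; exact/scontP. Qed.

(** Projections are self-adjoint of norm at most 1, so strong and strong-* continuity coincide for
    them. *)
Lemma pfield_Cb J f : pfield [set` J] f -> Cb J f.
Proof.
move=> [pf sf]; split.
- by move=> t /pf/proj_bop.
- exists 1 => t /pf hp; apply: (opnorm_le (proj_bop hp)) => // u.
  by rewrite mul1r; exact: proj_norm.
- by apply/scontP.
- apply/scontP => u t Jt e e0; apply: near_mono (sf u t Jt e e0) => s Js.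
  by have [_ _ ->] := pf s Js; have [_ _ ->] := pf t Jt.
Qed.
End Topology.

(** * The pieces of a partition of the ground space *)

Section Pieces.
Context {R : realType}.
Variables (X : ground) (n : nat) (x : nat -> R).
Hypothesis hx : partition_points X n x.

Definition lower_end := if X is RealLine then false else true.
Definition upper_end := if X is UnitInterval then true else is_circle X.

Lemma baseP (t : R) : (t \in base X) <-> (lower_end -> 0 <= t) /\ (upper_end -> t <= 1).
Proof.
rewrite /lower_end /upper_end; case: X; rewrite in_itv /=.
- by split=> [/andP[]|[-> // ->]].
- by rewrite andbT; split=> [|[->]].
- by [].
- by split=> [/andP[]|[-> // ->]].
Qed.

Lemma partition_interior i : (1 <= i <= n)%N ->
  (lower_end -> 0 < x i) /\ (upper_end -> x i < 1).
Proof.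
move=> hi; have [/(_ i hi) + _] := hx; rewrite /interior => /nbhs_ballP[d /= d0 hd].
have d2 : 0 < d / 2 by rewrite divr_gt0.
split=> [lo|up].
  have /baseP[+ _] := hd (x i - d / 2) ltac:(rewrite -ball_normE /= opprB addrC subrK
    gtr0_norm //; lra).
  by move=> /(_ lo); lra.
have /baseP[_] := hd (x i + d / 2) ltac:(rewrite -ball_normE /= opprD addrA subrr sub0r
  normrN gtr0_norm //; lra).
by move=> /(_ up); lra.
Qed.

Lemma partition_mono i j : (1 <= i)%N -> (i <= j <= n)%N -> x i <= x j.
Proof.
move=> i1 /andP[]; elim: j => [|j IH]; first by rewrite leqn0 => /eqP->.
rewrite leq_eqVlt => /orP[/eqP->//|]; rewrite ltnS => ij jn.
apply: le_trans (IH ij (ltnW jn)) _; apply: ltW; have [_] := hx; apply.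
by rewrite (leq_trans i1 ij).
Qed.

Lemma partition_base i : (1 <= i <= n)%N -> x i \in base X.
Proof.
by move=> hi; apply/baseP; have [h1 h2] := partition_interior hi;
  split=> [/h1|/h2] /ltW.
Qed.

Lemma pieceP i t : (i <= n)%N -> (t \in piece X n x i) <->
  [/\ t \in base X, (0 < i)%N -> x i <= t & (i < n)%N -> t <= x i.+1].
Proof.
move=> hi; rewrite (ltn_neqAle i n) hi andbT lt0n /piece.
have hl : (0 < i)%N -> x i \in base X.
  by move=> i0; apply: partition_base; rewrite i0.
have hr : (i < n)%N -> x i.+1 \in base X.
  by move=> i1; apply: partition_base.
move: hl hr; rewrite (ltn_neqAle i n) hi andbT lt0n.
case: (base X) => a b; rewrite !itv_boundlr => hl hr.
case: eqP hl => i0 /= hl; case: eqP hr => i1 /= hr.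
- by split=> [->|[->]].
- have /andP[_ h] := hr isT; split=> [/andP[-> h1]|[/andP[-> _] _ /(_ isT) h1]].
    split=> //=.
    by apply: le_trans h1 _; apply: le_trans h; rewrite bnd_simp.
  by rewrite bnd_simp.
- have /andP[h _] := hl isT; split=> [/andP[h1 ->]|[/andP[_ ->] /(_ isT) h1 _]].
    split=> //=.
    by rewrite andbT; apply: le_trans h1.
  by rewrite bnd_simp h1.
- have /andP[h _] := hl isT; have /andP[_ h'] := hr isT.
  split=> [/andP[h1 h2]|[_ /(_ isT) h1 /(_ isT) h2]]; last by rewrite !bnd_simp h1.
  split=> //=.
  apply/andP; split; first exact: le_trans h1.
  by apply: le_trans h2 _; apply: le_trans h'; rewrite bnd_simp.
Qed.

Definition piece_set i : set R := [set` piece X n x i].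

Lemma base_closed : closed_itv (base X : interval R).
Proof.
by case: X; [exists (BLeft 0), (BRight 1) | exists (BLeft 0), +oo%O
  | exists -oo%O, +oo%O | exists (BLeft 0), (BRight 1)]; split;
  by [|left|right; eexists].
Qed.

Lemma piece_closed i : closed_itv (piece X n x i).
Proof.
rewrite /piece; have [a [b [-> ha hb]]] := base_closed.
exists (if i == 0%N then a else BLeft (x i)), (if i == n then b else BRight (x i.+1)).
by split=> //; case: ifP => // _; right; eexists.
Qed.

(** Induction over the unions of the pieces up to [i], glued at [x i.+1]; for [i = n] the upper
    bound disappears. *)
Lemma near_pieces t (P : R -> Prop) : t \in base X ->
  (forall i, (i <= n)%N -> piece_set i t -> exists2 d : R, 0 < d &
     forall s, piece_set i s -> `|s - t| < d -> P s) ->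
  exists2 d : R, 0 < d & forall s, s \in base X -> `|s - t| < d -> P s.
Proof.
move=> bt hP.
suff : forall i, (i <= n)%N -> ((i < n)%N -> t <= x i.+1) ->
    exists2 d : R, 0 < d & forall s, s \in base X -> ((i < n)%N -> s <= x i.+1) ->
      `|s - t| < d -> P s.
  move=> /(_ n (leqnn n)); rewrite ltnn => /(_ ltac:(by [])) [d d0 hd].
  by exists d => // s bs lt; apply: hd.
elim=> [|i IH] hi ht.
  have [|d d0 hd] := hP 0%N hi; first by apply/pieceP.
  by exists d => // s bs hs lt; apply: hd => //; apply/pieceP.
suff : exists2 d : R, 0 < d &
    forall s, s \in base X /\ ((i.+1 < n)%N -> s <= x i.+2) -> `|s - t| < d -> P s.
  by move=> [d d0 hd]; exists d => // s bs hs lt; apply: hd.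
apply: (@near_glue R [set s | s \in base X /\ ((i.+1 < n)%N -> s <= x i.+2)] (x i.+1)).
all: move=> tx.
- have [|d d0 hd] := IH (ltnW hi); first by move=> _.
  by exists d => // s [bs hs] sx lt; apply: hd.
- have [|d d0 hd] := hP i.+1 hi; first by apply/pieceP.
  by exists d => // s [bs hs] sx lt; apply: hd => //; apply/pieceP.
Qed.

Lemma base_pieces t : t \in base X -> exists2 i, (i <= n)%N & piece_set i t.
Proof.
move=> bt; suff : forall i, (i <= n)%N -> ((i < n)%N -> t <= x i.+1) ->
    exists2 j, (j <= n)%N & piece_set j t.
  by move=> /(_ n (leqnn n)); rewrite ltnn; apply.
elim=> [|i IH] hi ht; first by exists 0%N => //; apply/pieceP.
have [tx|/ltW tx] := leP t (x i.+1); first by apply: IH => //; exact: ltnW.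
by exists i.+1 => //; apply/pieceP.
Qed.

Lemma piece_set_base i t : (i <= n)%N -> piece_set i t -> t \in base X.
Proof. by move=> hi /(pieceP _ hi)[]. Qed.

Lemma piece_set_convex i (s t r : R) : piece_set i s -> piece_set i t -> s <= r <= t -> piece_set i r.
Proof.
rewrite /piece_set /=; case: (piece X n x i) => a b; rewrite !itv_boundlr.
move=> /andP[h1 _] /andP[_ h2] /andP[h3 h4]; apply/andP; split.
  by apply: le_trans h1 _; rewrite bnd_simp.
by apply: le_trans h2; rewrite bnd_simp.
Qed.

Lemma piece_set_left i : (0 < i <= n)%N -> piece_set i (x i).
Proof.
move=> /andP[i0 hi]; apply/pieceP => //; split=> //; first by apply: partition_base; rewrite i0.
by move=> i1; apply: partition_mono => //; rewrite leqnSn.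
Qed.

Lemma piece_set_right i : (i < n)%N -> piece_set i (x i.+1).
Proof.
move=> hi; apply/pieceP; first exact: ltnW.
split=> //; first exact: partition_base.
by move=> i0; apply: partition_mono => //; rewrite leqnSn.
Qed.

Lemma piece_set_zero : lower_end -> piece_set 0 0.
Proof.
move=> lo; apply/pieceP => //; split=> // [|i0].
  by apply/baseP; split=> // _; exact: ler01.
by have [/(_ lo)/ltW] := @partition_interior 1 i0.
Qed.

Lemma piece_set_one : upper_end -> piece_set n 1.
Proof.
move=> up; apply/pieceP => //; split=> // [|i0|]; last by rewrite ltnn.
  by apply/baseP; split=> // _; exact: ler01.
by have [_ /(_ up)/ltW] := @partition_interior n ltac:(by rewrite i0 leqnn).
Qed.

Lemma piece_left_infinite i : (i <= n)%N ->
  left_infinite (piece X n x i) = (i == 0%N) && ~~ lower_end.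
Proof.
move=> hi; rewrite /piece /lower_end; case: X; case: (i == 0%N) => //=.
Qed.

Lemma piece_right_infinite i : (i <= n)%N ->
  right_infinite (piece X n x i) = (i == n) && ~~ upper_end.
Proof.
by move=> hi; rewrite /piece /upper_end; case: X; case: (i == n).
Qed.

End Pieces.

(** * Liftings *)

Section Lifting.
Context {R : realType} {H : hilbertType R}.
Variables (X : ground) (n : nat) (x : nat -> R).
Hypothesis hx : partition_points X n x.
Implicit Types (f g h : R -> H -> H).

Let Q i : set R := piece_set X n x i.

Lemma C0field_ext (J : interval R) f g : closed_itv J -> (forall t, t \in J -> f t = g t) ->
  C0field J f -> C0field J g.
Proof.
move=> cJ fg [cf nf lf rf]; split.
- by move=> t Jt; rewrite -fg //; exact: cf.
- by apply: ncont_ext nf => t u Jt; rewrite fg.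
- move=> Li e e0; have [m hm] := lf Li e e0; have [m' hm'] := left_infinite_mem cJ Li.
  exists (Num.min m m') => t; rewrite le_min => /andP[tm tm'] u.
  by rewrite -fg; [exact: hm|exact: hm'].
- move=> Ri e e0; have [m hm] := rf Ri e e0; have [m' hm'] := right_infinite_mem cJ Ri.
  exists (Num.max m m') => t; rewrite ge_max => /andP[tm tm'] u.
  by rewrite -fg; [exact: hm|exact: hm'].
Qed.

Lemma C0field_pieces f : C0field (base X) f <-> forall i, (i <= n)%N -> C0field (piece X n x i) f.
Proof.
have baseL : left_infinite (base X : interval R) = ~~ lower_end X by case: X.
have baseR : right_infinite (base X : interval R) = ~~ upper_end X by case: X.
split=> [[cf nf lf rf] i hi|hp].
  split.
  - by move=> t /(piece_set_base hx hi) bt; exact: cf.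
  - move=> t /(piece_set_base hx hi) bt e e0; have [d d0 hd] := nf t bt e e0.
    by exists d => // s /(piece_set_base hx hi) bs; exact: hd.
  - by rewrite (piece_left_infinite _ _ hi) => /andP[_ h]; apply: lf; rewrite baseL.
  - by rewrite (piece_right_infinite _ _ hi) => /andP[_ h]; apply: rf; rewrite baseR.
split.
- move=> t /(base_pieces hx)[i hi hit]; have [cf _ _ _] := hp i hi.
  exact: cf.
- move=> t bt e e0.
  apply: (@near_pieces _ X n x hx t (fun s => forall u, hnorm (f s u - f t u) <= e * hnorm u) bt).
  move=> i hi hit; have [_ nf _ _] := hp i hi; exact: nf.
- rewrite baseL => h; have [_ _ lf _] := hp 0%N (leq0n n); apply: lf.
  by rewrite piece_left_infinite.
- rewrite baseR => h; have [_ _ _ rf] := hp n (leqnn n); apply: rf.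
  by rewrite piece_right_infinite // eqxx.
Qed.

Lemma corona_pi_represented (F : nat -> R -> H -> H) g : multiplier X g ->
  (forall i, (i <= n)%N -> C0field (piece X n x i) (fun t => g t \- F i t)) ->
  corona_pi X g = represented X n x F.
Proof.
move=> mg hK; apply/seteqP; split=> h [mh].
  move=> [/(C0KP _ (base_closed X))/C0field_pieces hb _]; split=> // i hi.
  apply/(C0KP _ (piece_closed _ _ _ i)).
  exact: C0field_trans (hb i hi) (hK i hi).
move=> hr; split=> //; split.
  apply/(C0KP _ (base_closed X))/C0field_pieces => i hi.
  have /(C0KP _ (piece_closed _ _ _ i)) hh := hr i hi.
  exact: C0field_trans hh (C0field_sym (hK i hi)).
by have [_ eg] := mg; have [_ eh] := mh => hc; rewrite eg // eh.
Qed.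

Lemma C0field_zero (J : interval R) f : C0field J (fun t => f t \- f t).
Proof.
have E : (fun t => f t \- f t) = (fun=> fun=> 0).
  by apply/funext => t; apply/funext => u /=; rewrite subrr.
rewrite E; split=> [t _|t _ e e0|_ e e0|_ e e0]; first exact: compact_zero.
- by exists 1 => // s _ _ u; rewrite subrr hnorm0 mulr_ge0 ?hnorm_ge0 // ltW.
- by exists 0 => t _ u; rewrite hnorm0 mulr_ge0 ?hnorm_ge0 // ltW.
- by exists 0 => t _ u; rewrite hnorm0 mulr_ge0 ?hnorm_ge0 // ltW.
Qed.

Lemma corona_pi_refl g : multiplier X g -> corona_pi X g g.
Proof.
move=> mg; split=> //; split.
  by apply/(C0KP _ (base_closed X)); exact: C0field_zero.
by have [_ eg] := mg => hc; rewrite eg.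
Qed.

Lemma piece_set_nonempty i : (i <= n)%N -> exists t, Q i t.
Proof.
case: i => [_|i hi]; last by exists (x i.+1); exact: piece_set_left.
have [n0|n0] := posnP n; last by exists (x 1%N); exact: piece_set_right.
exists 0; apply/(pieceP hx) => //; split=> //; last by rewrite n0.
by apply/baseP; split=> // _; exact: ler01.
Qed.

Variable f : nat -> R -> H -> H.
Hypothesis pf : forall i, (i <= n)%N -> pfield (Q i) (f i).

(** The conditions of the theorem with [ec] in place of [esscodim]; [esscodimE] translates between
    the two. *)
Definition admissible (l : nat -> int) :=
  [/\ (forall i, (1 <= i <= n)%N -> l i - l i.-1 = - ec (f i (x i)) (f i.-1 (x i))) /\
        (is_circle X -> l 0%N - l n = - ec (f 0%N 0) (f n 1)),
      forall i t, (i <= n)%N -> Q i t ->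
        finite_rank (f i t) -> - (rank (f i t))%:Z <= l i,
      forall i t, (i <= n)%N -> Q i t ->
        finite_rank (idfun \- f i t) -> l i <= (rank (idfun \- f i t))%:Z &
      forall i, (i <= n)%N ->
        left_infinite (piece X n x i) || right_infinite (piece X n x i) -> l i = 0].

Lemma admissible_of_lift g : multiplier_projection X g ->
  (forall i, (i <= n)%N -> C0field (piece X n x i) (fun t => g t \- f i t)) ->
  exists l, admissible l.
Proof.
move=> [[mg eg] pg] hK.
have hg : pfield [set` base X] g by exact: Cb_pfield.
have hgi i : (i <= n)%N -> pfield (Q i) g.
  by move=> hi; apply: pfield_sub hg => t; exact: piece_set_base.
have pgi i t : (i <= n)%N -> Q i t -> projection (g t).
  by move=> hi /(piece_set_base hx hi); exact: pg.
have pfi i t : (i <= n)%N -> Q i t -> projection (f i t).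
  by move=> hi; have [h _] := pf hi; exact: h.
have Kf i : (i <= n)%N -> Kfield (Q i) (fun t => g t \- f i t).
  by move=> hi; apply: C0field_Kfield (hK i hi) => t; [exact: pgi|exact: pfi].
have ci i t : (i <= n)%N -> Q i t -> compact_op (g t \- f i t).
  by move=> hi; exact: Kfield_compact (Kf i hi).
have ex i : exists t, (i <= n)%N -> Q i t.
  have [hi|] := leqP i n; last by exists 0.
  by have [t] := piece_set_nonempty hi; exists t.
have [c hc] := choice ex.
(* The point [c i] is arbitrary, since [ec] is constant along a piece. *)
pose l i := ec (g (c i)) (f i (c i)).
have lE i t : (i <= n)%N -> Q i t -> ec (g t) (f i t) = l i.
  move=> hi hit; apply: (ec_constant _ (hgi i hi) (pf hi) (Kf i hi)) => //.
    by move=> s r z; exact: piece_set_convex.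
  exact: hc.
have diff (p q r : H -> H) : projection p -> projection q -> projection r ->
    compact_op (p \- q) -> compact_op (p \- r) -> ec p q - ec p r = - ec q r.
  move=> hp hq hr c1 c2.
  rewrite -(ec_additive hp hq hr c1 (compact_diff_trans (compact_diffC c1) c2)).
  by ring.
exists l; split; first split.
- move=> i /andP[i0 hi]; have hi' : (i.-1 < n)%N by lia.
  have Qi : Q i (x i) by apply: piece_set_left; rewrite ?i0.
  have Qi' : Q i.-1 (x i) by have := piece_set_right hx hi'; rewrite prednK.
  rewrite -(lE i (x i)) // -(lE i.-1 (x i)) // ?(ltnW hi') //.
  have hi2 := ltnW hi'.
  by apply: diff; [exact: pgi Qi|exact: pfi Qi|exact: pfi Qi'|exact: ci Qi|exact: ci Qi'].
- move=> hC; have lo : lower_end X by move: hC; case: X.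
  have up : upper_end X by move: hC; case: X.
  have Q0 := piece_set_zero hx lo; have Qn := piece_set_one hx up.
  rewrite -(lE 0%N 0) // -(lE n 1) // eg //.
  apply: diff; [exact: pgi Qn| | | |exact: ci Qn] => //.
  + exact: pfi Q0.
  + exact: pfi Qn.
  + by rewrite -eg //; exact: ci Q0.
- move=> i t hi hit fin; rewrite -(lE i t) //; have hp := pfi i t hi hit.
  have [m hm] := (finite_rankP hp).1 fin; rewrite (rank_odim hp hm).
  have sE := subsp_E1 hp (pgi i t hi hit).
  have [|k hk km] := odim_sub sE (subsp_fix (proj_bop hp)) _ hm; first by move=> v [].
  by rewrite /ec (dimoE sE hk); lia.
- move=> i t hi hit fin; rewrite -(lE i t) //; have hp := pfi i t hi hit.
  have hpc := projC hp; have [m hm] := (finite_rankP hpc).1 fin.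
  rewrite (rank_odim hpc hm).
  have sE := subsp_E1 (pgi i t hi hit) hp.
  have [|k hk km] := odim_sub sE (subsp_fix (proj_bop hpc)) _ hm.
    by move=> v [_ fv] /=; rewrite fv subr0.
  by rewrite /ec (dimoE sE hk); lia.
- move=> i hi inf.
  have [t hit small] : exists2 t, Q i t & forall u, hnorm (g t u - f i t u) <= 1 / 2 * hnorm u.
    have [_ _ lf rf] := hK i hi; have h2 : 0 < 1 / 2 :> R by lra.
    case/orP: inf => inf.
      have [m hm] := lf inf _ h2; have [m' hm'] := left_infinite_mem (piece_closed _ _ _ i) inf.
      exists (Num.min m m'); first by apply: hm'; rewrite ge_min lexx orbT.
      by apply: hm; rewrite ge_min lexx.
    have [m hm] := rf inf _ h2; have [m' hm'] := right_infinite_mem (piece_closed _ _ _ i) inf.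
    exists (Num.max m m'); first by apply: hm'; rewrite le_max lexx orbT.
    by apply: hm; rewrite le_max lexx.
  rewrite -(lE i t) //.
  have nul (p q : H -> H) : projection p -> projection q ->
      (forall u, hnorm (p u - q u) <= 1 / 2 * hnorm u) -> dimo (E1 p q) = 0%N.
    move=> hp hq hs; apply: dimoE (subsp_E1 hp hq) _; exists [::] => //.
    split=> // v [pv qv] _; apply: hnorm_eq0; have := hs v; rewrite pv qv subr0.
    by have := hnorm_ge0 v; lra.
  have hp := pgi i t hi hit; have hq := pfi i t hi hit.
  rewrite /ec (nul _ _ hp hq small) (nul _ _ hq hp) ?subrr // => u.
  by rewrite hnormB.
Qed.

Lemma ons_in_prefix (A : set H) m k : odim A m -> (k <= m)%N ->
  exists2 s, ons_in A s & size s = k.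
Proof.
move=> [s [[os As] _] <-] km; exists (take k s); last by rewrite size_take_min (minn_idPl km).
split; last by move=> y /mem_take; exact: As.
elim: s k os {As km} => [|y s IH] [|k] //= [y1 ys os]; split=> //; last exact: IH.
by move=> z /mem_take; exact: ys.
Qed.

(** A piece with an infinite end has [l i = 0] and keeps [f i]. On a compact piece the rank bounds,
    vacuous for infinite rank, supply the orthonormal vectors that [pfield_shift] asks for. *)
Lemma shifted_piece l i : admissible l -> (i <= n)%N ->
  exists g, [/\ pfield (Q i) g, Kfield (Q i) (fun t => g t \- f i t),
    forall t, Q i t -> ec (g t) (f i t) = l i &
    left_infinite (piece X n x i) || right_infinite (piece X n x i) -> g = f i].
Proof.
move=> [_ hlow hupp hinf] hi; have hf := pf hi; have [pfi _] := hf.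
have [inf|fin] := boolP (left_infinite (piece X n x i) || right_infinite (piece X n x i)).
  exists (f i); split=> //.
    apply: (@Kfield_ext _ _ _ (fun=> fun=> 0)).
      by move=> t _; apply/funext => u /=; rewrite subrr.
    apply: (@Kfield_const _ _ _ _ (fun=> 0)); try exact: compact_zero.
    by move=> u v; rewrite dotp0l dotp0r.
  by move=> t hit; rewrite hinf // ec_self //; exact: pfi.
have [a [b QE]] : exists a b, Q i = seg a b.
  have [a [b [E ha hb]]] := piece_closed X n x i; rewrite /Q /piece_set.
  move: fin; rewrite E; case: ha => [->|[r ->]] //; case: hb => [->|[s ->]] // _.
  by exists r, s; apply/seteqP; split=> t; rewrite /seg /= in_itv.
have ab : a <= b.
  by have [t] := piece_set_nonempty hi; rewrite QE => /andP[]; exact: le_trans.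
rewrite QE in hf pfi *; have QE' t : seg a b t -> Q i t by rewrite QE.
have [||g [hg Kg eg]] := @pfield_shift _ _ a b (l i) (f i) ab hf.
- move=> t hit l0; have hp := pfi t hit.
  have [fr|nfr] := pselect (finite_rank (f i t)); last first.
    apply: infinite_ons (subsp_fix (proj_bop hp)) _ _.
    by move=> /(finite_rankP hp).
  have := hlow i t hi (QE' t hit) fr; have [m hm] := (finite_rankP hp).1 fr.
  by rewrite (rank_odim hp hm) => le; apply: ons_in_prefix hm _; lia.
- move=> t hit l0; have hp := pfi t hit; have hpc := projC hp.
  have E : [set v | f i t v = 0] = [set v | (idfun \- f i t) v = v].
    apply/seteqP; split=> v /=; first by move=> ->; rewrite subr0.
    by move/eqP; rewrite subr_eq addrC -subr_eq subrr eq_sym => /eqP.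
  rewrite E; have [fr|nfr] := pselect (finite_rank (idfun \- f i t)); last first.
    apply: infinite_ons (subsp_fix (proj_bop hpc)) _ _.
    by move=> /(finite_rankP hpc).
  have := hupp i t hi (QE' t hit) fr; have [m hm] := (finite_rankP hpc).1 fr.
  by rewrite (rank_odim hpc hm) => le; apply: ons_in_prefix hm _; lia.
by exists g; split.
Qed.

(** By additivity [ec p q] is [l1 - ec f2 f1 - l2], and the relation between [l1] and [l2] says that
    this is 0. *)
Lemma turnable_chain (p f1 f2 q : H -> H) l1 l2 : projection p -> projection f1 ->
  projection f2 -> projection q -> compact_op (p \- f1) -> compact_op (f2 \- f1) ->
  compact_op (q \- f2) -> ec p f1 = l1 -> ec q f2 = l2 -> l2 - l1 = - ec f2 f1 ->
  turnable p q.
Proof.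
move=> hp h1 h2 hq c1 c12 c2 e1 e2 e12.
have c12' := compact_diffC c12; have c2' := compact_diffC c2.
have cp2 := compact_diff_trans c1 c12'; have cpq := compact_diff_trans cp2 c2'.
apply: turnable_ec0 => //.
rewrite -(ec_additive hp h2 hq cp2 c2') -(ec_additive hp h1 h2 c1 c12').
by rewrite e1 (ec_sym q) e2 (ec_sym f2); move: e12; lia.
Qed.

(** The field stays put to the left of [a], so at an infinite left end the difference from [f i] is
    eventually 0. *)
Lemma corrected_piece i g r a q : (i <= n)%N -> pfield (Q i) g ->
  Kfield (Q i) (fun t => g t \- f i t) ->
  (left_infinite (piece X n x i) -> g = f i) -> ~~ right_infinite (piece X n x i) ->
  Q i r -> a < r -> turnable (g r) q ->
  exists h, [/\ pfield (Q i) h, C0field (piece X n x i) (fun t => h t \- f i t),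
    forall t, Q i t -> t <= a -> h t = g t & h r = q].
Proof.
move=> hi hg Kg gL nR Qr ar tq.
have [h [hh Kh ha hr]] := tq (Q i) g a r hg Qr erefl ar.
exists h; split=> //; apply: Kfield_C0field.
- exact: Kfield_trans Kh Kg.
- move=> Li; have [m hm] := left_infinite_mem (piece_closed _ _ _ i) Li.
  exists (Num.min m a) => t; rewrite le_min => /andP[tm ta].
  by apply/funext => u /=; rewrite ha ?gL ?subrr //; exact: hm.
- by rewrite (negbTE nR).
Qed.

Definition glued (G : nat -> R -> H -> H) := fix glued i : R -> H -> H :=
  if i is j.+1 then fun t => if t <= x j.+1 then glued j t else G j.+1 t else G 0%N.

Lemma gluedE G : (forall i, (i < n)%N -> G i (x i.+1) = G i.+1 (x i.+1)) ->
  forall i t, (i <= n)%N -> Q i t -> glued G n t = G i t.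
Proof.
move=> hG; suff : forall k i t, (k <= n)%N -> (i <= k)%N -> Q i t -> glued G k t = G i t.
  by move=> h i t hi; exact: h.
elim=> [|k IH] i t hk hi Qt; first by move: hi Qt; rewrite leqn0 => /eqP->.
move: hi; rewrite leq_eqVlt => /orP[/eqP iE|ik]; last first.
  have iltn := leq_trans ik hk; have /(pieceP hx _ (ltnW iltn))[_ _ h] := Qt.
  rewrite /= (_ : t <= x k.+1); first by apply: IH => //; exact: ltnW.
  apply: le_trans (h iltn) _.
  by apply: (partition_mono hx) => //; rewrite ik.
subst i; have /(pieceP hx _ hk)[_ /(_ isT) h _] := Qt.
rewrite /=; case: ifPn => // h'; have tE : t = x k.+1 by apply/eqP; rewrite eq_le h' h.
by rewrite tE (IH k) ?hG ?(ltnW hk) //; exact: piece_set_right.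
Qed.

Hypothesis cf : forall i, (1 <= i <= n)%N -> compact_op (f i (x i) \- f i.-1 (x i)).
Hypothesis cf0 : is_circle X -> compact_op (f 0%N 0 \- f n 1).

Lemma lift_of_admissible l : admissible l ->
  exists g, multiplier_projection X g /\
    forall i, (i <= n)%N -> C0field (piece X n x i) (fun t => g t \- f i t).
Proof.
move=> hl; have [[hk hk0] _ _ _] := hl.
have exg i : exists g, (i <= n)%N ->
    [/\ pfield (Q i) g, Kfield (Q i) (fun t => g t \- f i t),
    forall t, Q i t -> ec (g t) (f i t) = l i &
    left_infinite (piece X n x i) || right_infinite (piece X n x i) -> g = f i].
  have [hi|] := leqP i n; last by exists (f i).
  by have [g hg] := shifted_piece hl hi; exists g.
have [g {exg}hg] := choice exg.
have pg i t : (i <= n)%N -> Q i t -> projection (g i t).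
  by move=> hi; have [[h _] _ _ _] := hg i hi; exact: h.
have pfi i t : (i <= n)%N -> Q i t -> projection (f i t).
  by move=> hi; have [h _] := pf hi; exact: h.
have cgf i t : (i <= n)%N -> Q i t -> compact_op (g i t \- f i t).
  by move=> hi; have [_ K _ _] := hg i hi; exact: Kfield_compact K.
have egf i t : (i <= n)%N -> Q i t -> ec (g i t) (f i t) = l i.
  by move=> hi; have [_ _ e _] := hg i hi; exact: e.
(* The target at a right end is the left value of the uncorrected [g i.+1], which [G i.+1]
   retains. *)
have exG i : exists G, (i <= n)%N ->
    [/\ pfield (Q i) G, C0field (piece X n x i) (fun t => G t \- f i t),
     ((0 < i)%N -> G (x i) = g i (x i)) /\
       (i = 0%N -> lower_end X -> G 0 = g 0%N 0),
     (i < n)%N -> G (x i.+1) = g i.+1 (x i.+1) &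
     i = n -> is_circle X -> G 1 = g 0%N 0].
  have [hi|] := leqP i n; last by exists (f i).
  have [hgi Kgi egi infi] := hg i hi.
  have Qleft : (0 < i)%N -> Q i (x i) by move=> i0; apply: (piece_set_left hx); rewrite i0.
  have Qzero : i = 0%N -> lower_end X -> Q i 0 by move=> ->; exact: piece_set_zero.
  have infL : left_infinite (piece X n x i) -> g i = f i.
    by move=> h; apply: infi; rewrite h.
  have step r q : Q i r -> ~~ right_infinite (piece X n x i) ->
      ((0 < i)%N -> x i < r) -> (i = 0%N -> lower_end X -> 0 < r) ->
      turnable (g i r) q ->
      exists G, [/\ pfield (Q i) G, C0field (piece X n x i) (fun t => G t \- f i t),
        ((0 < i)%N -> G (x i) = g i (x i)) /\
          (i = 0%N -> lower_end X -> G 0 = g 0%N 0) & G r = q].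
    move=> Qr nR h1 h2 tq.
    (* The correction starts at the left end of the piece, or at [r - 1] when the piece extends to
       minus infinity. *)
    pose a := if (0 < i)%N then x i else if lower_end X then 0 else r - 1.
    have ar : a < r.
      rewrite /a; case: ltnP => [/h1//|]; rewrite leqn0 => /eqP i0.
      by case: ifP => [/(h2 i0)//|_]; lra.
    have [G [hG KG Ga Gr]] := corrected_piece hi hgi Kgi infL nR Qr ar tq.
    exists G; split=> //; split=> [i0|i0 lo].
      by apply: Ga; [exact: Qleft|rewrite /a i0].
    have a0 : 0 <= a by rewrite /a i0 lo.
    by rewrite (Ga _ (Qzero i0 lo) a0) i0.
  have [iltn|nlei] := ltnP i n.
    have Qr : Q i (x i.+1) := piece_set_right hx iltn.
    have Ql : Q i.+1 (x i.+1) by apply: (piece_set_left hx).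
    have tq : turnable (g i (x i.+1)) (g i.+1 (x i.+1)).
      apply: (@turnable_chain _ (f i (x i.+1)) (f i.+1 (x i.+1)) _ (l i) (l i.+1)).
      - exact: pg Qr.
      - exact: pfi Qr.
      - exact: pfi Ql.
      - exact: pg Ql.
      - exact: cgf Qr.
      - by have := @cf i.+1; apply.
      - exact: cgf Ql.
      - exact: egf Qr.
      - exact: egf Ql.
      - by have := hk i.+1; apply.
    have [|||G [hG KG G1 G2]] := step _ _ Qr _ _ _ tq.
    - by rewrite piece_right_infinite // (ltn_eqF iltn).
    - by move=> i0; have [_] := hx; apply; rewrite i0.
    - by move=> i0 lo; have [] := @partition_interior _ _ _ _ hx i.+1 iltn; auto.
    - by exists G => _; split=> // iE; move: (iltn); rewrite iE ltnn.
  have iE : i = n by apply/eqP; rewrite eqn_leq hi.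
  have [hC|nC] := boolP (is_circle X); last first.
    (* Off the circle the last piece has nothing to match on its right and stays as it is. *)
    exists (g i) => _; split; [exact: hgi| |by split=> // ->|by []|by []].
    apply: Kfield_C0field => //.
      move=> Li; exists 0 => t _; apply/funext => u /=.
      by rewrite infi ?Li // subrr.
    move=> Ri; exists 0 => t _; apply/funext => u /=.
    by rewrite infi ?Ri ?orbT // subrr.
  have lo : lower_end X by move: hC; case: (X).
  have up : upper_end X by move: hC; case: (X).
  have Q0 := piece_set_zero hx lo; have Qn := piece_set_one hx up.
  have Qr : Q i 1 by rewrite iE.
  have tq : turnable (g i 1) (g 0%N 0).
    apply: (@turnable_chain _ (f i 1) (f 0%N 0) _ (l i) (l 0%N)).
    - exact: pg Qr.
    - exact: pfi Qr.
    - exact: pfi Q0.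
    - exact: pg Q0.
    - exact: cgf Qr.
    - by rewrite iE; exact: cf0.
    - exact: cgf Q0.
    - exact: egf Qr.
    - exact: egf Q0.
    - by rewrite iE; exact: hk0.
  have [|||G [hG KG G1 G2]] := step _ _ Qr _ _ _ tq.
  - by rewrite piece_right_infinite // up andbF.
  - move=> i0; have [_ h] := @partition_interior _ _ _ _ hx i ltac:(by rewrite i0 hi).
    exact: h.
  - by move=> _ _; exact: ltr01.
  - by exists G => _; split.
have [G {exG}hG] := choice exG.
have match_ i : (i < n)%N -> G i (x i.+1) = G i.+1 (x i.+1).
  move=> hi; have [_ _ _ -> // _] := hG i (ltnW hi).
  by have [_ _ [-> // _] _ _] := hG i.+1 hi.
have gE := gluedE match_.
exists (glued G n); split; last first.
  move=> i hi; have [_ K _ _ _] := hG i hi.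
  apply: C0field_ext K; first exact: piece_closed.
  by move=> t Qt; rewrite (gE i).
have hgl : pfield [set` base X] (glued G n).
  split.
    move=> t /(base_pieces hx)[i hi Qt]; rewrite (gE i) //.
    by have [[p _] _ _ _ _] := hG i hi; exact: p.
  move=> u t bt e e0.
  apply: (@near_pieces _ X n x hx t
    (fun s => hnorm (glued G n s u - glued G n t u) <= e) bt).
  move=> i hi Qt; have [[_ s] _ _ _ _] := hG i hi.
  have [d d0 hd] := s u t Qt e e0; exists d => // r Qr lt.
  by rewrite !(gE i) //; exact: hd.
split; last by case: hgl.
split; first exact: pfield_Cb.
move=> hC; have lo : lower_end X by move: hC; case: (X).
have up : upper_end X by move: hC; case: (X).
have Q0 := piece_set_zero hx lo; have Qn := piece_set_one hx up.
rewrite (gE 0%N) // (gE n) //.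
have [_ _ [_ ->] // _ _] := hG 0%N (leq0n n).
by have [_ _ _ _ ->] := hG n (leqnn n).
Qed.

End Lifting.

Theorem theorem3p5 (R : realType) (H : hilbertType R)
    (Hsep : separable_hilbert H) (Hinf : infinite_dimensional H)
    (X : ground) (n : nat) (x : nat -> R) (f : nat -> R -> H -> H)
    (F : set (R -> H -> H)) :
  partition_points X n x ->
  corona_projection X F ->
  projection_lifting X n x f F ->
  let k i := esscodim (f i (x i)) (f i.-1 (x i)) in
  let k0 := esscodim (f 0%N 0) (f n 1) in
  (exists g : R -> H -> H, multiplier_projection X g /\ corona_pi X g = F)
  <->
  (exists l : nat -> int,
    [/\ (forall i, (1 <= i <= n)%N -> l i - l i.-1 = - k i) /\
          (is_circle X -> l 0%N - l n = - k0),
        forall i t, (i <= n)%N -> t \in piece X n x i ->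
          finite_rank (f i t) -> - (rank (f i t))%:Z <= l i,
        forall i t, (i <= n)%N -> t \in piece X n x i ->
          finite_rank (idfun \- f i t) -> l i <= (rank (idfun \- f i t))%:Z &
        forall i, (i <= n)%N ->
          left_infinite (piece X n x i) || right_infinite (piece X n x i) ->
          l i = 0]).
Proof.
move=> hx _ [[cbf cf cf0] -> pf] k k0.
have hf i : (i <= n)%N -> pfield (piece_set X n x i) (f i).
  by move=> hi; apply: Cb_pfield (cbf i hi) _ => t; exact: pf.
have kE i : (1 <= i <= n)%N -> k i = ec (f i (x i)) (f i.-1 (x i)).
  move=> hi; have /andP[i1 i2] := hi; apply: esscodimE => //.
  - by apply: pf => //; exact: piece_set_left.
  - apply: pf; first by lia.
    by have := @piece_set_right _ X n x hx i.-1; rewrite prednK //; apply.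
  - exact: cf.
have k0E : is_circle X -> k0 = ec (f 0%N 0) (f n 1).
  move=> hC; have lo : lower_end X by move: hC; case: (X).
  have up : upper_end X by move: hC; case: (X).
  apply: esscodimE => //; last exact: cf0.
  - by apply: pf => //; exact: piece_set_zero.
  - by apply: pf => //; exact: piece_set_one.
split=> [[g [mg gF]]|[l [[hk hk0] h2 h3 h4]]].
  have [] := admissible_of_lift hx hf mg.
    move=> i hi; apply/(C0KP _ (piece_closed _ _ _ i)).
    have := corona_pi_refl mg.1; rewrite gF => -[_]; exact.
  move=> l [[hk hk0] h2 h3 h4]; exists l; split=> //; split=> [i hi|hC].
    by rewrite hk // kE.
  by rewrite hk0 // k0E.
have [|g [mg hg]] := lift_of_admissible hx hf cf cf0 (l := l).
  split=> //; split=> [i hi|hC]; first by rewrite hk // kE.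
  by rewrite hk0 // k0E.
by exists g; split=> //; apply: corona_pi_represented => //; exact: mg.1.
Qed.
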